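(* Fix $0<\gamma<1-\gamma'<1$ and $\eta>0$. There exists $\varepsilon=\varepsilon(\gamma,\gamma',\eta)>0$ such that for every Borel set $A\subseteq[0,1]^2$ with $\lambda(A)\in[\gamma,1-\gamma']$ there exists a bijection $\phi:[0,1]^2\to[0,1]^2$ such that (1) $\phi$ is $(1+\eta)$-bi-Lipschitz, i.e. $\frac{1}{1+\eta}|x-y|\le|\phi(x)-\phi(y)|\le(1+\eta)|x-y|$ for all $x,y\in[0,1]^2$; (2) $\phi(x)=x$ for all $x\in\partial[0,1]^2$; (3) $\lambda(\phi(A))\ge\lambda(A)+\varepsilon$.
   Context: $\lambda$ denotes two-dimensional Lebesgue measure; $|\cdot|$ is the Euclidean norm on $\mathbb{R}^2$. *)

(* Defs.v *)
From Stdlib Require Import Reals Lra.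
Open Scope R_scope.

Definition pt := (R * R)%type.

Definition dist2 (x y : pt) : R :=
  sqrt ((fst x - fst y)^2 + (snd x - snd y)^2).

Definition in_square (x : pt) : Prop :=
  0 <= fst x <= 1 /\ 0 <= snd x <= 1.

Definition on_boundary (x : pt) : Prop :=
  in_square x /\ (fst x = 0 \/ fst x = 1 \/ snd x = 0 \/ snd x = 1).

Definition open2 (U : pt -> Prop) : Prop :=
  forall x, U x -> exists r, 0 < r /\ forall y, dist2 x y < r -> U y.

Inductive borel2 : (pt -> Prop) -> Prop :=
  | borel_open : forall U, open2 U -> borel2 U
  | borel_compl : forall A, borel2 A -> borel2 (fun x => ~ A x)
  | borel_cunion : forall F : nat -> pt -> Prop,
      (forall n, borel2 (F n)) -> borel2 (fun x => exists n, F n x).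

Record rect := mkRect { ra : R; rb : R; rc : R; rd : R }.
Definition rect_ok (r : rect) : Prop := ra r <= rb r /\ rc r <= rd r.
Definition in_rect (r : rect) (x : pt) : Prop :=
  ra r <= fst x <= rb r /\ rc r <= snd x <= rd r.
Definition area (r : rect) : R := (rb r - ra r) * (rd r - rc r).

Definition cover_value (A : pt -> Prop) (s : R) : Prop :=
  exists C : nat -> rect,
    (forall n, rect_ok (C n)) /\
    (forall x, A x -> exists n, in_rect (C n) x) /\
    infinite_sum (fun n => area (C n)) s.

(* lebesgue2 A m : the two-dimensional Lebesgue (outer) measure of A is m
   (infimum of total areas of countable rectangle covers). On Borel sets this
   is Lebesgue measure lambda. *)
Definition lebesgue2 (A : pt -> Prop) (m : R) : Prop :=
  (forall s, cover_value A s -> m <= s) /\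
  (forall m', (forall s, cover_value A s -> m' <= s) -> m' <= m).

Definition image (phi : pt -> pt) (A : pt -> Prop) : pt -> Prop :=
  fun y => exists x, A x /\ y = phi x.

Definition square_bijection (phi : pt -> pt) : Prop :=
  (forall x, in_square x -> in_square (phi x)) /\
  (forall x y, in_square x -> in_square y -> phi x = phi y -> x = y) /\
  (forall y, in_square y -> exists x, in_square x /\ phi x = y).

(* Main.v *)
(** The map is a horizontal shear [(x, y) |-> (x + t U(x, y), y)], or a vertical one, with [U] Lipschitz and
    zero on the boundary.  It suffices that the integral of [dU/dx] over the complement of [A] is at most a
    negative constant: then the image of the complement loses a fixed amount of area, and the image of [A]
    gains it.  Carathéodory-type approximation replaces the complement by a union [G] of cells of a dyadic grid.

    On the grid, let [w] solve the Neumann problem [Lap w = 1_G - |G|].  The integrals of [1_G - |G|] against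
    [d^2 w / dx^2] and [d^2 w / dy^2] add up to [|G| (1 - |G|)], so one of them is large; say the first, and put
    [u = dw/dx].  Summation by parts bounds the gradient of [u] in L^2, and [u] vanishes on the vertical
    sides.  Multiplying [u] by a cutoff in [y] makes it vanish on all sides, at a cost that is small by
    Cauchy-Schwarz.  Finally [u] agrees with a Lipschitz function [U] off a set of area O(1 / L^2), where [L]
    is the Lipschitz constant: one removes the dyadic squares on which the mean of [|grad u|^2] exceeds
    [L^2], and extends from the rest by McShane's formula.  On the removed set [dU/dx] is at most [L], so the
    loss is O(1 / L), uniformly in the grid. *)

Require Import Defs.
From Stdlib Require Import Reals Lra Lia Arith ZArith Classical ClassicalEpsilon Cantor.
From HB Require structures.
From mathcomp Require all_boot all_order all_algebra archimedean ring lra zify Rstruct.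
Open Scope R_scope.

(** The gain may depend only on [gamma], [gamma'] and [eta], while [A] and its complement can be
    mixed at arbitrarily small scales; so all constants are fixed before the level of the grid is
    known. The flux u itself cannot serve as U: second derivatives of w are singular integrals of a
    bounded function, controlled in L^2 but not pointwise. The Neumann condition is chosen because
    it makes u vanish on two opposite sides by itself, which leaves only two sides to the cutoff.

    For images only upper bounds of outer measures are computed; the one lower bound is that the
    square has outer measure at least 1. The images of [A], of the grid set and of a small error set
    cover the square, so subadditivity turns the loss on the complement into a gain for [A].

    The grid carrying u is finer than that of G. This makes room for the cutoff strips. It also
    absorbs a mismatch: the mean over a cell of the derivative of the bilinear interpolation
    involves two neighbouring rows of differences, the discrete argument only one. *)

Module Discrete.
Import structures all_boot all_order all_algebra archimedean ring lra zify.
Import Order.TTheory GRing.Theory Num.Theory.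
Set Implicit Arguments.
Unset Strict Implicit.
Unset Printing Implicit Defensive.
Local Open Scope ring_scope.

(** * The discrete Neumann problem *)

Section Neumann.
Variable R : realFieldType.
Implicit Types (f w : nat -> nat -> R).

Definition xdiff f i j := f i.+1 j - f i j.
Definition ydiff f i j := f i j.+1 - f i j.
Definition gsum (N : nat) f := \sum_(i < N) \sum_(j < N) f i j.

(** The flux across the edge between columns [i.-1] and [i]; its zeros at [i = 0] and for [N <= i]
    are the discrete Neumann condition. *)
Definition xflux N w i j := if (0 < i < N)%N then w i j - w i.-1 j else 0.
Definition yflux N w i j := if (0 < j < N)%N then w i j - w i j.-1 else 0.
Definition laplacian N w i j := xdiff (xflux N w) i j + ydiff (yflux N w) i j.

Lemma sum_by_parts (p b : nat -> R) n : p 0%N = 0 ->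
  \sum_(i < n) (p i.+1 - p i) * b i =
  p n * b n.-1 - \sum_(i < n) p i * (b i - b i.-1).
Proof.
move=> p0; elim: n => [|n IH]; first by rewrite !big_ord0 p0 mul0r subr0.
by rewrite !big_ord_recr /= IH; ring.
Qed.

Lemma gsum_transpose N f : gsum N f = gsum N (fun i j => f j i).
Proof. exact: exchange_big. Qed.

Lemma gsumD N f g : gsum N (fun i j => f i j + g i j) = gsum N f + gsum N g.
Proof. by rewrite /gsum -big_split /=; apply: eq_bigr => i _; rewrite big_split. Qed.

Lemma gsumZ N a f : gsum N (fun i j => a * f i j) = a * gsum N f.
Proof. by rewrite /gsum mulr_sumr; apply: eq_bigr => i _; rewrite mulr_sumr. Qed.

Lemma gsumN N f : gsum N (fun i j => - f i j) = - gsum N f.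
Proof. by rewrite -mulN1r -gsumZ; do 2!apply: eq_bigr => ? _; rewrite mulN1r. Qed.

Lemma gsumB N f g : gsum N (fun i j => f i j - g i j) = gsum N f - gsum N g.
Proof. by rewrite gsumD gsumN. Qed.

Lemma eq_gsum N f g : (forall i j, (i < N)%N -> (j < N)%N -> f i j = g i j) ->
  gsum N f = gsum N g.
Proof. by move=> e; apply: eq_bigr => i _; apply: eq_bigr => j _; apply: e. Qed.

Lemma le_gsum N f g : (forall i j, (i < N)%N -> (j < N)%N -> f i j <= g i j) ->
  gsum N f <= gsum N g.
Proof. by move=> e; apply: ler_sum => i _; apply: ler_sum => j _; apply: e. Qed.

Lemma gsum_const N a : gsum N (fun _ _ => a) = a * N%:R ^+ 2.
Proof. by rewrite /gsum !sumr_const !card_ord -mulrnA -[LHS]mulr_natr natrM expr2. Qed.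

Lemma gsum_ge0 N f : (forall i j, (i < N)%N -> (j < N)%N -> 0 <= f i j) -> 0 <= gsum N f.
Proof. by move=> h; do 2!apply: sumr_ge0 => ? _; apply: h. Qed.

Lemma gsum_eq0 N f : (forall i j, (i < N)%N -> (j < N)%N -> 0 <= f i j) ->
  gsum N f = 0 -> forall i j, (i < N)%N -> (j < N)%N -> f i j = 0.
Proof.
move=> h /eqP; rewrite psumr_eq0; last by move=> i _; apply: sumr_ge0 => j _; exact: h.
move=> /allP h1 i j iN jN.
have /= := h1 (Ordinal iN) (mem_index_enum _); rewrite psumr_eq0; last by move=> k _; exact: h.
by move=> /allP h2; apply/eqP; exact: (h2 (Ordinal jN) (mem_index_enum _)).
Qed.

Lemma xfluxN N w j : xflux N w N j = 0.
Proof. by rewrite /xflux ltnn andbF. Qed.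

Lemma xflux_parts N w f :
  gsum N (fun i j => xdiff (xflux N w) i j * f i j) =
  - gsum N (fun i j => xflux N w i j * (f i j - f i.-1 j)).
Proof.
rewrite ![gsum _ _]exchange_big /= -sumrN; apply: eq_bigr => j _.
by rewrite /xdiff (@sum_by_parts (fun i => xflux N w i j) (fun i => f i j)) // xfluxN mul0r sub0r.
Qed.

Lemma yflux_parts N w f :
  gsum N (fun i j => ydiff (yflux N w) i j * f i j) =
  - gsum N (fun i j => yflux N w i j * (f i j - f i j.-1)).
Proof.
by rewrite [LHS]gsum_transpose [in RHS]gsum_transpose; apply: (@xflux_parts N (fun i j => w j i) (fun i j => f j i)).
Qed.

(** Green's first identity: the flux vanishes on the boundary, so summation by parts leaves no
    boundary term, and away from the boundary the flux is the very difference of [w] with which it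
    gets paired. *)
Lemma dirichlet_energy N w :
  gsum N (fun i j => laplacian N w i j * w i j) =
  - gsum N (fun i j => xflux N w i j ^+ 2 + yflux N w i j ^+ 2).
Proof.
rewrite gsumD opprD.
have -> : gsum N (fun i j => laplacian N w i j * w i j) =
  gsum N (fun i j => xdiff (xflux N w) i j * w i j) +
  gsum N (fun i j => ydiff (yflux N w) i j * w i j).
  by rewrite -gsumD; apply: eq_gsum => i j _ _; rewrite mulrDl.
rewrite xflux_parts yflux_parts; congr (- _ - _); apply: eq_gsum => i j iN jN.
  by rewrite /xflux iN andbT; case: i iN => [|i] _ /=; rewrite ?mul0r ?expr0n // expr2.
by rewrite /yflux jN andbT; case: j jN => [|j] _ /=; rewrite ?mul0r ?expr0n // expr2.
Qed.

Lemma gsum_laplacian N w : gsum N (laplacian N w) = 0.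
Proof.
have hx : gsum N (fun i j => xdiff (xflux N w) i j * 1) = 0.
  by rewrite xflux_parts -gsumN -[RHS](mul0r (N%:R ^+ 2)) -gsum_const; apply: eq_gsum => i j _ _; ring.
have hy : gsum N (fun i j => ydiff (yflux N w) i j * 1) = 0.
  by rewrite yflux_parts -gsumN -[RHS](mul0r (N%:R ^+ 2)) -gsum_const; apply: eq_gsum => i j _ _; ring.
rewrite -[RHS]addr0 -{1}hx -hy -gsumD; apply: eq_gsum => i j _ _; rewrite /laplacian; ring.
Qed.

(** Zero energy makes [w] constant along rows and columns, and the zero sum then kills the
    constant. *)
Lemma laplacian_inj N w : gsum N w = 0 ->
  (forall i j, (i < N)%N -> (j < N)%N -> laplacian N w i j = 0) ->
  forall i j, (i < N)%N -> (j < N)%N -> w i j = 0.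
Proof.
move=> w0 lap0.
have /esym/eqP := dirichlet_energy N w.
rewrite (@eq_gsum _ (fun i j => _ * _) (fun _ _ => 0)); last by move=> i j iN jN; rewrite lap0 ?mul0r.
rewrite gsum_const mul0r oppr_eq0 => /eqP /gsum_eq0 h.
have {}h i j : (i < N)%N -> (j < N)%N -> xflux N w i j = 0 /\ yflux N w i j = 0.
  move=> iN jN; have /eqP := h (fun i j _ _ => addr_ge0 (sqr_ge0 _) (sqr_ge0 _)) i j iN jN.
  by rewrite paddr_eq0 ?sqr_ge0 // !sqrf_eq0 => /andP[/eqP -> /eqP ->].
have hx i j : (i < N)%N -> (j < N)%N -> w i j = w 0%N j.
  elim: i => // i IH iN jN; rewrite -IH //; last exact: ltnW.
  by have [] := h _ _ iN jN; rewrite /xflux iN /= => /eqP; rewrite subr_eq0 => /eqP.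
have hy j : (j < N)%N -> w 0%N j = w 0%N 0%N.
  elim: j => // j IH jN; rewrite -IH //; last exact: ltnW.
  have N0 : (0 < N)%N by lia.
  by have [_] := h _ _ N0 jN; rewrite /yflux jN /= => /eqP; rewrite subr_eq0 => /eqP.
move=> i j iN jN; rewrite hx // hy //.
move: w0; rewrite (@eq_gsum _ _ (fun _ _ => w 0%N 0%N)); last by move=> a b aN bN; rewrite hx // hy.
move/eqP; rewrite gsum_const mulf_eq0 sqrf_eq0 pnatr_eq0 => /orP[/eqP//|/eqP N0].
by rewrite N0 in iN.
Qed.

Lemma neumann_solution N f : gsum N f = 0 ->
  exists w, forall i j, (i < N)%N -> (j < N)%N -> laplacian N w i j = f i j.
Proof.
case: N => [|n] f0; first by exists f.
set N := n.+1 in f0 *.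
pose wn (W : 'M[R]_N) i j := W (inord i) (inord j).
(* Subtracting the sum of [W] removes the constants from the kernel, so the operator is injective,
   hence bijective in finite dimension. Since Laplacians sum to zero, the preimage of a sum-zero [f]
   has sum zero, and for it the correction disappears. *)
pose L (W : 'M[R]_N) : 'M[R]_N := \matrix_(i, j) (laplacian N (wn W) i j - gsum N (wn W)).
have wnl a U V i j : wn (a *: U + V) i j = a * wn U i j + wn V i j by rewrite /wn !mxE.
have lapl a U V i j : laplacian N (wn (a *: U + V)) i j =
    a * laplacian N (wn U) i j + laplacian N (wn V) i j.
  rewrite /laplacian /xdiff /ydiff /xflux /yflux !wnl.
  by do 4!case: ifP => _; ring.
have linL : linear L.
  move=> a U V; apply/matrixP => i j; rewrite !mxE lapl.
  rewrite (@eq_gsum _ _ (fun i j => a * wn U i j + wn V i j)); last by move=> *; rewrite wnl.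
  by rewrite gsumD gsumZ; ring.
pose Ll : {linear 'M[R]_N -> 'M[R]_N} := HB.pack L (GRing.isLinear.Build _ _ _ _ L linL).
have LE W i j : (i < N)%N -> (j < N)%N -> Ll W (inord i) (inord j) = laplacian N (wn W) i j - gsum N (wn W).
  by move=> iN jN; rewrite /= mxE !inordK.
have sumL W : gsum N (wn (Ll W)) = - gsum N (wn W) * N%:R ^+ 2.
  rewrite (eq_gsum (g := fun i j => laplacian N (wn W) i j - gsum N (wn W))); last by move=> *; apply: LE.
  by rewrite gsumB gsum_laplacian gsum_const sub0r mulNr.
have N2 : N%:R ^+ 2 != 0 :> R by rewrite sqrf_eq0 pnatr_eq0.
have ker0 : lker (linfun Ll) == 0%VS.
  rewrite -subv0; apply/subvP => W; rewrite memv_ker lfunE => /eqP W0; rewrite memv0.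
  have s0 : gsum N (wn W) = 0.
    have /eqP := sumL W; rewrite W0 (eq_gsum (g := fun _ _ => 0)); last by move=> *; rewrite /wn mxE.
    by rewrite gsum_const mul0r eq_sym mulf_eq0 (negPf N2) orbF oppr_eq0 => /eqP.
  apply/eqP/matrixP => i j; rewrite mxE.
  have := @laplacian_inj N (wn W) s0 _ i j (ltn_ord i) (ltn_ord j).
  rewrite /wn !inord_val; apply=> k l kN lN.
  by have := LE W k l kN lN; rewrite W0 mxE s0 subr0.
pose F : 'M[R]_N := \matrix_(i, j) f i j.
have FE i j : (i < N)%N -> (j < N)%N -> wn F i j = f i j by move=> iN jN; rewrite /wn mxE !inordK.
exists (wn ((linfun Ll)^-1%VF F)) => i j iN jN.
set W := (_^-1)%VF F.
have LW : Ll W = F.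
  by have := lker0_lfunVK ker0 F; rewrite lfunE.
have s0 : gsum N (wn W) = 0.
  have /eqP := sumL W; rewrite LW (eq_gsum FE) f0.
  by rewrite eq_sym mulf_eq0 (negPf N2) orbF oppr_eq0 => /eqP.
by have := LE W i j iN jN; rewrite LW s0 subr0 -FE.
Qed.

(* The cross term of [laplacian ^ 2] is summed by parts in both directions and becomes the square of the mixed difference. *)
Lemma hessian_energy N w :
  gsum N (fun i j => laplacian N w i j ^+ 2) =
  gsum N (fun i j => xdiff (xflux N w) i j ^+ 2) + gsum N (fun i j => ydiff (yflux N w) i j ^+ 2)
  + gsum N (fun i j => (xflux N w i j - xflux N w i j.-1) ^+ 2) *+ 2.
Proof.
have cross : gsum N (fun i j => xdiff (xflux N w) i j * ydiff (yflux N w) i j) =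
    gsum N (fun i j => (xflux N w i j - xflux N w i j.-1) ^+ 2).
  rewrite xflux_parts.
  pose r i j : R := if ((0 < i < N) && (0 < j < N))%N then
    w i j - w i.-1 j - (w i j.-1 - w i.-1 j.-1) else 0.
  rewrite (@eq_gsum _ _ (fun i j => - (ydiff r i j * - xflux N w i j) )).
    rewrite gsumN opprK.
    rewrite /gsum; apply: eq_bigr => i _; rewrite /ydiff.
    rewrite (@sum_by_parts (fun j => r i j) (fun j => - xflux N w i j)); last first.
      by rewrite /r andbF.
    have -> : r i N = 0 by rewrite /r ltnn !andbF.
    rewrite mul0r sub0r -sumrN; apply: eq_bigr => j _.
    rewrite /r /xflux !ltn_ord !andbT; case: (posnP i) => i0 /=; first by ring.
    case: (posnP j) => j0 /=; first by rewrite j0 /=; ring.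
    by ring.
  move=> i j iN jN; rewrite mulrN opprK mulrC.
  case: (posnP i) => i0; first by rewrite /xflux i0 /= !mulr0.
  congr (_ * _); rewrite /ydiff /yflux /r i0 iN jN !andbT /=.
  by case: ifP => _; case: ifP => _ /=; ring.
rewrite -cross -mulr_natr -[_ * 2%:R]mulrC -gsumZ -!gsumD; apply: eq_gsum => i j _ _.
by rewrite /laplacian; ring.
Qed.

End Neumann.

(** * Lipschitz truncation *)

Section DyadicBoxes.
Variable R : realFieldType.
Implicit Types (g v : nat -> nat -> R).

Definition box k a b g := \sum_(i < 2 ^ k) \sum_(j < 2 ^ k) g (a * 2 ^ k + i)%N (b * 2 ^ k + j)%N.

Lemma box_transpose k a b g : box k a b g = box k b a (fun i j => g j i).
Proof. exact: exchange_big. Qed.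

Lemma sum_dyadic_split (F : nat -> R) k a :
  \sum_(i < 2 ^ k.+1) F (a * 2 ^ k.+1 + i)%N =
  \sum_(i < 2 ^ k) F (a.*2 * 2 ^ k + i)%N + \sum_(i < 2 ^ k) F (a.*2.+1 * 2 ^ k + i)%N.
Proof.
rewrite expnS mul2n -addnn big_split_ord /=.
by congr (_ + _); apply: eq_bigr => i _; congr F; lia.
Qed.

Lemma box_split k a b g : box k.+1 a b g =
  box k a.*2 b.*2 g + box k a.*2 b.*2.+1 g + (box k a.*2.+1 b.*2 g + box k a.*2.+1 b.*2.+1 g).
Proof.
rewrite /box (sum_dyadic_split (fun i => \sum_(j < 2 ^ k.+1) g i (b * 2 ^ k.+1 + j)%N)).
by congr (_ + _); rewrite -big_split /=; apply: eq_bigr => i _; rewrite (sum_dyadic_split (g _)).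
Qed.

Lemma le_box k a b g1 g2 : (forall i j, g1 i j <= g2 i j) -> box k a b g1 <= box k a b g2.
Proof. by move=> h; do 2!apply: ler_sum => ? _. Qed.

Lemma boxZ k a b c g : box k a b (fun i j => c * g i j) = c * box k a b g.
Proof. by rewrite /box mulr_sumr; apply: eq_bigr => i _; rewrite mulr_sumr. Qed.

Lemma boxD k a b g1 g2 : box k a b (fun i j => g1 i j + g2 i j) = box k a b g1 + box k a b g2.
Proof. by rewrite /box -big_split /=; apply: eq_bigr => i _; rewrite big_split. Qed.

Lemma box_const k a b c : box k a b (fun _ _ => c) = c * 4 ^+ k.
Proof.
rewrite /box !sumr_const !card_ord -mulrnA -[LHS]mulr_natr; congr (_ * _).
by rewrite natrM natrX -exprMn -natrM.
Qed.

Lemma norm_diff_le_variation (h : nat -> R) M i m : (i <= m)%N -> (m <= M)%N ->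
  `|h m - h i| <= \sum_(t < M) `|h t.+1 - h t|.
Proof.
elim: M i m => [|M IH] i m im mM.
  have -> : m = i by lia.
  by rewrite subrr normr0 big_ord0.
rewrite big_ord_recr /=; case: (ltnP M m) => mM'; last first.
  by rewrite (le_trans (IH _ _ im mM')) // lerDl.
have -> : m = M.+1 by lia.
case: (ltnP M i) => iM.
  have -> : i = M.+1 by lia.
  by rewrite subrr normr0 addr_ge0 // sumr_ge0.
have := IH i M iM (leqnn _) => h1.
have -> : h M.+1 - h i = (h M - h i) + (h M.+1 - h M) by ring.
by rewrite (le_trans (ler_normD _ _)) // lerD2r.
Qed.

(** Points at horizontal distance [2 ^ k] are paired. Their difference is at most the variation of
    [v] along the row through both boxes, and each row holds [2 ^ k] pairs. *)
Lemma box_adjacent_x k a b v :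
  `|box k a.+1 b v - box k a b v| <=
  2 ^+ k * (box k a b (fun i j => `|xdiff v i j|) + box k a.+1 b (fun i j => `|xdiff v i j|)).
Proof.
rewrite (box_transpose k a b v) (box_transpose k a.+1 b v).
rewrite (box_transpose k a b (fun i j => `|_|)) (box_transpose k a.+1 b (fun i j => `|_|)).
rewrite /box -sumrB -big_split /= (le_trans (ler_norm_sum _ _ _)) // mulr_sumr.
apply: ler_sum => j _; rewrite -sumrB.
set s := (2 ^ k)%N; pose h t := v (a * s + t)%N (b * s + j)%N.
have -> : 2 ^+ k = s%:R :> R by rewrite natrX.
have -> : \sum_(t < s) `|xdiff v (a * s + t)%N (b * s + j)%N| +
    \sum_(t < s) `|xdiff v (a.+1 * s + t)%N (b * s + j)%N| = \sum_(t < s + s) `|h t.+1 - h t|.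
  rewrite big_split_ord /=; congr (_ + _); apply: eq_bigr => t _; rewrite /xdiff /h.
    by rewrite addnS.
  by congr (`| _ - _|); congr (v _ _); lia.
pose V := \sum_(t < s + s) `|h t.+1 - h t|; rewrite -/V; apply: le_trans (ler_norm_sum _ _ _) _.
have {}hV i : (i < s)%N -> `|h (s + i)%N - h i| <= V.
  by move=> si; apply: (norm_diff_le_variation h); lia.
apply: (le_trans (y := \sum_(i < s) V)); last by rewrite sumr_const card_ord mulr_natl.
apply: ler_sum => i _; have -> : (a.+1 * s + i = a * s + (s + i))%N by rewrite mulSn; lia.
exact: hV.
Qed.

Definition grad2 v i j := xdiff v i j ^+ 2 + ydiff v i j ^+ 2.

Definition good_box l v k a b := box k a b (grad2 v) <= l ^+ 2 * 4 ^+ k.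

Lemma norm_le_amgm (l d : R) : 0 < l -> `|d| <= l / 2 + (2 * l)^-1 * d ^+ 2.
Proof.
move=> l0; rewrite -(real_normK (num_real d)); set x := `|d|.
have -> : (2 * l)^-1 * x ^+ 2 = x ^+ 2 / l / 2 by field; rewrite gt_eqF.
have h : x * l * 2 <= l ^+ 2 + x ^+ 2 by have := sqr_ge0 (x - l); rewrite sqrrB; lra.
have : x * 2 <= l + x ^+ 2 / l.
  rewrite -(ler_pM2r l0) mulrDl mulfVK ?gt_eqF //; move: h; rewrite expr2; lra.
lra.
Qed.

(** Cauchy-Schwarz in its AM-GM form with weight [l]: a real field need not contain square roots. *)
Lemma good_box_diff l v k a b (d : nat -> nat -> R) : 0 < l ->
  (forall i j, d i j ^+ 2 <= grad2 v i j) -> good_box l v k a b ->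
  box k a b (fun i j => `|d i j|) <= l * 4 ^+ k.
Proof.
move=> l0 dg gd; apply: (le_trans (y := box k a b (fun i j => l / 2 + (2 * l)^-1 * grad2 v i j))).
  apply: le_box => i j; apply: le_trans (norm_le_amgm _ l0) _.
  by rewrite lerD2l ler_pM2l ?invr_gt0 ?mulr_gt0.
rewrite boxD box_const boxZ.
have h : (2 * l)^-1 * box k a b (grad2 v) <= (2 * l)^-1 * (l ^+ 2 * 4 ^+ k).
  by rewrite ler_pM2l ?invr_gt0 ?mulr_gt0.
have e : (2 * l)^-1 * (l ^+ 2 * 4 ^+ k) = l / 2 * 4 ^+ k by field; rewrite gt_eqF.
rewrite e in h; apply: (le_trans (y := l / 2 * 4 ^+ k + l / 2 * 4 ^+ k)); last by lra.
by rewrite lerD2l.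
Qed.

(** After division by the number [4 ^+ k] of points, this says that adjacent means differ by at most
    [2 * l] times the side [2 ^+ k]. *)
Lemma good_adjacent_x l v k a b : 0 < l -> good_box l v k a b -> good_box l v k a.+1 b ->
  `|box k a.+1 b v - box k a b v| <= 2 * l * 8 ^+ k.
Proof.
move=> l0 g1 g2; apply: le_trans (box_adjacent_x _ _ _ _) _.
have dg i j : xdiff v i j ^+ 2 <= grad2 v i j by rewrite lerDl sqr_ge0.
have h1 := good_box_diff l0 dg g1; have h2 := good_box_diff l0 dg g2.
have -> : 8 ^+ k = 2 ^+ k * 4 ^+ k :> R by rewrite -exprMn -natrM.
have -> : 2 * l * (2 ^+ k * 4 ^+ k) = 2 ^+ k * (l * 4 ^+ k + l * 4 ^+ k) by ring.
by rewrite ler_pM2l ?exprn_gt0 // lerD.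
Qed.

Lemma good_box_transpose l v k a b : good_box l v k a b = good_box l (fun i j => v j i) k b a.
Proof.
rewrite /good_box box_transpose; congr (_ <= _); apply: eq_bigr => i _; apply: eq_bigr => j _.
by rewrite /grad2 addrC.
Qed.

Lemma good_adjacent_y l v k a b : 0 < l -> good_box l v k a b -> good_box l v k a b.+1 ->
  `|box k a b.+1 v - box k a b v| <= 2 * l * 8 ^+ k.
Proof.
move=> l0; rewrite (good_box_transpose _ _ _ a b) (good_box_transpose _ _ _ a b.+1).
rewrite (box_transpose k a b v) (box_transpose k a b.+1 v); exact: good_adjacent_x.
Qed.

Definition near (a c : nat) := ((a <= c.+1) && (c <= a.+1))%N.

Lemma good_near l v k a b a' b' : 0 < l -> near a a' -> near b b' ->
  (forall c d, near a c -> near b d -> good_box l v k c d) ->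
  `|box k a b v - box k a' b' v| <= ((a != a') + (b != b'))%:R * (2 * l * 8 ^+ k).
Proof.
move=> l0 na nb hg.
have hx : `|box k a b v - box k a' b v| <= (a != a')%:R * (2 * l * 8 ^+ k).
  have nb0 : near b b by rewrite /near leqnSn.
  have [->|] := eqVneq a a'; first by rewrite subrr normr0 mul0r.
  rewrite mul1r => ne; have /orP[/eqP e|/eqP e] : (a' == a.+1) || (a == a'.+1).
    by move: na ne; rewrite /near; lia.
  - rewrite distrC e; apply: good_adjacent_x => //; apply: hg => //; rewrite /near; lia.
  - rewrite e; apply: good_adjacent_x => //; apply: hg => //; rewrite /near; lia.
have hy : `|box k a' b v - box k a' b' v| <= (b != b')%:R * (2 * l * 8 ^+ k).
  have [->|] := eqVneq b b'; first by rewrite subrr normr0 mul0r.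
  rewrite mul1r => ne; have /orP[/eqP e|/eqP e] : (b' == b.+1) || (b == b'.+1).
    by move: nb ne; rewrite /near; lia.
  - rewrite distrC e; apply: good_adjacent_y => //; apply: hg => //; rewrite /near; lia.
  - rewrite e; apply: good_adjacent_y => //; apply: hg => //; rewrite /near; lia.
have -> : box k a b v - box k a' b' v = (box k a b v - box k a' b v) + (box k a' b v - box k a' b' v) by ring.
by rewrite natrD mulrDl (le_trans (ler_normD _ _)) // lerD.
Qed.

Lemma half_cases (m : nat) : ((m != m./2.*2) + (m != m./2.*2.+1) = 1)%N.
Proof. lia. Qed.

Lemma box_ge0 k a b g : (forall i j, 0 <= g i j) -> 0 <= box k a b g.
Proof. by move=> h; do 2!apply: sumr_ge0 => ? _. Qed.

(** The parent's mean is the average of the means of its four children, each reached from [(a, b)]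
    by at most two steps between adjacent good boxes. *)
Lemma good_parent l v k a b : 0 < l ->
  (forall c d, near a c -> near b d -> good_box l v k c d) ->
  `|box k a b v / 4 ^+ k - box k.+1 a./2 b./2 v / 4 ^+ k.+1| <= 2 * l * 2 ^+ k.
Proof.
move=> l0 hg.
have e4 : (4 : R) ^+ k != 0 by rewrite expf_neq0 ?pnatr_eq0.
have -> : box k a b v / 4 ^+ k - box k.+1 a./2 b./2 v / 4 ^+ k.+1 =
   (4 * box k a b v - box k.+1 a./2 b./2 v) / 4 ^+ k.+1.
  by rewrite exprS; field.
have p4 : 0 < (4 : R) ^+ k.+1 by rewrite exprn_gt0.
rewrite normrM (gtr0_norm (x := _^-1)) ?invr_gt0 //.
rewrite ler_pdivrMr //.
have -> : 2 * l * 2 ^+ k * 4 ^+ k.+1 = 8 * (l * 8 ^+ k).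
  have -> : 8 ^+ k = 2 ^+ k * 4 ^+ k :> R by rewrite -exprMn -natrM.
  by rewrite exprS; ring.
set X := l * 8 ^+ k.
rewrite box_split.
have near2 c : (c == a./2.*2) || (c == a./2.*2.+1) -> near a c by rewrite /near; lia.
have near2' c : (c == b./2.*2) || (c == b./2.*2.+1) -> near b c by rewrite /near; lia.
have H c d : (c == a./2.*2) || (c == a./2.*2.+1) -> (d == b./2.*2) || (d == b./2.*2.+1) ->
  `|box k a b v - box k c d v| <= ((a != c) + (b != d))%:R * (2 * X).
  move=> hc hd; have := good_near l0 (near2 _ hc) (near2' _ hd) hg.
  by rewrite /X [2 * (l * _)]mulrA.
have X0 : 0 <= X by rewrite mulr_ge0 ?exprn_ge0 // ltW.
have := H a./2.*2 b./2.*2; rewrite !eqxx /= => /(_ isT isT) h1.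
have := H a./2.*2.+1 b./2.*2; rewrite !eqxx orbT /= => /(_ isT isT) h2.
have := H a./2.*2 b./2.*2.+1; rewrite !eqxx orbT /= => /(_ isT isT) h3.
have := H a./2.*2.+1 b./2.*2.+1; rewrite !eqxx !orbT /= => /(_ isT isT) h4.
(* The siblings are 0, 1, 1 and 2 steps away from [(a, b)]; these 4 steps of [2 * X] each give the
   [8 * X] of the goal. *)
have cnt : (((a != a./2.*2) + (b != b./2.*2)) + ((a != a./2.*2.+1) + (b != b./2.*2)) +
   (((a != a./2.*2) + (b != b./2.*2.+1)) + ((a != a./2.*2.+1) + (b != b./2.*2.+1))) = 4)%N.
  move: (half_cases a) (half_cases b); do 4!move: (nat_of_bool (_ != _)).
  by clear; lia.
have {}cnt := congr1 (fun n => n%:R * (2 * X) : R) cnt.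
rewrite !natrD !mulrDl in cnt h1 h2 h3 h4.
move: h1 h2 h3 h4; rewrite !ler_norml => /andP[? ?] /andP[? ?] /andP[? ?] /andP[? ?].
by apply/andP; split; lra.
Qed.

Definition avg k v i j := box k (i %/ 2 ^ k) (j %/ 2 ^ k) v / 4 ^+ k.

Lemma good_avg l v i j K : 0 < l ->
  (forall k c d, (k < K)%N -> near (i %/ 2 ^ k) c -> near (j %/ 2 ^ k) d -> good_box l v k c d) ->
  `|v i j - avg K v i j| <= 2 * l * 2 ^+ K.
Proof.
(* The sharper bound is the geometric sum of [2 * l * 2 ^+ k] over [k < K], which is what the
   induction can carry. *)
move=> l0 hg; suff : `|v i j - avg K v i j| <= 2 * l * (2 ^+ K - 1).
  by move/le_trans; apply; rewrite ler_pM2l ?mulr_gt0 //; lra.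
elim: K hg => [|K IH] hg.
  rewrite /avg /box expn0 !divn1 !big_ord1 expr0 divr1 !muln1 !addn0 !subrr normr0; lra.
have {}IH := IH (fun k c d kK => hg k c d (leqW kK)).
have h := good_parent l0 (fun c d => hg K c d (ltnSn K)).
have e : forall m, ((m %/ 2 ^ K)./2 = m %/ 2 ^ K.+1)%N.
  by move=> m; rewrite -divn2 -divnMA expnSr.
rewrite !e -!/(avg _ _ _ _) in h.
have -> : v i j - avg K.+1 v i j = (v i j - avg K v i j) + (avg K v i j - avg K.+1 v i j) by ring.
apply: le_trans (ler_normD _ _) _.
by rewrite exprS; move: IH h; rewrite /avg; lra.
Qed.

End DyadicBoxes.

(** * Counting the points near bad dyadic squares *)

Section BadSet.
Variable R : realFieldType.
Variables (l : R) (v : nat -> nat -> R).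

(** The dyadic interval of length [2 ^ k] at position [a], enlarged by its own length on both sides.
    The left end is written additively because subtraction on [nat] truncates. *)
Definition bnear (k a i : nat) := ((a * 2 ^ k <= i + 2 ^ k) && (i < a.+2 * 2 ^ k))%N.

(* The union of the tripled maximal bad dyadic subsquares of a dyadic square. *)
Fixpoint bad_nbhd (k a b i j : nat) : bool :=
  if ~~ good_box l v k a b then bnear k a i && bnear k b j else
  if k is k'.+1 then
    [|| bad_nbhd k' a.*2 b.*2 i j, bad_nbhd k' a.*2 b.*2.+1 i j,
        bad_nbhd k' a.*2.+1 b.*2 i j | bad_nbhd k' a.*2.+1 b.*2.+1 i j]
  else false.

Lemma bnear_count k a M : (\sum_(i < M) bnear k a i <= 3 * 2 ^ k)%N.
Proof.
suff h : (\sum_(i < M) bnear k a i <= minn M (a.+2 * 2 ^ k) - (a * 2 ^ k - 2 ^ k))%N.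
  apply: leq_trans h _; rewrite !mulSn; set s := (2 ^ k)%N; set t := (a * s)%N; lia.
elim: M => [|M IH]; first by rewrite big_ord0.
rewrite big_ord_recr /= /bnear; move: IH; rewrite !mulSn; set s := (2 ^ k)%N; set t := (a * s)%N.
by set S := (\sum_(i < M) _)%N; case: leqP => ?; case: ltnP => ? /=; lia.
Qed.

Lemma bad_box_nbhd_count k a b M : 0 < l -> ~~ good_box l v k a b ->
  gsum M (fun i j => (bnear k a i && bnear k b j)%:R) <= 9 / l ^+ 2 * box k a b (grad2 v).
Proof.
move=> l0; rewrite /good_box -ltNge => /ltW bad; apply: (le_trans (y := 9 * 4 ^+ k)); last first.
  by rewrite -mulrA ler_pM2l // mulrC ler_pdivlMr ?exprn_gt0 // mulrC.
rewrite /gsum; under eq_bigr => i _ do under eq_bigr => j _ do rewrite -mulnb natrM.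
under eq_bigr => i _ do rewrite -mulr_sumr -natr_sum.
rewrite -mulr_suml -natr_sum -natrM -natrX -natrM ler_nat.
apply: leq_trans (leq_mul (bnear_count _ _ _) (bnear_count _ _ _)) _.
by rewrite mulnACA -expnMn.
Qed.

(** A weak-type bound, as for the dyadic maximal function: the recursion stops at the first bad
    square on each branch, so the squares counted are disjoint and their energies add up. A bad
    square has energy above [l ^+ 2 * 4 ^+ k], and its triple has at most [9 * 4 ^+ k] points. *)
Lemma bad_nbhd_count k a b M : 0 < l ->
  gsum M (fun i j => (bad_nbhd k a b i j)%:R) <= 9 / l ^+ 2 * box k a b (grad2 v).
Proof.
move=> l0; elim: k a b => [|k IH] a b /=.
all: case: (boolP (good_box _ _ _ _ _)) => [gd|bad] /=; last exact: bad_box_nbhd_count.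
  rewrite (eq_gsum (g := fun _ _ => 0)) // gsum_const mul0r mulr_ge0 ?divr_ge0 ?exprn_ge0 ?(ltW l0) //.
  by apply: box_ge0 => i j; rewrite addr_ge0 ?sqr_ge0.
rewrite box_split !mulrDr.
have h1 := IH a.*2 b.*2; have h2 := IH a.*2 b.*2.+1.
have h3 := IH a.*2.+1 b.*2; have h4 := IH a.*2.+1 b.*2.+1.
apply: le_trans (lerD (lerD h1 h2) (lerD h3 h4)); rewrite -!gsumD.
apply: le_gsum => i j _ _; do 4!case: bad_nbhd => //=; lra.
Qed.

(** Removing the triples of the maximal bad squares removes those of all bad squares: the triple of
    a dyadic square lies in the triple of each of its ancestors, in particular of the one at which
    the recursion stops. *)
Lemma bad_nbhd_sub d k a b i j : (forall c e, c %/ 2 ^ d = a -> e %/ 2 ^ d = b ->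
  ~~ good_box l v k c e -> bnear k c i -> bnear k e j -> bad_nbhd (k + d) a b i j)%N.
Proof.
elim: d a b => [|d IH] a b c e.
  rewrite addn0 expn0 !divn1 => <- <- bad nc ne.
  by case: k bad nc ne => [|k] /= -> -> ->.
move=> hc he bad nc ne; rewrite addnS /=; case: ifP => _.
  have H m a' i' : (m %/ 2 ^ d.+1 = a' -> bnear k m i' -> bnear (k + d).+1 a' i')%N.
    move=> <-; rewrite /bnear -addnS expnD; set s := (2 ^ k)%N; set t := (2 ^ d.+1)%N.
    have t0 : (0 < t)%N by rewrite expn_gt0.
    have h1 := leq_divM m t; have h2 : (m < (m %/ t).+1 * t)%N by rewrite ltn_ceil.
    set x := (m %/ t)%N in h1 h2 *; move=> /andP[h3 h4].
    have h1' : (x * t * s <= m * s)%N by rewrite leq_mul2r h1 orbT.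
    have h2' : (m.+1 * s <= x.+1 * t * s)%N by rewrite leq_mul2r h2 orbT.
    have h5 : (s <= s * t)%N by rewrite leq_pmulr.
    have -> : (x * (s * t) = x * t * s)%N by lia.
    have -> : (x.+2 * (s * t) = x.+1 * t * s + s * t)%N by rewrite (mulSn x.+1); lia.
    move: h4; rewrite (mulSn m.+1) => h4; apply/andP; split; lia.
  by rewrite (H _ _ _ hc nc) (H _ _ _ he ne).
have hd m m' : (m %/ 2 ^ d.+1 = m' -> (m %/ 2 ^ d = m'.*2) \/ (m %/ 2 ^ d = m'.*2.+1))%N.
  by rewrite expnSr divnMA divn2; lia.
have [ec|ec] := hd _ _ hc; have [ee|ee] := hd _ _ he;
  by rewrite (IH _ _ _ _ ec ee bad nc ne) ?orbT.
Qed.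

End BadSet.

(** * Lipschitz bounds at the good points *)

Section Truncation.
Variables (R : realFieldType) (l : R) (n : nat) (v : nat -> nat -> R).
Hypothesis l0 : 0 < l.
Let N := (2 ^ n)%N.

(** The support is placed in the middle of a 3 by 3 block of squares of side [2 ^ n], so that its
    dyadic squares have neighbours on all sides without negative indices. *)
Definition inside (i j : nat) := [&& 2 ^ n < i, i < 2 * 2 ^ n, 2 ^ n < j & j < 2 * 2 ^ n]%N.
Hypothesis v0 : forall i j, ~~ inside i j -> v i j = 0.

Definition bad_pt i j := [exists a : 'I_3, [exists b : 'I_3, bad_nbhd l v n a b i j]].

Lemma bad_pt_count M :
  gsum M (fun i j => (bad_pt i j)%:R) <=
  9 / l ^+ 2 * \sum_(a < 3) \sum_(b < 3) box n a b (grad2 v).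
Proof.
apply: (le_trans (y := gsum M (fun i j => \sum_(a < 3) \sum_(b < 3) (bad_nbhd l v n a b i j)%:R))).
  apply: le_gsum => i j _ _.
  have pos (a b : 'I_3) : 0 <= (bad_nbhd l v n a b i j)%:R :> R by [].
  have [/existsP[a /existsP[b hb]]|_] := boolP (bad_pt i j); last by do 2!apply: sumr_ge0 => ? _.
  rewrite (bigD1 a) //= (bigD1 b) //= hb -addrA lerDl addr_ge0 ?sumr_ge0 // => c _.
  by rewrite sumr_ge0.
rewrite mulr_sumr.
have -> : gsum M (fun i j => \sum_(a < 3) \sum_(b < 3) (bad_nbhd l v n a b i j)%:R) =
   \sum_(a < 3) \sum_(b < 3) gsum M (fun i j => (bad_nbhd l v n a b i j)%:R) :> R.
  rewrite /gsum; under eq_bigr => i _ do rewrite exchange_big /=.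
  rewrite exchange_big /=; apply: eq_bigr => a _.
  under eq_bigr => i _ do rewrite exchange_big /=.
  by rewrite exchange_big.
apply: ler_sum => a _; rewrite mulr_sumr; apply: ler_sum => b _; exact: bad_nbhd_count.
Qed.

(** If a box equal or adjacent to the one holding the point were bad, its triple would contain the
    point; this is why triples are removed. *)
Lemma good_pt_box i j k c d : inside i j -> ~~ bad_pt i j -> (k <= n)%N ->
  near (i %/ 2 ^ k) c -> near (j %/ 2 ^ k) d -> good_box l v k c d.
Proof.
move=> /and4P[i1 i2 j1 j2] good kn nc nd; apply: contraNT good => bad.
have H m m' : (2 ^ n < m -> m < 2 * 2 ^ n -> near (m %/ 2 ^ k) m' ->
    m' %/ 2 ^ (n - k) < 3 /\ bnear k m' m)%N.
  rewrite -{1 2}(subnK kn) expnD; set s := (2 ^ k)%N; set t := (2 ^ _)%N => h1 h2.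
  have s0 : (0 < s)%N by rewrite expn_gt0.
  have t0 : (0 < t)%N by rewrite expn_gt0.
  have h3 := leq_divM m s; have h4 : (m < (m %/ s).+1 * s)%N by rewrite ltn_ceil.
  rewrite /near; set x := (m %/ s)%N in h3 h4 * => /andP[h5 h6].
  have h7 : (x < 2 * t)%N by rewrite ltn_divLR // -mulnA.
  split; first by rewrite ltn_divLR //; lia.
  have h8 : (x * s <= m'.+1 * s)%N by rewrite leq_mul2r h5 orbT.
  have h9 : (m' * s <= x.+1 * s)%N by rewrite leq_mul2r h6 orbT.
  rewrite /bnear -/s (mulSn m'.+1); rewrite !mulSn in h4 h8 h9 *; apply/andP; split; lia.
have [ca ci] := H _ _ i1 i2 nc; have [db dj] := H _ _ j1 j2 nd.
apply/existsP; exists (Ordinal ca); apply/existsP; exists (Ordinal db).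
by rewrite -{1}(subnKC kn); apply: (bad_nbhd_sub (c := c) (e := d)).
Qed.

(** The l1 distance: of the truncated differences [i - i'] and [i' - i], one is zero and the other
    is the distance. *)
Definition dist1 (i j i' j' : nat) : R := ((i - i') + (i' - i) + ((j - j') + (j' - j)))%:R.

Lemma pow2_above d : (0 < d)%N -> (d < N)%N ->
  exists K, [/\ (K <= n)%N, (d < 2 ^ K)%N & (2 ^ K <= 2 * d)%N].
Proof.
move=> d0 dN; have /andP[h1 h2] : (2 ^ trunc_log 2 d <= d < 2 ^ (trunc_log 2 d).+1)%N by apply: trunc_log_bounds.
exists (trunc_log 2 d).+1; split=> //; last by rewrite expnS leq_mul2l.
by rewrite -(ltn_exp2l _ _ (isT : (1 < 2)%N)); apply: leq_ltn_trans h1 dN.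
Qed.

Lemma near_div s i i' : (0 < s -> i <= i' + s -> i' <= i + s -> near (i %/ s) (i' %/ s))%N.
Proof.
move=> s0 h1 h2; rewrite /near; apply/andP; split.
  by apply: leq_trans (leq_div2r _ h1) _; rewrite divnDr // divnn s0 addn1.
by apply: leq_trans (leq_div2r _ h2) _; rewrite divnDr // divnn s0 addn1.
Qed.

Lemma good_pt_avg i j K : inside i j -> ~~ bad_pt i j -> (K <= n)%N ->
  `|v i j - avg K v i j| <= 2 * l * 2 ^+ K.
Proof.
move=> ins good Kn; apply: good_avg => // k c d kK; apply: good_pt_box => //.
by apply: leq_trans Kn; apply: ltnW.
Qed.

Lemma good_near_avg i j K a b : inside i j -> ~~ bad_pt i j -> (K <= n)%N ->
  near (i %/ 2 ^ K) a -> near (j %/ 2 ^ K) b ->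
  `|avg K v i j - box K a b v / 4 ^+ K| <= ((i %/ 2 ^ K != a)%N + (j %/ 2 ^ K != b)%N)%:R * (2 * l * 2 ^+ K).
Proof.
move=> ins good Kn na nb.
have h := good_near l0 na nb (fun c d => @good_pt_box i j K c d ins good Kn).
rewrite /avg -mulrBl normrM (gtr0_norm (x := _^-1)) ?invr_gt0 ?exprn_gt0 //.
rewrite ler_pdivrMr ?exprn_gt0 //; apply: le_trans h _.
have -> : 8 ^+ K = 2 ^+ K * 4 ^+ K :> R by rewrite -exprMn -natrM.
by rewrite !mulrA.
Qed.

(** At the dyadic scale [2 ^ K] just above the larger coordinate distance, the points lie in equal
    or touching boxes. Going from each point to its mean costs [2 * l * 2 ^+ K], going between the
    means [4 * l * 2 ^+ K], and [2 ^ K] is at most twice the distance. *)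
Lemma good_pts_lipschitz i j i' j' : inside i j -> ~~ bad_pt i j -> inside i' j' -> ~~ bad_pt i' j' ->
  `|v i j - v i' j'| <= 16 * l * dist1 i j i' j'.
Proof.
move=> ins good ins' good'.
set d := ((i - i') + (i' - i) + ((j - j') + (j' - j)))%N.
pose m := maxn ((i - i') + (i' - i)) ((j - j') + (j' - j)).
have [m0|m0] := posnP m.
  have -> : i = i' by rewrite /m in m0; lia.
  have -> : j = j' by rewrite /m in m0; lia.
  by rewrite subrr normr0 mulr_ge0 // mulr_ge0 // ltW.
have mN : (m < N)%N by move: ins ins' => /and4P[? ? ? ?] /and4P[? ? ? ?]; rewrite /m /N; lia.
have [K [Kn dK Kd]] := pow2_above m0 mN.
have s0 : (0 < 2 ^ K)%N by rewrite expn_gt0.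
have na : near (i %/ 2 ^ K) (i' %/ 2 ^ K) by apply: near_div => //; rewrite /m in dK; lia.
have nb : near (j %/ 2 ^ K) (j' %/ 2 ^ K) by apply: near_div => //; rewrite /m in dK; lia.
have h1 := good_pt_avg ins good Kn; have h2 := good_pt_avg ins' good' Kn.
have h3 := good_near_avg ins good Kn na nb.
have {}h3 : `|avg K v i j - avg K v i' j'| <= 4 * l * 2 ^+ K.
  apply: le_trans h3 _; apply: (le_trans (y := 2 * (2 * l * 2 ^+ K))); last by lra.
  by rewrite ler_wpM2r ?mulr_ge0 ?exprn_ge0 ?(ltW l0) // ler_nat; do 2!case: eqP.
have h4 : 2 ^+ K <= 2 * dist1 i j i' j' :> R.
  rewrite -natrX -natrM ler_nat; apply: leq_trans Kd _; rewrite /m /d; lia.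
have h5 : 8 * l * 2 ^+ K <= 8 * l * (2 * dist1 i j i' j') by rewrite ler_pM2l ?mulr_gt0.
move: h1 h2 h3; rewrite !ler_norml => /andP[? ?] /andP[? ?] /andP[? ?]; apply/andP; split; lra.
Qed.

Lemma box_outside K a b : (K <= n)%N -> (a.+1 * 2 ^ K <= N)%N || (2 * N <= a * 2 ^ K)%N ||
  (b.+1 * 2 ^ K <= N)%N || (2 * N <= b * 2 ^ K)%N -> box K a b v = 0.
Proof.
move=> Kn h; rewrite /box big1 // => i _; rewrite big1 // => j _; apply: v0.
have := ltn_ord i; have := ltn_ord j; move: (nat_of_ord i) (nat_of_ord j) h => i' j'.
rewrite /inside /N !mulSn; lia.
Qed.

Lemma outside_neighbour i d K : (K <= n)%N -> (0 < d)%N -> (d < 2 ^ K)%N ->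
  (i == N + d)%N || (i + d == 2 * N)%N ->
  exists2 a, near (i %/ 2 ^ K) a & (a.+1 * 2 ^ K <= N)%N || (2 * N <= a * 2 ^ K)%N.
Proof.
move=> Kn d0 dK; have e : (N = 2 ^ (n - K) * 2 ^ K)%N by rewrite -expnD subnK.
rewrite e; set s := (2 ^ K)%N in dK *; set t := (2 ^ _)%N.
have s0 : (0 < s)%N by rewrite expn_gt0.
have t0 : (0 < t)%N by rewrite expn_gt0.
case/orP => /eqP h.
  have -> : (i %/ s = t)%N by rewrite h divnMDl // divn_small // addn0.
  exists t.-1; first by rewrite /near; lia.
  by rewrite prednK // leqnn.
have -> : (i %/ s = (2 * t).-1)%N.
  have -> : (i = (2 * t).-1 * s + (s - d))%N.
    have : ((2 * t).-1 * s + s = 2 * (t * s))%N by rewrite -mulSnr prednK; lia.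
    lia.
  by rewrite divnMDl // divn_small ?addn0 //; lia.
exists (2 * t)%N; first by rewrite /near; lia.
by rewrite mulnA leqnn orbT.
Qed.

(** Some side of the middle square separates the two points. If [d] is the distance of the good
    point from it, then at the dyadic scale just above [d] the point's box has a neighbour beyond
    that side, where [v] has mean zero; the mean over this neighbour takes the place of the second
    point. *)
Lemma good_pt_boundary i j i' j' : inside i j -> ~~ bad_pt i j -> ~~ inside i' j' ->
  `|v i j| <= 16 * l * dist1 i j i' j'.
Proof.
move=> ins good out.
have Hx d : (0 < d)%N -> (d < N)%N -> (i == N + d)%N || (i + d == 2 * N)%N -> `|v i j| <= 16 * l * d%:R.
  move=> d0 dN hd; have [K [Kn dK Kd]] := pow2_above d0 dN.
  have [a na ha] := outside_neighbour Kn d0 dK hd.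
  have nb : near (j %/ 2 ^ K) (j %/ 2 ^ K) by rewrite /near leqnSn.
  have h1 := good_pt_avg ins good Kn; have h2 := good_near_avg ins good Kn na nb.
  rewrite (@box_outside K a) // in h2; last by rewrite ha.
  rewrite eqxx addn0 mul0r subr0 in h2.
  have {}h2 : `|avg K v i j| <= 2 * l * 2 ^+ K.
    apply: le_trans h2 _; case: (_ != _); rewrite ?mul1r ?mul0r //.
    by rewrite mulr_ge0 ?exprn_ge0 // mulr_ge0 // ltW.
  have h4 : 2 ^+ K <= 2 * d%:R :> R by rewrite -natrX -natrM ler_nat.
  have h5 : 4 * l * 2 ^+ K <= 4 * l * (2 * d%:R) by rewrite ler_pM2l ?mulr_gt0.
  have h6 : 0 <= l * d%:R by rewrite mulr_ge0 // ltW.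
  move: h1 h2; rewrite !ler_norml => /andP[? ?] /andP[? ?]; apply/andP; split; lra.
have Hy d : (0 < d)%N -> (d < N)%N -> (j == N + d)%N || (j + d == 2 * N)%N -> `|v i j| <= 16 * l * d%:R.
  move=> d0 dN hd; have [K [Kn dK Kd]] := pow2_above d0 dN.
  have [a na ha] := outside_neighbour Kn d0 dK hd.
  have nb : near (i %/ 2 ^ K) (i %/ 2 ^ K) by rewrite /near leqnSn.
  have h1 := good_pt_avg ins good Kn; have h2 := good_near_avg ins good Kn nb na.
  rewrite (@box_outside K _ a) // in h2; last by move: ha => /orP[] ->; rewrite ?orbT.
  rewrite eqxx add0n mul0r subr0 in h2.
  have {}h2 : `|avg K v i j| <= 2 * l * 2 ^+ K.
    apply: le_trans h2 _; case: (_ != _); rewrite ?mul1r ?mul0r //.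
    by rewrite mulr_ge0 ?exprn_ge0 // mulr_ge0 // ltW.
  have h4 : 2 ^+ K <= 2 * d%:R :> R by rewrite -natrX -natrM ler_nat.
  have h5 : 4 * l * 2 ^+ K <= 4 * l * (2 * d%:R) by rewrite ler_pM2l ?mulr_gt0.
  have h6 : 0 <= l * d%:R by rewrite mulr_ge0 // ltW.
  move: h1 h2; rewrite !ler_norml => /andP[? ?] /andP[? ?]; apply/andP; split; lra.
have mono (d : nat) : (d <= (i - i') + (i' - i) + ((j - j') + (j' - j)))%N ->
    16 * l * d%:R <= 16 * l * dist1 i j i' j'.
  by move=> h; rewrite ler_pM2l ?mulr_gt0 // ler_nat.
move: (ins) => /and4P; rewrite -/N => -[i1 i2 j1 j2].
move: out; rewrite /inside -/N !negb_and -!leqNgt => /or4P[] h.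
- apply: le_trans (mono (i - N)%N _); last by lia.
  by apply: Hx; lia.
- apply: le_trans (mono (2 * N - i)%N _); last by lia.
  by apply: Hx; lia.
- apply: le_trans (mono (j - N)%N _); last by lia.
  by apply: Hy; lia.
- apply: le_trans (mono (2 * N - j)%N _); last by lia.
  by apply: Hy; lia.
Qed.

End Truncation.

(** * McShane extension from a finite set *)

Section McShane.
Variables (R : realFieldType) (T : eqType) (d : T -> T -> R) (C : R).
Hypotheses (d0 : forall z, d z z = 0) (dtri : forall x y z, d x z <= d x y + d y z) (C0 : 0 <= C).

Definition seq_min (F : T -> R) x s := foldr (fun w m => Num.min (F w) m) (F x) s.

Lemma seq_min_le F x s w : w \in x :: s -> seq_min F x s <= F w.
Proof.
elim: s w => [|y s IH] w; first by rewrite inE => /eqP ->.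
rewrite !inE /= ge_min => /or3P[/eqP->|/eqP->|h]; first by rewrite IH ?orbT // inE eqxx.
  by rewrite lexx.
by rewrite IH ?orbT // inE h orbT.
Qed.

Lemma seq_min_attained F x s : exists2 w, w \in x :: s & seq_min F x s = F w.
Proof.
elim: s => [|y s [w ws IH]]; first by exists x; rewrite ?inE.
rewrite /= minElt; case: ltP => _; first by exists y; rewrite // !inE eqxx orbT.
by exists w => //; move: ws; rewrite !inE => /orP[->//|->]; rewrite !orbT.
Qed.

Lemma mcshane (v : T -> R) (x : T) (s : seq T) :
  (forall w w', w \in x :: s -> w' \in x :: s -> v w <= v w' + C * d w w') ->
  exists V : T -> R, (forall w, w \in x :: s -> V w = v w) /\
    (forall z z', V z <= V z' + C * d z z').
Proof.
move=> lip; exists (fun z => seq_min (fun w => v w + C * d z w) x s); split.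
  move=> w ws; apply/eqP; rewrite eq_le; apply/andP; split.
    by apply: le_trans (seq_min_le _ ws) _; rewrite d0 mulr0 addr0.
  by have [w' ws' ->] := seq_min_attained (fun w' => v w' + C * d w w') x s; exact: lip.
move=> z z'; have [w ws ->] := seq_min_attained (fun w => v w + C * d z' w) x s.
apply: le_trans (seq_min_le _ ws) _; rewrite -addrA lerD2l -mulrDr ler_wpM2l // addrC.
exact: dtri.
Qed.

End McShane.

Lemma lipschitz_truncation (R : realFieldType) (l : R) (n : nat) (v : nat -> nat -> R) :
  0 < l -> (forall i j, ~~ inside n i j -> v i j = 0) ->
  exists V : nat -> nat -> R,
    [/\ forall i j, `|xdiff V i j| <= 16 * l,
        forall i j, `|ydiff V i j| <= 16 * l,
        forall i j, (i <= 2 * 2 ^ n)%N -> (j <= 2 * 2 ^ n)%N -> ~~ inside n i j -> V i j = 0 &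
        forall i j, (i <= 2 * 2 ^ n)%N -> (j <= 2 * 2 ^ n)%N -> ~~ bad_pt l n v i j -> V i j = v i j].
Proof.
move=> l0 v0; set M := (2 * 2 ^ n)%N.
(* The points outside the support are kept along with the good ones, so the extension still vanishes
   there. *)
pose E (z : nat * nat) := ~~ inside n z.1 z.2 || ~~ bad_pt l n v z.1 z.2.
pose s := [seq z <- [seq (i, j) | i <- iota 0 M.+1, j <- iota 0 M.+1] | E z].
pose d (z w : nat * nat) : R := dist1 R z.1 z.2 w.1 w.2.
have sE z : (z \in s) = [&& E z, (z.1 <= M)%N & (z.2 <= M)%N].
  rewrite mem_filter; congr (_ && _); apply/allpairsP/andP.
    by move=> [w [w1 w2 ->]] /=; rewrite !mem_iota !add0n !ltnS in w1 w2.
  by move=> [h1 h2]; exists z; rewrite !mem_iota !add0n !ltnS; split=> //; case: z {h1 h2}.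
have o0 : E (0%N, 0%N) by [].

have EE z : z \in (0%N, 0%N) :: s -> E z.
  by rewrite inE sE => /orP[/eqP->//|/andP[]].
have [|||w w' /EE hw /EE hw'|V [Vv Vlip]] := @mcshane R _ d (16 * l) _ _ _ (fun z => v z.1 z.2) (0%N, 0%N) s.
- by move=> z; rewrite /d /dist1 !subnn.
- by move=> x y z; rewrite /d /dist1 -natrD ler_nat; lia.
- by rewrite mulr_ge0 // ltW.
- have dge : 0 <= 16 * l * d w w' by rewrite mulr_ge0 // mulr_ge0 // ltW.
  have dsym : d w w' = d w' w by rewrite /d /dist1; congr (_%:R); lia.
  have [iw|ow] := boolP (inside n w.1 w.2); last first.
    rewrite (v0 _ _ ow); have [iw'|ow'] := boolP (inside n w'.1 w'.2); last by rewrite (v0 _ _ ow') add0r.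
    have gw' : ~~ bad_pt l n v w'.1 w'.2 by move: hw'; rewrite /E iw'.
    have := good_pt_boundary l0 v0 iw' gw' ow; rewrite -/(d w' w) -dsym ler_norml => /andP[? ?]; lra.
  have gw : ~~ bad_pt l n v w.1 w.2 by move: hw; rewrite /E iw.
  have [iw'|ow'] := boolP (inside n w'.1 w'.2); last first.
    rewrite (v0 _ _ ow').
    have := good_pt_boundary l0 v0 iw gw ow'; rewrite -/(d w w') ler_norml => /andP[? ?]; lra.
  have gw' : ~~ bad_pt l n v w'.1 w'.2 by move: hw'; rewrite /E iw'.
  have := good_pts_lipschitz l0 iw gw iw' gw'; rewrite -/(d w w') ler_norml => /andP[? ?]; lra.
exists (fun i j => V (i, j)); split.
- move=> i j; have h1 := Vlip (i.+1, j) (i, j); have h2 := Vlip (i, j) (i.+1, j).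
  have e1 : d (i.+1, j) (i, j) = 1 by rewrite /d /dist1 /= [in LHS](_ : (_ + _ + (_ + _))%N = 1%N) //; lia.
  have e2 : d (i, j) (i.+1, j) = 1 by rewrite /d /dist1 /= [in LHS](_ : (_ + _ + (_ + _))%N = 1%N) //; lia.
  by rewrite e1 mulr1 in h1; rewrite e2 mulr1 in h2; rewrite /xdiff ler_norml; apply/andP; split; lra.
- move=> i j; have h1 := Vlip (i, j.+1) (i, j); have h2 := Vlip (i, j) (i, j.+1).
  have e1 : d (i, j.+1) (i, j) = 1 by rewrite /d /dist1 /= [in LHS](_ : (_ + _ + (_ + _))%N = 1%N) //; lia.
  have e2 : d (i, j) (i, j.+1) = 1 by rewrite /d /dist1 /= [in LHS](_ : (_ + _ + (_ + _))%N = 1%N) //; lia.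
  by rewrite e1 mulr1 in h1; rewrite e2 mulr1 in h2; rewrite /ydiff ler_norml; apply/andP; split; lra.
- move=> i j iM jM out; rewrite Vv /= ?v0 // inE sE /= iM jM /E /= out orbT.
  by [].
- move=> i j iM jM good; rewrite Vv //= inE sE /= iM jM /E /= good !orbT.
  by [].
Qed.

(** * A Lipschitz field paired with a grid set *)

Section Cutoff.
Variable R : realFieldType.
Implicit Types (p u f : nat -> nat -> R).

Lemma xflux_out N (w : nat -> nat -> R) i j : (N <= i)%N -> xflux N w i j = 0.
Proof. by move=> h; rewrite /xflux [(i < N)%N]ltnNge h andbF. Qed.

Lemma hessian_x_le N (w : nat -> nat -> R) :
  gsum N (fun i j => xdiff (xflux N w) i j ^+ 2) <= gsum N (fun i j => laplacian N w i j ^+ 2).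
Proof.
rewrite hessian_energy -addrA lerDl addr_ge0 ?mulrn_wge0 //; apply: gsum_ge0 => *; exact: sqr_ge0.
Qed.

Lemma hessian_xy_le N (w : nat -> nat -> R) :
  gsum N (fun i j => (xflux N w i j - xflux N w i j.-1) ^+ 2) <=
  gsum N (fun i j => laplacian N w i j ^+ 2).
Proof.
have h f : 0 <= gsum N (fun i j => f i j ^+ 2) by apply: gsum_ge0 => *; exact: sqr_ge0.
rewrite hessian_energy mulr2n.
have := h (xdiff (xflux N w)); have := h (ydiff (yflux N w)).
have := h (fun i j => xflux N w i j - xflux N w i j.-1); lra.
Qed.

(** Pairing [f] with the equation splits the sum of [f ^+ 2] into an x-part and a y-part, one of
    which is at least half. If the x-part is too small, the transposed solution is used: [p] is an
    x-flux in both cases, and only [f] gets transposed. *)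
Lemma neumann_flux N f : gsum N f = 0 ->
  exists p, [/\ forall i j, (i == 0)%N || (N <= i)%N -> p i j = 0,
    gsum N (fun i j => xdiff p i j ^+ 2) <= gsum N (fun i j => f i j ^+ 2),
    gsum N (fun i j => (p i j - p i j.-1) ^+ 2) <= gsum N (fun i j => f i j ^+ 2) &
    gsum N (fun i j => f i j ^+ 2) / 2 <= gsum N (fun i j => f i j * xdiff p i j) \/
    gsum N (fun i j => f i j ^+ 2) / 2 <= gsum N (fun i j => f j i * xdiff p i j)].
Proof.
move=> /neumann_solution[w wf].
have zero (w' : nat -> nat -> R) i j : (i == 0)%N || (N <= i)%N -> xflux N w' i j = 0.
  by case/orP => [/eqP->//|]; exact: xflux_out.
have ef : gsum N (fun i j => laplacian N w i j ^+ 2) = gsum N (fun i j => f i j ^+ 2).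
  by apply: eq_gsum => i j iN jN; rewrite wf.
pose w' i j := w j i.
have ef' : gsum N (fun i j => laplacian N w' i j ^+ 2) = gsum N (fun i j => f i j ^+ 2).
  by rewrite -ef gsum_transpose; apply: eq_gsum => i j _ _; rewrite /laplacian [in LHS]addrC.
have split_f : gsum N (fun i j => f i j ^+ 2) =
    gsum N (fun i j => f i j * xdiff (xflux N w) i j) + gsum N (fun i j => f j i * xdiff (xflux N w') i j).
  rewrite [gsum N (fun i j => f j i * _)]gsum_transpose -gsumD; apply: eq_gsum => i j iN jN.
  by rewrite -mulrDr expr2 -{2}(wf i j iN jN).
set X := gsum N (fun i j => f i j ^+ 2) in ef ef' split_f *.
have [h|h] := lerP (X / 2) (gsum N (fun i j => f i j * xdiff (xflux N w) i j)).
  exists (xflux N w); split; [exact: zero | | | by left]; rewrite -ef.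
    exact: hessian_x_le.
  exact: hessian_xy_le.
exists (xflux N w'); split; [exact: zero | rewrite -ef' | rewrite -ef' | right; lra].
  exact: hessian_x_le.
exact: hessian_xy_le.
Qed.

Lemma sqr_sum_le N (a : nat -> R) : (\sum_(t < N) a t) ^+ 2 <= N%:R * \sum_(t < N) a t ^+ 2.
Proof.
case: N => [|N]; first by rewrite !big_ord0 expr0n mul0r.
set M := N.+1; set S := \sum_(t < M) a t; have M0 : 0 < M%:R :> R by rewrite ltr0n.
have : 0 <= \sum_(t < M) (a t - S / M%:R) ^+ 2 by apply: sumr_ge0 => t _; exact: sqr_ge0.
have -> : \sum_(t < M) (a t - S / M%:R) ^+ 2 = \sum_(t < M) a t ^+ 2 - S ^+ 2 / M%:R.
  have -> : \sum_(t < M) (a t - S / M%:R) ^+ 2 =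
      \sum_(t < M) (a t ^+ 2 - (2 * (S / M%:R) * a t - (S / M%:R) ^+ 2)).
    by apply: eq_bigr => t _; ring.
  rewrite sumrB; congr (_ - _); rewrite sumrB -mulr_sumr -/S sumr_const card_ord -mulr_natl.
  by field; rewrite gt_eqF.
by rewrite subr_ge0 ler_pdivrMr // mulrC.
Qed.

Lemma poincare N p : (forall j, p 0%N j = 0) ->
  gsum N (fun i j => p i j ^+ 2) <= N%:R ^+ 2 * gsum N (fun i j => xdiff p i j ^+ 2).
Proof.
move=> p0; rewrite gsum_transpose [in leRHS]gsum_transpose /gsum mulr_sumr.
apply: ler_sum => j _.
have h i : (i < N)%N -> p i j ^+ 2 <= N%:R * \sum_(t < N) xdiff p t j ^+ 2.
  move=> iN; have := norm_diff_le_variation (fun t => p t j) (leq0n i) (ltnW iN); rewrite p0 subr0 => h.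
  have := sqr_sum_le N (fun t => `|xdiff p t j|).
  under [in X in _ <= X -> _]eq_bigr => t _ do rewrite real_normK ?num_real //.
  apply: le_trans; rewrite -real_normK ?num_real // ler_sqr ?nnegrE //.
  by rewrite sumr_ge0.
apply: (le_trans (y := \sum_(i < N) N%:R * \sum_(t < N) xdiff p t j ^+ 2)).
  by apply: ler_sum => i _; exact: h.
by rewrite sumr_const card_ord -[(_ * _) *+ N]mulr_natl mulrA expr2.
Qed.

(** A trapezoid of slope [1 / s] at both ends, capped at 1; it vanishes from [N] on because [N - j]
    truncates. *)
Definition cutoff (N s j : nat) : R := (minn s (minn j (N - j)))%:R / s%:R.

Lemma cutoff_ge0 N s j : 0 <= cutoff N s j.
Proof. by rewrite divr_ge0. Qed.

Lemma cutoff_le1 N s j : (0 < s)%N -> cutoff N s j <= 1.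
Proof. by move=> s0; rewrite ler_pdivrMr ?ltr0n // mul1r ler_nat geq_minl. Qed.

Lemma cutoff_out N s j : (j == 0)%N || (N <= j)%N -> cutoff N s j = 0.
Proof.
move=> h; rewrite /cutoff (_ : minn s _ = 0%N) ?mul0r //; move: h => /orP[/eqP->|h]; lia.
Qed.

Lemma cutoff_lip N s j : (0 < s)%N -> (cutoff N s j.+1 - cutoff N s j) ^+ 2 <= s%:R^-1 ^+ 2.
Proof.
move=> s0; rewrite /cutoff -mulrBl exprMn ler_piMl ?sqr_ge0 //.
set x := minn _ _; set y := minn _ _.
have : (x <= y.+1)%N /\ (y <= x.+1)%N by rewrite /x /y; lia.
rewrite -!(ler_nat R) => -[]; rewrite -!natr1 => h1 h2.
by rewrite -real_normK ?num_real // expr_le1 // ler_norml; apply/andP; split; lra.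
Qed.

Lemma cutoff_deficit N s : (0 < s)%N -> \sum_(j < N) (1 - cutoff N s j) <= 2 * s%:R.
Proof.
move=> s0; apply: (le_trans (y := \sum_(j < N) ((j < s)%N + (N - j < s)%N)%:R)).
  apply: ler_sum => j _; case: (ltnP j s) => h1 /=.
    by have := cutoff_ge0 N s j; rewrite natrD; case: (_ < _)%N => /=; lra.
  case: ltnP => h2 /=; first by have := cutoff_ge0 N s j; lra.
  rewrite /cutoff (_ : minn _ _ = s) ?divff ?subrr ?pnatr_eq0 -?lt0n //; lia.
rewrite -natr_sum -natrM ler_nat big_split /= mul2n -addnn leq_add //.
  apply: leq_trans (geq_minr N s); elim: N => [|N IH]; first by rewrite big_ord0.
  rewrite big_ord_recr /=; move: IH; set S := (\sum_(i < N) _)%N => IH; case: ltnP => ?; lia.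
suff h k : (k <= N)%N -> (\sum_(i < k) (N - i < s) <= k - (N - s))%N.
  by apply: leq_trans (h N (leqnn _)) _; lia.
elim: k => [|k IH] kN; first by rewrite big_ord0.
rewrite big_ord_recr /=; move: (IH (ltnW kN)); set S := (\sum_(i < k) _)%N => {}IH; case: ltnP => ?; lia.
Qed.

End Cutoff.

(** * Effect of the cutoff and of the truncation on energy and pairing *)

Section Gain.
Variable R : realFieldType.
Implicit Types (p u f : nat -> nat -> R).

Lemma sum_succ_le N (F : nat -> R) : (forall j, 0 <= F j) -> F N = 0 ->
  \sum_(j < N) F j.+1 <= \sum_(j < N) F j.
Proof.
case: N => [|N] F0 FN; first by rewrite !big_ord0.
by rewrite big_ord_recr /= FN addr0 [leRHS]big_ord_recl /= lerDr.
Qed.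

Lemma cutoff_energy N s p : (0 < s)%N ->
  gsum N (grad2 (fun i j => cutoff R N s j * p i j)) <=
  gsum N (fun i j => xdiff p i j ^+ 2) + 2 * gsum N (fun i j => (p i j - p i j.-1) ^+ 2)
  + 2 * s%:R^-1 ^+ 2 * gsum N (fun i j => p i j ^+ 2).
Proof.
move=> s0; set chi := cutoff R N s.
have chi2 j : chi j ^+ 2 <= 1 by rewrite expr_le1 // ?cutoff_ge0 ?cutoff_le1.
pose F i j := (chi j * (p i j - p i j.-1)) ^+ 2.
(* [ydiff] is a forward difference, whereas the bound on [p] concerns backward ones. The shift
   brings in only row [N], where the cutoff vanishes. *)
have shiftF : gsum N (fun i j => F i j.+1) <= gsum N (fun i j => (p i j - p i j.-1) ^+ 2).
  apply: (le_trans (y := gsum N F)); last first.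
    by apply: le_gsum => i j _ _; rewrite /F exprMn ler_piMl ?sqr_ge0.
  apply: ler_sum => i _.
  have FN : F i N = 0 by rewrite /F /chi cutoff_out ?leqnn ?orbT // mul0r expr0n.
  by apply: (@sum_succ_le N (F i)) => // j; exact: sqr_ge0.
apply: (le_trans (y := gsum N (fun i j => xdiff p i j ^+ 2 +
   2 * F i j.+1 + 2 * s%:R^-1 ^+ 2 * p i j ^+ 2))); last first.
  by rewrite !gsumD !gsumZ lerD2r lerD2l ler_pM2l.
apply: le_gsum => i j _ _; rewrite /grad2 /xdiff /ydiff -addrA lerD //.
  by rewrite -mulrBr exprMn ler_piMl ?sqr_ge0.
have -> : chi j.+1 * p i j.+1 - chi j * p i j =
   chi j.+1 * (p i j.+1 - p i j) + (chi j.+1 - chi j) * p i j by ring.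
rewrite /F /=; set a := chi j.+1 * _.
have h : ((chi j.+1 - chi j) * p i j) ^+ 2 <= s%:R^-1 ^+ 2 * p i j ^+ 2.
  by rewrite exprMn ler_wpM2r ?sqr_ge0 // cutoff_lip.
set b := _ * p i j in h *; have := sqr_ge0 (a - b); rewrite sqrrB sqrrD; lra.
Qed.

(** The loss is the sum of [(1 - cutoff) * f * xdiff p]. AM-GM with a free weight [beta] bounds it
    by a multiple of the deficit of the cutoff, at most [2 * s] for each [i], plus a multiple of the
    energy of [p] that is small for large [beta]. *)
Lemma cutoff_pairing N s p f beta : (0 < s)%N -> 0 < beta -> (forall i j, `|f i j| <= 1) ->
  gsum N (fun i j => f i j * xdiff p i j) -
    (beta * N%:R * s%:R + (2 * beta)^-1 * gsum N (fun i j => xdiff p i j ^+ 2)) <=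
  gsum N (fun i j => f i j * xdiff (fun i j => cutoff R N s j * p i j) i j).
Proof.
move=> s0 b0 f1; rewrite lerBlDr -lerBlDl -gsumB.
set chi := cutoff R N s.
apply: (le_trans (y := gsum N (fun i j => beta / 2 * (1 - chi j) + (2 * beta)^-1 * xdiff p i j ^+ 2))).
  apply: le_gsum => i j _ _.
  have -> : f i j * xdiff p i j - f i j * xdiff (fun i j => chi j * p i j) i j =
    (1 - chi j) * (f i j * xdiff p i j) by rewrite /xdiff; ring.
  have c1 : 0 <= 1 - chi j by rewrite subr_ge0 cutoff_le1.
  have c2 : 1 - chi j <= 1 by have := cutoff_ge0 R N s j; rewrite -/chi; lra.
  have h : f i j * xdiff p i j <= beta / 2 + (2 * beta)^-1 * xdiff p i j ^+ 2.
    apply: le_trans (norm_le_amgm _ b0); apply: le_trans (ler_norm _) _.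
    by rewrite normrM ler_piMl.
  apply: le_trans (ler_wpM2l c1 h) _; rewrite mulrDr [_ * (beta / 2)]mulrC lerD2l.
  by rewrite ler_piMl // mulr_ge0 ?sqr_ge0 // invr_ge0 mulr_ge0 // ltW.
rewrite gsumD !gsumZ lerD2r.
have -> : gsum N (fun _ j => 1 - chi j) = N%:R * \sum_(j < N) (1 - chi j).
  by rewrite /gsum sumr_const card_ord mulr_natl.
have bN : 0 <= beta / 2 * N%:R by rewrite mulr_ge0 // divr_ge0 // ltW.
have := ler_wpM2l bN (cutoff_deficit R N s0); rewrite -/chi => h.
rewrite mulrA; apply: le_trans h _.
by rewrite (_ : beta / 2 * N%:R * (2 * s%:R) = beta * N%:R * s%:R) //; field.
Qed.

Lemma gsum_shift_le N M a b f : (forall i j, 0 <= f i j) -> (a + N <= M)%N -> (b + N <= M)%N ->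
  gsum N (fun i j => f (a + i)%N (b + j)%N) <= gsum M f.
Proof.
have sh (g : nat -> R) c : (forall i, 0 <= g i) -> (c + N <= M)%N ->
    \sum_(i < N) g (c + i)%N <= \sum_(i < M) g i.
  move=> g0 cM; rewrite -(subnKC cM) big_split_ord /= big_split_ord /=.
  apply: (le_trans (y := \sum_(i < c) g i + \sum_(i < N) g (c + i)%N)).
    by rewrite lerDr sumr_ge0.
  by rewrite lerDl sumr_ge0.
move=> f0 aM bM.
apply: (le_trans (y := \sum_(i < N) \sum_(j < M) f (a + i)%N j)).
  by apply: ler_sum => i _; exact: (sh (f _)).
by apply: (sh (fun i => \sum_(j < M) f i j)) => // i; rewrite sumr_ge0.
Qed.

Lemma gsum_indicator_amgm N (P : nat -> nat -> bool) f l : 0 < l ->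
  gsum N (fun i j => (P i j)%:R * `|f i j|) <=
  l / 2 * gsum N (fun i j => (P i j)%:R) + (2 * l)^-1 * gsum N (fun i j => f i j ^+ 2).
Proof.
move=> l0; rewrite -!gsumZ -gsumD; apply: le_gsum => i j _ _.
case: (P i j); rewrite /= ?mul1r ?mulr1 ?mul0r ?mulr0 ?add0r; first exact: norm_le_amgm.
by rewrite mulr_ge0 ?sqr_ge0 // invr_ge0 mulr_ge0 // ltW.
Qed.

Lemma truncated_pairing n u f (l : R) : 0 < l -> (forall i j, `|f i j| <= 1) ->
  (forall i j : nat, [|| i == 0, 2 ^ n <= i, j == 0 | 2 ^ n <= j]%N -> u i j = 0) ->
  exists U : nat -> nat -> R,
    [/\ forall i j, `|xdiff U i j| <= 16 * l,
        forall i j, `|ydiff U i j| <= 16 * l,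
        forall i j : nat, (i <= 2 ^ n)%N -> (j <= 2 ^ n)%N ->
          [|| i == 0, i == 2 ^ n, j == 0 | j == 2 ^ n]%N -> U i j = 0 &
        gsum (2 ^ n) (fun i j => f i j * xdiff u i j) - 298 / l * gsum (2 ^ n) (grad2 u) <=
        gsum (2 ^ n) (fun i j => f i j * xdiff U i j)].
Proof.
move=> l0 f1 u0; set N := (2 ^ n)%N.
pose v i j := if ((N <= i) && (N <= j))%N then u (i - N)%N (j - N)%N else 0.
have v0 i j : ~~ inside n i j -> v i j = 0.
  rewrite /inside /v -/N => h; case: ifP => // /andP[h1 h2]; apply: u0; rewrite -/N; lia.
have vE i j : v (N + i)%N (N + j)%N = u i j by rewrite /v !leq_addr !addKn.
have [V [Vx Vy Vout Vgood]] := lipschitz_truncation l0 v0.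
exists (fun i j => V (N + i)%N (N + j)%N).
have xE i j : xdiff (fun i j => V (N + i)%N (N + j)%N) i j = xdiff V (N + i)%N (N + j)%N.
  by rewrite /xdiff addnS.
have yE i j : ydiff (fun i j => V (N + i)%N (N + j)%N) i j = ydiff V (N + i)%N (N + j)%N.
  by rewrite /ydiff addnS.
split; first by move=> i j; rewrite xE.
- by move=> i j; rewrite yE.
- move=> i j iN jN h; apply: Vout; rewrite /inside -/N; lia.
set E := gsum N (grad2 u).
have EE : \sum_(a < 3) \sum_(b < 3) box n a b (grad2 v) = E.
  have out i j : ~~ [&& N <= i, i < 2 * N, N <= j & j < 2 * N]%N -> grad2 v i j = 0.
    move=> h; rewrite /grad2 /xdiff /ydiff !v0 ?subrr ?expr0n ?addr0 //; rewrite /inside -/N; lia.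
  have b0 a b : (a != 1)%N || (b != 1)%N -> box n a b (grad2 v) = 0.
    move=> h; rewrite /box big1 // => i _; rewrite big1 // => j _; apply: out.
    have := ltn_ord i; have := ltn_ord j; rewrite -/N; move: (nat_of_ord i) (nat_of_ord j) => i' j' h1 h2.
    case/orP: h => h.
      have [->|[c ->]] : (a = 0 \/ exists c, a = c.+2)%N by case: a h => [|[|c]] // _; [left|right; exists c].
        by rewrite mul0n; lia.
      by rewrite !mulSn; lia.
    have [->|[c ->]] : (b = 0 \/ exists c, b = c.+2)%N by case: b h => [|[|c]] // _; [left|right; exists c].
      by rewrite mul0n; lia.
    by rewrite !mulSn; lia.
  rewrite !big_ord_recl !big_ord0 /= !addr0 ?(b0 0%N) ?(b0 1%N 0%N) ?(b0 1%N 2%N) ?(b0 2%N) //.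
  rewrite !addr0 !add0r; apply: eq_bigr => i _; apply: eq_bigr => j _.
  by rewrite /= -/N !mul1n /grad2 /xdiff /ydiff -!addnS !vE.
have bad_le := bad_pt_count n v l0 (3 * N); rewrite EE in bad_le.
(* The difference at [(i, j)] is known to survive the truncation only if both of its end points are
   good; this doubles the constant 9 to 18. *)
pose bad i j := bad_pt l n v (N + i) (N + j) || bad_pt l n v (N + i.+1) (N + j).
have badc : gsum N (fun i j => (bad i j)%:R) <= 18 / l ^+ 2 * E.
  have h1 := @gsum_shift_le N (3 * N) N N (fun i j => (bad_pt l n v i j)%:R)
    (fun i j => ler0n _ _) ltac:(lia) ltac:(lia).
  have N0 : (0 < N)%N by rewrite expn_gt0.
  have h2 := @gsum_shift_le N (3 * N) N.+1 N (fun i j => (bad_pt l n v i j)%:R)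
    (fun i j => ler0n _ _) ltac:(lia) ltac:(lia).
  apply: (le_trans (y := gsum N (fun i j => (bad_pt l n v (N + i) (N + j))%:R) +
     gsum N (fun i j => (bad_pt l n v (N.+1 + i) (N + j))%:R))); last first.
    by rewrite (_ : 18 / l ^+ 2 * E = 9 / l ^+ 2 * E + 9 / l ^+ 2 * E); [apply: lerD; lra|ring].
  rewrite -gsumD; apply: le_gsum => i j _ _; rewrite /bad addSnnS -natrD ler_nat.
  by do 2!case: bad_pt.
have diff_le : gsum N (fun i j => f i j * xdiff u i j) -
    gsum N (fun i j => f i j * xdiff (fun i j => V (N + i)%N (N + j)%N) i j) <=
    gsum N (fun i j => (bad i j)%:R * `|xdiff u i j|) + 16 * l * gsum N (fun i j => (bad i j)%:R).
  rewrite -gsumB -gsumZ -gsumD; apply: le_gsum => i j iN jN; rewrite xE -mulrBr.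
  have [bd|gd] := boolP (bad i j); rewrite /= ?mul1r ?mul0r ?mulr1 ?mulr0 ?addr0.
    apply: le_trans (ler_norm _) _; rewrite normrM; apply: le_trans (ler_piMl _ (f1 _ _)) _ => //.
    by apply: le_trans (ler_normB _ _) _; rewrite lerD2l.
  move: gd; rewrite negb_or => /andP[g1 g2].
  by rewrite /xdiff -addnS !Vgood ?vE ?subrr ?mulr0 // -/N; lia.
have amgm := gsum_indicator_amgm N bad (xdiff u) l0.
have Ex : gsum N (fun i j => xdiff u i j ^+ 2) <= E.
  by apply: le_gsum => i j _ _; rewrite lerDl sqr_ge0.
set B := gsum N (fun i j => (bad i j)%:R) in badc diff_le amgm.
have h1 : (2 * l)^-1 * gsum N (fun i j => xdiff u i j ^+ 2) <= (2 * l)^-1 * E.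
  by rewrite ler_pM2l // invr_gt0 mulr_gt0.
have h2 : (l / 2 + 16 * l) * B <= (l / 2 + 16 * l) * (18 / l ^+ 2 * E).
  by rewrite ler_pM2l // addr_gt0 ?mulr_gt0 ?invr_gt0.
have E0 : 0 <= E by apply: gsum_ge0 => i j _ _; rewrite addr_ge0 ?sqr_ge0.
(* A bad point loses at most [|xdiff u| + 16 * l], and AM-GM trades [|xdiff u|] for [l / 2] plus
   energy over [2 * l]. Altogether 18 times 16.5, plus one half, which is rounded up to 298. *)
have h3 : (l / 2 + 16 * l) * (18 / l ^+ 2 * E) + (2 * l)^-1 * E = (297 + 2^-1) * (E / l).
  by field; rewrite gt_eqF.
have h4 : 0 <= E / l by rewrite divr_ge0 // ltW.
have h5 : 298 / l * E = 298 * (E / l) by ring.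
rewrite h5; lra.
Qed.

End Gain.

(** * Choice of the constants and passage to a finer grid *)

Section GridGain.
Variable R : realFieldType.
Implicit Types (p u f : nat -> nat -> R).

Definition zero_on_boundary N u := forall i j : nat, (i <= N)%N -> (j <= N)%N ->
  [|| i == 0, i == N, j == 0 | j == N]%N -> u i j = 0.

(** Half the sum of [f ^+ 2] is at least [k / 2 * 4 ^+ n], and three losses of at most
    [k / 8 * 4 ^+ n] are subtracted: the cutoff strips, the AM-GM remainder and the truncation. The
    strips have width [2 ^ (n - r)], a fixed fraction of the side, so the energy after the cutoff is
    at most [5 * 4 ^+ r * 4 ^+ n]; and 11920 is 8 times 298 times 5. *)
Lemma flux_gain n r f (k : R) : (r <= n)%N -> 0 < k -> 32 / k ^+ 2 <= 2 ^+ r ->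
  gsum (2 ^ n) f = 0 -> (forall i j, `|f i j| <= 1) ->
  k * 4 ^+ n <= gsum (2 ^ n) (fun i j => f i j ^+ 2) ->
  let l := 11920 * 4 ^+ r / k in
  exists U, [/\ forall i j, `|xdiff U i j| <= 16 * l, forall i j, `|ydiff U i j| <= 16 * l,
    zero_on_boundary (2 ^ n) U &
    k / 8 * 4 ^+ n <= gsum (2 ^ n) (fun i j => f i j * xdiff U i j) \/
    k / 8 * 4 ^+ n <= gsum (2 ^ n) (fun i j => f j i * xdiff U i j)].
Proof.
move=> rn k0 rk f0 f1 Xk l; set N := (2 ^ n)%N in f0 Xk *.
have [p [p0 px py pair]] := neumann_flux f0.
set X := gsum N (fun i j => f i j ^+ 2) in Xk px py pair.
have N2 : N%:R ^+ 2 = 4 ^+ n :> R by rewrite natrX -exprM mulnC exprM -natrX.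
have XN : X <= 4 ^+ n.
  rewrite -N2 -[N%:R ^+ 2]mul1r -gsum_const; apply: le_gsum => i j _ _.
  by rewrite -real_normK ?num_real // expr_le1.
have Rr0 : 0 < 4 ^+ r :> R by rewrite exprn_gt0.
have l0 : 0 < l by rewrite divr_gt0 // mulr_gt0.
have main f' : (forall i j, `|f' i j| <= 1) -> X / 2 <= gsum N (fun i j => f' i j * xdiff p i j) ->
    exists U, [/\ forall i j, `|xdiff U i j| <= 16 * l, forall i j, `|ydiff U i j| <= 16 * l,
      zero_on_boundary N U & k / 8 * 4 ^+ n <= gsum N (fun i j => f' i j * xdiff U i j)].
  move=> f'1 pr; pose s := (2 ^ (n - r))%N.
  have s0 : (0 < s)%N by rewrite expn_gt0.
  have sR : 0 < s%:R :> R by rewrite ltr0n.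
  have NE : N%:R = 2 ^+ r * s%:R :> R by rewrite -natrX -natrM -expnD subnKC.
  pose u i j := cutoff R N s j * p i j.
  have [i j|U [Ux Uy U0 Ug]] := @truncated_pairing R n u f' l l0 f'1.
    rewrite -/N /u => /or4P[] h.
    - by rewrite p0 ?h ?mulr0.
    - by rewrite p0 ?h ?orbT ?mulr0.
    - by rewrite cutoff_out ?h ?mul0r.
    - by rewrite cutoff_out ?h ?orbT ?mul0r.
  exists U; split=> //; rewrite -/N in Ug.
  have en := cutoff_energy N p s0; rewrite -/u in en.
  have poin := poincare N (fun j => p0 0%N j isT).
  set P := gsum N (fun i j => p i j ^+ 2) in en poin.
  set X1 := gsum N (fun i j => xdiff p i j ^+ 2) in px en poin.
  set E := gsum N (grad2 u) in en Ug.
  have X0 : 0 <= X by apply: gsum_ge0 => *; exact: sqr_ge0.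
  have hP : s%:R^-1 ^+ 2 * P <= 4 ^+ r * X.
    apply: (le_trans (y := s%:R^-1 ^+ 2 * (N%:R ^+ 2 * X))).
      rewrite ler_pM2l ?exprn_gt0 ?invr_gt0 //; apply: le_trans poin _.
      by rewrite ler_wpM2l ?sqr_ge0.
    have e4 : (2 ^+ r) ^+ 2 = 4 ^+ r :> R by rewrite -exprM mulnC exprM -natrX.
    rewrite mulrA (_ : s%:R^-1 ^+ 2 * N%:R ^+ 2 = 4 ^+ r) // NE -e4.
    by field; rewrite gt_eqF.
  have R1 : 1 <= 4 ^+ r :> R by rewrite exprn_ege1 // ler1n.
  have R2 : X <= 4 ^+ r * X by rewrite ler_peMl.
  have EX : E <= 5 * 4 ^+ r * 4 ^+ n.
    have : 4 ^+ r * X <= 4 ^+ r * 4 ^+ n by rewrite ler_pM2l.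
    by move: hP px py R2 en; rewrite -mulrA; clear; lra.
  (* This makes [(2 * beta)^-1] equal to [k / 8]; the strip term is then controlled by the lower
     bound on [2 ^+ r]. *)
  pose beta := 4 / k; have b0 : 0 < beta by rewrite divr_gt0.
  have pc := @cutoff_pairing R N s p f' beta s0 b0 f'1; rewrite -/X1 -/u in pc.
  have h1 : beta * N%:R * s%:R <= k / 8 * 4 ^+ n.
    have -> : 4 ^+ n = 2 ^+ r * (N%:R * s%:R) :> R by rewrite -N2 expr2 {1}NE; ring.
    have -> : beta * N%:R * s%:R = 4 / k * (N%:R * s%:R) by rewrite /beta; ring.
    rewrite [leRHS]mulrA ler_wpM2r ?mulr_ge0 //.
    have := ler_wpM2l (_ : 0 <= k / 8) rk => /(_ _) h.
    apply: le_trans (h _); last by rewrite divr_ge0 // ltW.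
    by rewrite (_ : k / 8 * (32 / k ^+ 2) = 4 / k) //; field; rewrite gt_eqF.
  have h2 : (2 * beta)^-1 * X1 <= k / 8 * 4 ^+ n.
    have -> : (2 * beta)^-1 = k / 8 by rewrite /beta; field; rewrite gt_eqF.
    by rewrite ler_pM2l ?divr_gt0 //; apply: le_trans XN.
  have h3 : 298 / l * E <= k / 8 * 4 ^+ n.
    apply: le_trans (ler_wpM2l _ EX) _; first by rewrite divr_ge0 // ltW.
    rewrite (_ : 298 / l * (5 * 4 ^+ r * 4 ^+ n) = k / 8 * 4 ^+ n) // /l.
    by field; rewrite !gt_eqF.
  by move: Ug pr Xk pc h1 h2 h3; clear; lra.
case: pair => pr.
  by have [U [? ? ? ?]] := main f f1 pr; exists U; split=> //; left.
by have [U [? ? ? ?]] := main (fun i j => f j i) (fun i j => f1 j i) pr; exists U; split=> //; right.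
Qed.

Lemma sum_refine (F : nat -> R) A B : (0 < B)%N ->
  \sum_(i < A * B) F (i %/ B)%N = B%:R * \sum_(i < A) F i.
Proof.
move=> B0; elim: A => [|A IH]; first by rewrite !big_ord0 mulr0.
rewrite mulSnr big_split_ord /= IH big_ord_recr /= mulrDr; congr (_ + _).
rewrite (eq_bigr (fun _ => F A)) => [|j _]; first by rewrite sumr_const card_ord mulr_natl.
by rewrite divnMDl // divn_small // addn0.
Qed.

Lemma gsum_refine A B f : (0 < B)%N ->
  gsum (A * B) (fun i j => f (i %/ B)%N (j %/ B)%N) = B%:R ^+ 2 * gsum A f.
Proof.
move=> B0; rewrite /gsum (sum_refine (fun i => \sum_(j < A * B) f i (j %/ B)%N)) // expr2 -mulrA.
by congr (_ * _); rewrite mulr_sumr; apply: eq_bigr => i _; rewrite (sum_refine (f i)).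
Qed.

(** The composite can change only where [j %/ B] increases, and these increments telescope. *)
Lemma refine_variation (G : nat -> bool) A B : (0 < B)%N ->
  \sum_(j < A * B) `|(G (j %/ B)%N)%:R - (G (j.-1 %/ B)%N)%:R| <= A%:R :> R.
Proof.
move=> B0; apply: (le_trans (y := \sum_(j < A * B) ((j %/ B) - (j.-1 %/ B))%N%:R)).
  apply: ler_sum => j _; have h : (j.-1 %/ B <= j %/ B)%N by apply: leq_div2r; exact: leq_pred.
  move: h; rewrite leq_eqVlt => /orP[/eqP->|h]; first by rewrite !subrr subnn normr0.
  apply: (le_trans (y := 1)); last by rewrite ler1n subn_gt0.
  by do 2!case: (G _); rewrite ?subrr ?subr0 ?sub0r ?normrN ?normr1 ?normr0.
rewrite -natr_sum ler_nat.
have tel M : (\sum_(j < M) (j %/ B - j.-1 %/ B) = M.-1 %/ B)%N.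
  elim: M => [|M IH]; first by rewrite big_ord0 div0n.
  by rewrite big_ord_recr /= IH subnKC // leq_div2r // leq_pred.
by rewrite tel; apply: leq_trans (leq_div2r _ (leq_pred _)) _; rewrite mulnK.
Qed.

(* Summing by parts in [j], the two rows of [xdiff u] only differ where [G] jumps, i.e. at coarse cell boundaries. *)
Lemma row_average_error (G : nat -> nat -> bool) A B u (L : R) : (0 < B)%N ->
  zero_on_boundary (A * B) u -> (forall i j, `|xdiff u i j| <= L) ->
  gsum (A * B) (fun i j => (G (i %/ B)%N (j %/ B)%N)%:R * (xdiff u i j.+1 - xdiff u i j)) <=
  L * (A * B)%:R * A%:R.
Proof.
move=> B0 u0 Lu; set N := (A * B)%N; set g := fun i j => (G (i %/ B)%N (j %/ B)%N)%:R : R.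
have z i : (i < N)%N -> xdiff u i 0 = 0 /\ xdiff u i N = 0.
  move=> iN; have iN' := ltnW iN.
  by rewrite /xdiff !u0 ?subrr ?eqxx ?orbT.
have L0 : 0 <= L by apply: le_trans (Lu 0%N 0%N).
apply: (le_trans (y := \sum_(i < N) (L * A%:R))); last first.
  by rewrite sumr_const card_ord -[_ *+ N]mulr_natl mulrCA mulrA.
apply: ler_sum => i _; have [z0 zN] := z i (ltn_ord i).
under eq_bigr => j _ do rewrite mulrC.
rewrite (@sum_by_parts R (xdiff u i) (fun j => g i j)) // zN mul0r sub0r -sumrN.
apply: (le_trans (y := \sum_(j < N) L * `|g i j - g i j.-1|)).
  apply: ler_sum => j _; apply: le_trans (ler_norm _) _.
  by rewrite normrN normrM ler_wpM2r.
rewrite -mulr_sumr ler_wpM2l //; exact: (refine_variation (G (i %/ B)%N)).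
Qed.

Lemma gsum_xdiff0 N u : zero_on_boundary N u -> gsum N (xdiff u) = 0.
Proof.
move=> u0; rewrite gsum_transpose /gsum big1 // => j _; rewrite /xdiff.
have := @sum_by_parts R (fun i => u i j) (fun _ => 1) N.
rewrite !u0 ?eqxx ?orbT ?(ltnW (ltn_ord j)) // => /(_ erefl).
have e : \sum_(i < N) u i j * (1 - 1) = 0 by rewrite big1 // => i _; rewrite subrr mulr0.
rewrite e mul0r subrr => h.
by rewrite -[RHS]h; apply: eq_bigr => i _; rewrite mulr1.
Qed.

End GridGain.

Theorem grid_shear_gain (R : archiRealFieldType) (g : R) : 0 < g -> g <= 1 / 2 ->
  exists L c : R, [/\ 0 < L, 0 < c & forall (a : nat) (G : nat -> nat -> bool),
    g * 4 ^+ a <= gsum (2 ^ a) (fun i j => (G i j)%:R) <= (1 - g) * 4 ^+ a ->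
    exists (b : nat) (u : nat -> nat -> R),
      [/\ forall i j, `|xdiff u i j| <= L, forall i j, `|ydiff u i j| <= L,
          zero_on_boundary (2 ^ (a + b)) u &
          gsum (2 ^ (a + b)) (fun i j => (G (i %/ 2 ^ b)%N (j %/ 2 ^ b)%N)%:R *
            (xdiff u i j + xdiff u i j.+1)) <= - c * 4 ^+ (a + b) \/
          gsum (2 ^ (a + b)) (fun i j => (G (j %/ 2 ^ b)%N (i %/ 2 ^ b)%N)%:R *
            (xdiff u i j + xdiff u i j.+1)) <= - c * 4 ^+ (a + b)]].
Proof.
(* A 0/1 function of mean [m] has variance [m * (1 - m)], here at least [g * (1 - g) >= g / 2]. *)
move=> g0 g1; pose k := g / 2; have k0 : 0 < k by rewrite divr_gt0.
have pow2 (x : R) : exists r, x <= 2 ^+ r.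
  exists (Num.bound `|x|); apply: le_trans (ler_norm x) _; apply: ltW.
  by apply: lt_trans (archi_boundP (normr_ge0 x)) _; rewrite -natrX ltr_nat ltn_expl.
have [r rk] := pow2 (32 / k ^+ 2).
pose l := 11920 * 4 ^+ r / k; have l0 : 0 < l by rewrite divr_gt0 // mulr_gt0 // exprn_gt0.
(* [r] governs the strip width; [b1] makes the grid so fine inside the cells of [G] that averaging
   two rows costs at most [k / 8 * 4 ^+ n]. *)
have [b1 b1k] := pow2 (16 * l / (k / 8)).
exists (16 * l), (k / 8); split; [by rewrite mulr_gt0 | by rewrite divr_gt0 |].
move=> a G /andP[G1 G2]; pose b := (r + b1)%N; exists b.
set n := (a + b)%N; set N := (2 ^ n)%N; set B := (2 ^ b)%N.
have B0 : (0 < B)%N by rewrite expn_gt0.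
have NE : N = (2 ^ a * B)%N by rewrite -expnD.
pose Gf i j := (G (i %/ B)%N (j %/ B)%N)%:R : R.
have four m : (2 ^ m)%:R ^+ 2 = 4 ^+ m :> R by rewrite natrX -exprM mulnC exprM -natrX.
have n4 : 4 ^+ n = 4 ^+ a * 4 ^+ b :> R by rewrite exprD.
have a40 : 0 < 4 ^+ a :> R by rewrite exprn_gt0.
have b40 : 0 < 4 ^+ b :> R by rewrite exprn_gt0.
have sG : gsum N Gf = 4 ^+ b * gsum (2 ^ a) (fun i j => (G i j)%:R).
  by rewrite NE (gsum_refine _ (fun i j => (G i j)%:R)) // four.
set S := gsum (2 ^ a) _ in G1 G2 sG.
pose m := S / 4 ^+ a.
have mE : S = m * 4 ^+ a by rewrite /m mulfVK // gt_eqF.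
have m1 : g <= m by rewrite /m ler_pdivlMr.
have m2 : m <= 1 - g by rewrite /m ler_pdivrMr.
pose f i j := Gf i j - m.
have f0 : gsum N f = 0.
  by rewrite gsumB gsum_const sG four n4 mE; ring.
have f1 i j : `|f i j| <= 1.
  by rewrite /f /Gf ler_norml; move: g0 g1 m1 m2; clear; case: (G _ _) => /= *; apply/andP; split; lra.
have fk : k * 4 ^+ n <= gsum N (fun i j => f i j ^+ 2).
  have -> : gsum N (fun i j => f i j ^+ 2) = gsum N (fun i j => (1 - 2 * m) * Gf i j + m ^+ 2).
    by apply: eq_gsum => i j _ _; rewrite /f /Gf; case: (G _ _) => /=; ring.
  rewrite gsumD gsumZ gsum_const sG four n4 mE.
  have -> : (1 - 2 * m) * (4 ^+ b * (m * 4 ^+ a)) + m ^+ 2 * (4 ^+ a * 4 ^+ b) =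
     (m * (1 - m)) * (4 ^+ a * 4 ^+ b) by ring.
  rewrite ler_pM2r ?mulr_gt0 // /k; move: g0 g1 m1 m2; clear; nra.
have rn : (r <= n)%N by rewrite /n /b addnCA leq_addr.
have [U [Ux Uy U0 Ug]] := flux_gain rn k0 rk f0 f1 fk; rewrite -/l -/N in Ux Uy U0 Ug.
(* The sign is reversed because [G] is to be compressed. *)
exists (fun i j => - U i j).
have xN i j : xdiff (fun i j => - U i j) i j = - xdiff U i j by rewrite /xdiff; ring.
have yN i j : ydiff (fun i j => - U i j) i j = - ydiff U i j by rewrite /ydiff; ring.
split; first by move=> i j; rewrite xN normrN.
- by move=> i j; rewrite yN normrN.
- by move=> i j iN jN h; rewrite U0 ?oppr0.
have main (H : nat -> nat -> bool) :
    k / 8 * 4 ^+ n <= gsum N (fun i j => ((H (i %/ B)%N (j %/ B)%N)%:R - m) * xdiff U i j) ->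
    gsum N (fun i j => (H (i %/ B)%N (j %/ B)%N)%:R *
      (xdiff (fun i j => - U i j) i j + xdiff (fun i j => - U i j) i j.+1)) <= - (k / 8) * 4 ^+ n.
  move=> h; pose Hf i j := (H (i %/ B)%N (j %/ B)%N)%:R : R.
  (* The mean [m] drops out because [xdiff U] sums to zero. *)
  have e1 : gsum N (fun i j => (Hf i j - m) * xdiff U i j) = gsum N (fun i j => Hf i j * xdiff U i j).
    rewrite (eq_gsum (g := fun i j => Hf i j * xdiff U i j - m * xdiff U i j)) => [|i j _ _]; last by ring.
    by rewrite gsumB gsumZ gsum_xdiff0 // mulr0 subr0.
  rewrite -/(Hf _ _) e1 in h.
  have UN0 : zero_on_boundary (2 ^ a * B) (fun i j => - U i j).
    by move=> i j; rewrite -NE => iN jN hb; rewrite U0 ?oppr0.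
  have Ul i j : `|xdiff (fun i j => - U i j) i j| <= 16 * l by rewrite xN normrN.
  have err := row_average_error H B0 UN0 Ul; rewrite -NE -/(Hf _ _) in err.
  (* The two rows together are twice the first row plus the row error, so the bound is
     [- 2 * (k / 8) + k / 8] times [4 ^+ n]. *)
  have -> : gsum N (fun i j => (H (i %/ B)%N (j %/ B)%N)%:R *
      (xdiff (fun i j => - U i j) i j + xdiff (fun i j => - U i j) i j.+1)) =
    gsum N (fun i j => Hf i j * (xdiff (fun i j => - U i j) i j.+1 - xdiff (fun i j => - U i j) i j)) -
    2 * gsum N (fun i j => Hf i j * xdiff U i j).
    by rewrite -gsumZ -gsumB; apply: eq_gsum => i j _ _; rewrite /Hf !xN; ring.
  have small : 16 * l * N%:R * (2 ^ a)%:R <= k / 8 * 4 ^+ n.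
    have -> : 4 ^+ n = N%:R * (2 ^ a)%:R * B%:R :> R by rewrite -four -/N expr2 {2}NE natrM mulrA.
    have BR : 16 * l / (k / 8) <= B%:R.
      apply: le_trans b1k _; by rewrite -natrX ler_nat leq_exp2l // leq_addl.
    rewrite ler_pdivrMr ?divr_gt0 // in BR.
    have -> : 16 * l * N%:R * (2 ^ a)%:R = (N%:R * (2 ^ a)%:R) * (16 * l) by ring.
    have -> : k / 8 * (N%:R * (2 ^ a)%:R * B%:R) = (N%:R * (2 ^ a)%:R) * (B%:R * (k / 8)) by ring.
    by rewrite ler_wpM2l ?mulr_ge0.
  by move: h err small; clear; lra.
by case: Ug => h; [left; exact: main | right; exact: (main (fun i j => G j i))].
Qed.

End Discrete.

(** * Finite sums over the standard real numbers *)

Fixpoint rsum (n : nat) (f : nat -> R) : R :=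
  match n with O => 0 | S k => rsum k f + f k end.

Lemma rsum_ext n f g : (forall k, (k < n)%nat -> f k = g k) -> rsum n f = rsum n g.
Proof.
  induction n as [|n IH]; simpl; intros H; [reflexivity|].
  rewrite IH by (intros; apply H; lia). rewrite H by lia. reflexivity.
Qed.

Lemma rsum_le n f g : (forall k, (k < n)%nat -> f k <= g k) -> rsum n f <= rsum n g.
Proof.
  induction n as [|n IH]; simpl; intros H; [lra|].
  pose proof (H n ltac:(lia)). specialize (IH (fun k h => H k ltac:(lia))). lra.
Qed.

Lemma rsum_plus n f g : rsum n (fun k => f k + g k) = rsum n f + rsum n g.
Proof. induction n as [|n IH]; simpl; [|rewrite IH]; lra. Qed.

Lemma rsum_scal n a f : rsum n (fun k => a * f k) = a * rsum n f.
Proof. induction n as [|n IH]; simpl; [|rewrite IH]; lra. Qed.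

Lemma rsum_const n a : rsum n (fun _ => a) = INR n * a.
Proof. induction n as [|n IH]; [simpl; lra|]. rewrite S_INR. simpl rsum. rewrite IH. lra. Qed.

Lemma rsum_nonneg n f : (forall k, (k < n)%nat -> 0 <= f k) -> 0 <= rsum n f.
Proof.
  intros H. rewrite <- (Rmult_0_r (INR n)), <- rsum_const. apply rsum_le. exact H.
Qed.

Lemma rsum_mono n m f : (n <= m)%nat -> (forall k, 0 <= f k) -> rsum n f <= rsum m f.
Proof.
  intros H F. induction H as [|m H IH]; simpl; [lra|]. specialize (F m). lra.
Qed.

Lemma rsum_single n k f : (k < n)%nat ->
  rsum n (fun i => if Nat.eq_dec i k then f i else 0) = f k.
Proof.
  intros H. induction n as [|n IH]; [lia|]. simpl.
  destruct (Nat.eq_dec n k) as [->|D].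
  - rewrite (rsum_ext _ _ (fun _ => 0)); [rewrite rsum_const; lra|].
    intros i Hi. destruct (Nat.eq_dec i k); [lia|reflexivity].
  - rewrite IH by lia. lra.
Qed.

Lemma rsum_half_pow n : rsum n (fun k => (/ 2) ^ S k) = 1 - (/ 2) ^ n.
Proof. induction n as [|n IH]; [simpl; lra|]. cbn [rsum]. rewrite IH. simpl. lra. Qed.

Lemma sum_f_R0_rsum f n : sum_f_R0 f n = rsum (S n) f.
Proof. induction n as [|n IH]; simpl; [lra|]. rewrite IH. reflexivity. Qed.

(** A pair is coded by a number no smaller than either coordinate, so the first [n] pairs of the
    enumeration lie in the [n] by [n] square, and each occurs once. *)
Lemma rsum_cantor_le (a : nat -> nat -> R) n : (forall i j, 0 <= a i j) ->
  rsum n (fun k => a (fst (of_nat k)) (snd (of_nat k))) <= rsum n (fun i => rsum n (a i)).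
Proof.
  intros A.
  assert (H : forall m, (m <= n)%nat -> rsum m (fun k => a (fst (of_nat k)) (snd (of_nat k))) <=
    rsum n (fun i => rsum n (fun j => if lt_dec (to_nat (i, j)) m then a i j else 0))).
  { induction m as [|m IH]; intros Hm.
    - apply rsum_nonneg. intros i _. apply rsum_nonneg. intros j _. destruct lt_dec; [apply A|lra].
    - cbn [rsum]. specialize (IH ltac:(lia)).
      destruct (of_nat m) as [i0 j0] eqn:E. cbn [fst snd].
      assert (Em : to_nat (i0, j0) = m) by (rewrite <- E; apply cancel_to_of).
      pose proof (to_nat_non_decreasing i0 j0) as Hij. rewrite Em in Hij.
      assert (Eq : a i0 j0 = rsum n (fun i => rsum n (fun j =>
         if Nat.eq_dec i i0 then if Nat.eq_dec j j0 then a i j else 0 else 0))).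
      { rewrite (rsum_ext n _ (fun i => if Nat.eq_dec i i0 then
          rsum n (fun j => if Nat.eq_dec j j0 then a i j else 0) else 0)).
        - rewrite rsum_single by lia. rewrite rsum_single by lia. reflexivity.
        - intros i _. destruct Nat.eq_dec; [reflexivity|]. rewrite rsum_const. lra. }
      rewrite Eq. apply Rle_trans with (1 := Rplus_le_compat_r _ _ _ IH).
      rewrite <- rsum_plus. apply rsum_le. intros i _. rewrite <- rsum_plus. apply rsum_le.
      intros j _. specialize (A i j).
      destruct (lt_dec (to_nat (i, j)) m) as [H1|H1]; destruct (lt_dec (to_nat (i, j)) (S m)) as [H2|H2];
        destruct (Nat.eq_dec i i0) as [->|]; try destruct (Nat.eq_dec j j0) as [->|]; try lra; try lia. }
  apply Rle_trans with (1 := H n (le_n n)). apply rsum_le. intros i _. apply rsum_le. intros j _.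
  specialize (A i j). destruct lt_dec; lra.
Qed.

(** * Outer measure *)

(* [outer_le S r]: the outer measure of [S] is at most [r]. *)
Definition outer_le (S : pt -> Prop) (r : R) : Prop :=
  forall d, 0 < d -> exists C : nat -> rect,
    (forall n, rect_ok (C n)) /\ (forall x, S x -> exists n, in_rect (C n) x) /\
    (forall n, rsum n (fun k => area (C k)) <= r + d).

Lemma area_nonneg C : rect_ok C -> 0 <= area C.
Proof. intros [H1 H2]. apply Rmult_le_pos; lra. Qed.

Lemma outer_le_mono S S' r r' : (forall x, S x -> S' x) -> r' <= r -> outer_le S' r' -> outer_le S r.
Proof.
  intros HS Hr H d Hd. destruct (H d Hd) as (C & C1 & C2 & C3). exists C. repeat split; auto; [apply C1|apply C1|].
  intros n. specialize (C3 n). lra.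
Qed.

Lemma outer_le_lim S r : (forall d, 0 < d -> outer_le S (r + d)) -> outer_le S r.
Proof.
  intros H d Hd. destruct (H (d / 2) ltac:(lra) (d / 2) ltac:(lra)) as (C & C1 & C2 & C3).
  exists C. repeat split; auto; [apply C1|apply C1|]. intros n. specialize (C3 n). lra.
Qed.

Lemma outer_le_rect C : rect_ok C -> outer_le (in_rect C) (area C).
Proof.
  intros H d Hd. exists (fun n => match n with O => C | _ => mkRect 0 0 0 0 end).
  assert (Z : area (mkRect 0 0 0 0) = 0) by (unfold area; simpl; ring).
  split; [|split].
  - intros [|n]; [exact H|]. split; simpl; lra.
  - intros x Hx. exists O. exact Hx.
  - pose proof (area_nonneg C H) as P.
    assert (E : forall n, rsum n (fun k => area (match k with O => C | _ => mkRect 0 0 0 0 end)) <= area C).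
    { destruct n as [|n]; [simpl; lra|]. induction n as [|n IH]; [simpl; lra|].
      change (rsum (S n) (fun k => area (match k with O => C | _ => mkRect 0 0 0 0 end)) +
        area (mkRect 0 0 0 0) <= area C). lra. }
    intros n. specialize (E n). lra.
Qed.

Lemma outer_le_empty : outer_le (fun _ => False) 0.
Proof.
  apply outer_le_mono with (in_rect (mkRect 0 0 0 0)) (area (mkRect 0 0 0 0)).
  - tauto.
  - unfold area; simpl; lra.
  - apply outer_le_rect. split; simpl; lra.
Qed.

Lemma outer_le_cunion (S : nat -> pt -> Prop) (r : nat -> R) t :
  (forall n, outer_le (S n) (r n)) -> (forall n, rsum n r <= t) ->
  outer_le (fun x => exists n, S n x) t.
Proof.
  intros H Ht d Hd.
  assert (Pp : forall n, 0 < d * (/ 2) ^ Datatypes.S n).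
  { intros n. apply Rmult_lt_0_compat; [lra|]. apply pow_lt; lra. }
  destruct (choice (fun n C => (forall k, rect_ok (C k)) /\ (forall x, S n x -> exists k, in_rect (C k) x) /\
     (forall m, rsum m (fun k => area (C k)) <= r n + d * (/ 2) ^ Datatypes.S n))
     (fun n => H n _ (Pp n))) as [C HC].
  exists (fun k => C (fst (of_nat k)) (snd (of_nat k))). split; [|split].
  - intros n. apply HC.
  - intros x [n Hx]. destruct (HC n) as (_ & C2 & _). destruct (C2 x Hx) as [k Hk].
    exists (to_nat (n, k)). rewrite cancel_of_to. exact Hk.
  - intros n. apply Rle_trans with (rsum n (fun i => rsum n (fun j => area (C i j)))).
    + apply (rsum_cantor_le (fun i j => area (C i j))). intros i j. apply area_nonneg, HC.
    + apply Rle_trans with (rsum n (fun i => r i + d * (/ 2) ^ Datatypes.S i)).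
      * apply rsum_le. intros i _. apply HC.
      * rewrite rsum_plus, rsum_scal, rsum_half_pow. specialize (Ht n).
        assert (0 <= (/ 2) ^ n) by (apply pow_le; lra). nra.
Qed.

Lemma outer_le_nonneg S r : outer_le S r -> 0 <= r.
Proof.
  intros H. apply Rnot_lt_le. intros L.
  destruct (H (- r / 2) ltac:(lra)) as (C & _ & _ & C3). specialize (C3 O). simpl in C3. lra.
Qed.

Lemma outer_le_union S S' r r' : outer_le S r -> outer_le S' r' -> outer_le (fun x => S x \/ S' x) (r + r').
Proof.
  intros H H'. pose proof (outer_le_nonneg S r H) as R1. pose proof (outer_le_nonneg S' r' H') as R2.
  apply outer_le_mono with (fun x => exists n, match n with O => S x | 1%nat => S' x | _ => False end) (r + r').
  - intros x [Hx|Hx]; [exists O|exists 1%nat]; exact Hx.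
  - lra.
  - apply outer_le_cunion with (r := fun n => match n with O => r | 1%nat => r' | _ => 0 end)
      (S := fun n x => match n with O => S x | 1%nat => S' x | _ => False end).
    + intros [|[|n]]; [exact H|exact H'|exact outer_le_empty].
    + intros [|[|n]]; [simpl; lra|simpl; lra|].
      induction n as [|n IH]; [simpl; lra|].
      change (rsum (Datatypes.S (Datatypes.S n)) (fun n => match n with O => r | 1%nat => r' | _ => 0 end) + 0 <= r + r').
      lra.
Qed.

Lemma outer_le_fin n (S : nat -> pt -> Prop) r : (forall k, (k < n)%nat -> outer_le (S k) (r k)) ->
  outer_le (fun x => exists k, (k < n)%nat /\ S k x) (rsum n r).
Proof.
  induction n as [|n IH]; intros H.
  - apply outer_le_mono with (fun _ => False) 0; [|simpl; lra|apply outer_le_empty].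
    intros x (k & Hk & _). lia.
  - simpl. apply outer_le_mono with (fun x => (exists k, (k < n)%nat /\ S k x) \/ S n x) (rsum n r + r n); [|lra|].
    + intros x (k & Hk & Hx). destruct (Nat.eq_dec k n) as [->|]; [right; exact Hx|].
      left. exists k. split; [lia|exact Hx].
    + apply outer_le_union; [apply IH; intros; apply H; lia|apply H; lia].
Qed.

Lemma outer_le_fin2 n (S : nat -> nat -> pt -> Prop) r :
  (forall i j, (i < n)%nat -> (j < n)%nat -> outer_le (S i j) (r i j)) ->
  outer_le (fun x => exists i j, (i < n)%nat /\ (j < n)%nat /\ S i j x) (rsum n (fun i => rsum n (r i))).
Proof.
  intros H.
  apply outer_le_mono with (fun x => exists i, (i < n)%nat /\ exists j, (j < n)%nat /\ S i j x)
    (rsum n (fun i => rsum n (r i))); [|lra|].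
  - intros x (i & j & Hi & Hj & Hx). exists i. split; [exact Hi|]. exists j. auto.
  - apply outer_le_fin with (S := fun i x => exists j, (j < n)%nat /\ S i j x).
    intros i Hi. apply outer_le_fin. auto.
Qed.

Lemma cover_value_outer_le S s : cover_value S s -> outer_le S s.
Proof.
  intros (C & C1 & C2 & C3) d Hd. exists C. split; [exact C1|]. split; [exact C2|].
  intros n. apply Rnot_lt_le. intros L.
  destruct (C3 (d) Hd) as [N HN]. set (M := max N n).
  specialize (HN M ltac:(unfold M; lia)). rewrite sum_f_R0_rsum in HN.
  assert (rsum n (fun k => area (C k)) <= rsum (Datatypes.S M) (fun k => area (C k))).
  { apply rsum_mono; [unfold M; lia|]. intros k. apply area_nonneg, C1. }
  unfold Rdist in HN. apply Rabs_def2 in HN. lra.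
Qed.

Lemma outer_le_cover_value S r d : outer_le S r -> 0 < d -> exists s, cover_value S s /\ s <= r + d.
Proof.
  intros H Hd. destruct (H d Hd) as (C & C1 & C2 & C3).
  assert (G : Un_growing (fun n => sum_f_R0 (fun k => area (C k)) n)).
  { intros n. simpl. pose proof (area_nonneg _ (C1 (Datatypes.S n))). lra. }
  assert (B : has_ub (fun n => sum_f_R0 (fun k => area (C k)) n)).
  { exists (r + d). intros x [n ->]. rewrite sum_f_R0_rsum. apply C3. }
  destruct (growing_cv _ G B) as [s Hs]. exists s. split.
  - exists C. split; [exact C1|]. split; [exact C2|]. exact Hs.
  - apply Rnot_lt_le. intros L. destruct (Hs (s - (r + d)) ltac:(lra)) as [N HN].
    specialize (HN N (le_n N)). rewrite sum_f_R0_rsum in HN. specialize (C3 (Datatypes.S N)).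
    unfold Rdist in HN. apply Rabs_def2 in HN. lra.
Qed.

Lemma lebesgue2_outer_le S m : lebesgue2 S m -> outer_le S m.
Proof.
  intros [_ H2]. apply outer_le_lim. intros d Hd.
  destruct (classic (exists s, cover_value S s /\ s <= m + d)) as [(s & Hs & L)|N].
  - apply outer_le_mono with S s; auto. apply cover_value_outer_le, Hs.
  - exfalso. assert (m + d <= m); [|lra]. apply H2. intros s Hs. apply Rnot_lt_le. intros L.
    apply N. exists s. split; [exact Hs|lra].
Qed.

Lemma lebesgue2_le S m r : lebesgue2 S m -> outer_le S r -> m <= r.
Proof.
  intros [H1 _] H. apply Rnot_lt_le. intros L.
  destruct (outer_le_cover_value S r ((m - r) / 2) H ltac:(lra)) as (s & Hs & Ls).
  specialize (H1 s Hs). lra.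
Qed.

(** * The unit square *)

(** The length of the intersection of [[a, b]] and [[x, x + s]]. *)
Definition overlap (a b x s : R) : R := Rmax 0 (Rmin b (x + s) - Rmax a x).

Lemma overlap_nonneg a b x s : 0 <= overlap a b x s.
Proof. apply Rmax_l. Qed.

Lemma overlap_split a b x s : a <= b -> 0 <= s ->
  overlap a b x (2 * s) = overlap a b x s + overlap a b (x + s) s.
Proof.
  intros. unfold overlap, Rmax, Rmin. repeat destruct Rle_dec; lra.
Qed.

Lemma overlap_le a b x s : a <= b -> overlap a b x s <= b - a.
Proof. intros. unfold overlap, Rmax, Rmin. repeat destruct Rle_dec; lra. Qed.

Lemma overlap_full a b x s : a <= x -> x + s <= b -> 0 <= s -> overlap a b x s = s.
Proof. intros. unfold overlap, Rmax, Rmin. repeat destruct Rle_dec; lra. Qed.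

Definition overlap2 (C : rect) (x y s : R) : R :=
  overlap (ra C) (rb C) x s * overlap (rc C) (rd C) y s.

Lemma overlap2_nonneg C x y s : 0 <= overlap2 C x y s.
Proof. apply Rmult_le_pos; apply overlap_nonneg. Qed.

(** The cover fills at most the fraction [q] of the square of side [s] with lower left corner
    [(x, y)], counted with multiplicity. *)
Definition sparse (C : nat -> rect) (q x y s : R) : Prop :=
  forall n, rsum n (fun k => overlap2 (C k) x y s) <= q * s ^ 2.

(** If all four quarters failed, one sufficiently long partial sum would exceed the bound on every
    quarter, hence on the whole square. *)
Lemma sparse_child C q x y s : (forall n, rect_ok (C n)) -> 0 <= s -> sparse C q x y (2 * s) ->
  exists a b, (a = 0 \/ a = s) /\ (b = 0 \/ b = s) /\ sparse C q (x + a) (y + b) s.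
Proof.
  intros OK Hs H. apply NNPP. intros N.
  assert (V : forall a b, (a = 0 \/ a = s) -> (b = 0 \/ b = s) ->
     exists n, q * s ^ 2 < rsum n (fun k => overlap2 (C k) (x + a) (y + b) s)).
  { intros a b Ha Hb. apply NNPP. intros M. apply N. exists a, b. repeat split; auto.
    intros n. apply Rnot_lt_le. intros L. apply M. exists n. exact L. }
  destruct (V 0 0 ltac:(auto) ltac:(auto)) as [n1 V1].
  destruct (V 0 s ltac:(auto) ltac:(auto)) as [n2 V2].
  destruct (V s 0 ltac:(auto) ltac:(auto)) as [n3 V3].
  destruct (V s s ltac:(auto) ltac:(auto)) as [n4 V4].
  pose (m := (n1 + n2 + n3 + n4)%nat).
  assert (Mo : forall a b n, (n <= m)%nat -> rsum n (fun k => overlap2 (C k) (x + a) (y + b) s) <=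
     rsum m (fun k => overlap2 (C k) (x + a) (y + b) s)).
  { intros. apply rsum_mono; [assumption|]. intros; apply overlap2_nonneg. }
  pose proof (Mo 0 0 n1 ltac:(unfold m; lia)). pose proof (Mo 0 s n2 ltac:(unfold m; lia)).
  pose proof (Mo s 0 n3 ltac:(unfold m; lia)). pose proof (Mo s s n4 ltac:(unfold m; lia)).
  specialize (H m).
  assert (E : rsum m (fun k => overlap2 (C k) x y (2 * s)) =
    rsum m (fun k => overlap2 (C k) (x + 0) (y + 0) s) + rsum m (fun k => overlap2 (C k) (x + 0) (y + s) s)
    + (rsum m (fun k => overlap2 (C k) (x + s) (y + 0) s) + rsum m (fun k => overlap2 (C k) (x + s) (y + s) s))).
  { rewrite <- !rsum_plus. apply rsum_ext. intros k _. destruct (OK k) as [O1 O2].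
    unfold overlap2. rewrite !overlap_split by assumption. rewrite !Rplus_0_r. ring. }
  nra.
Qed.

Lemma nested_limit (x : nat -> R) : (forall n, x n <= x (S n) <= x n + (/ 2) ^ S n) ->
  exists l, forall n, x n <= l <= x n + (/ 2) ^ n.
Proof.
  intros H.
  assert (M : forall n k, x n <= x (n + k)%nat <= x n + ((/ 2) ^ n - (/ 2) ^ (n + k))).
  { intros n k. induction k as [|k IH]; [rewrite Nat.add_0_r; lra|].
    rewrite Nat.add_succ_r. specialize (H (n + k)%nat). simpl in *. lra. }
  assert (P : forall n, 0 < (/ 2) ^ n) by (intros; apply pow_lt; lra).
  destruct (completeness (fun r => exists n, r = x n)) as [l [L1 L2]].
  - exists (x O + 1). intros r [n ->]. specialize (M O n). specialize (P n). simpl in *. lra.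
  - exists (x O). exists O. reflexivity.
  - exists l. intros n. split; [apply L1; exists n; reflexivity|].
    apply L2. intros r [m ->]. destruct (le_lt_dec n m) as [Hm|Hm].
    + specialize (M n (m - n)%nat). replace (n + (m - n))%nat with m in M by lia. specialize (P m). lra.
    + specialize (M m (n - m)%nat). replace (m + (n - m))%nat with n in M by lia. specialize (P n). lra.
Qed.

Lemma pow_half_small e : 0 < e -> exists n, (/ 2) ^ n < e.
Proof.
  intros He. destruct (pow_lt_1_zero (/ 2) ltac:(rewrite Rabs_pos_eq; lra) e He) as [N HN].
  exists N. specialize (HN N (le_n N)). rewrite Rabs_pos_eq in HN; [exact HN|]. apply pow_le; lra.
Qed.

(* Bisection: if the enlarged cover had total area below 1, some subsquare of every dyadic size would be
   covered with density below 1; these shrink to a point, near which one rectangle covers everything. *)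
Lemma outer_le_square r : outer_le in_square r -> 1 <= r.
Proof.
  intros H. apply Rnot_lt_le. intros L. set (d := (1 - r) / 4).
  assert (Hd : 0 < d) by (unfold d; lra).
  destruct (H d Hd) as (C & C1 & C2 & C3).
  (* Moving each side outwards by [e] adds [2 * e] times the sum of width and height, plus
     [4 * e ^ 2], to the area. For [e <= 1] this is at most [e * wd]. *)
  set (wd := fun n => 2 * (rb (C n) - ra (C n)) + 2 * (rd (C n) - rc (C n)) + 4).
  set (e := fun n => Rmin 1 (d * (/ 2) ^ S n / wd n)).
  assert (Wp : forall n, 0 < wd n) by (intros n; destruct (C1 n); unfold wd; lra).
  assert (Ep : forall n, 0 < e n).
  { intros n. unfold e. apply Rmin_glb_lt; [lra|]. apply Rdiv_lt_0_compat; [|apply Wp].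
    apply Rmult_lt_0_compat; [lra|]. apply pow_lt; lra. }
  set (D := fun n => mkRect (ra (C n) - e n) (rb (C n) + e n) (rc (C n) - e n) (rd (C n) + e n)).
  assert (D1 : forall n, rect_ok (D n)).
  { intros n. destruct (C1 n). specialize (Ep n). split; simpl; lra. }
  assert (DA : forall n, area (D n) <= area (C n) + d * (/ 2) ^ S n).
  { intros n. unfold area. simpl ra. simpl rb. simpl rc. simpl rd.
    destruct (C1 n) as [O1 O2]. specialize (Ep n). specialize (Wp n).
    assert (E1 : e n <= 1) by apply Rmin_l.
    assert (E2 : e n * wd n <= d * (/ 2) ^ S n).
    { apply Rle_trans with (d * (/ 2) ^ S n / wd n * wd n); [|right; field; lra].
      apply Rmult_le_compat_r; [lra|]. apply Rmin_r. }
    unfold wd in E2. nra. }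
  assert (S0 : sparse D (r + 2 * d) 0 0 1).
  { intros n. apply Rle_trans with (rsum n (fun k => area (C k) + d * (/ 2) ^ S k)).
    - apply rsum_le. intros k _. apply Rle_trans with (2 := DA k). destruct (D1 k) as [O1 O2].
      apply Rmult_le_compat; try apply overlap_nonneg; apply overlap_le; assumption.
    - rewrite rsum_plus, rsum_scal, rsum_half_pow. specialize (C3 n).
      assert (0 < (/ 2) ^ n) by (apply pow_lt; lra). nra. }
  set (P := fun (n : nat) (z : R * R) => sparse D (r + 2 * d) (fst z) (snd z) ((/ 2) ^ n)).
  assert (Step : forall n z, exists z', P n z -> P (S n) z' /\
     (fst z <= fst z' <= fst z + (/ 2) ^ S n) /\ (snd z <= snd z' <= snd z + (/ 2) ^ S n)).
  { intros n z. destruct (classic (P n z)) as [Hz|Hz]; [|exists z; tauto].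
    assert (Pp : 0 < (/ 2) ^ S n) by (apply pow_lt; lra).
    destruct (sparse_child D (r + 2 * d) (fst z) (snd z) ((/ 2) ^ S n) D1 ltac:(lra)) as (a & b & Ha & Hb & Hab).
    - replace (2 * (/ 2) ^ S n) with ((/ 2) ^ n) by (simpl; field). exact Hz.
    - exists (fst z + a, snd z + b). intros _. split; [exact Hab|]. simpl fst. simpl snd.
      destruct Ha; destruct Hb; lra. }
  destruct (choice (fun (nz : nat * (R * R)) z' => P (fst nz) (snd nz) -> P (S (fst nz)) z' /\
     (fst (snd nz) <= fst z' <= fst (snd nz) + (/ 2) ^ S (fst nz)) /\
     (snd (snd nz) <= snd z' <= snd (snd nz) + (/ 2) ^ S (fst nz)))) as [nx Hnx].
  { intros [n z]. exact (Step n z). }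
  set (z := fix z n := match n with O => (0, 0) | S m => nx (m, z m) end).
  assert (Pz : forall n, P n (z n)).
  { induction n as [|n IH]; [exact S0|]. exact (proj1 (Hnx (n, z n) IH)). }
  assert (Zs : forall n, (fst (z n) <= fst (z (S n)) <= fst (z n) + (/ 2) ^ S n) /\
     (snd (z n) <= snd (z (S n)) <= snd (z n) + (/ 2) ^ S n)).
  { intros n. exact (proj2 (Hnx (n, z n) (Pz n))). }
  destruct (nested_limit (fun n => fst (z n)) (fun n => proj1 (Zs n))) as [lx Lx].
  destruct (nested_limit (fun n => snd (z n)) (fun n => proj2 (Zs n))) as [ly Ly].
  destruct (C2 (lx, ly)) as [k Hk].
  { pose proof (Lx O). pose proof (Ly O). simpl in *. split; simpl; lra. }
  destruct (pow_half_small (e k) (Ep k)) as [n Hn].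
  specialize (Lx n). specialize (Ly n). simpl in Lx, Ly.
  assert (F : overlap2 (D k) (fst (z n)) (snd (z n)) ((/ 2) ^ n) = (/ 2) ^ n * (/ 2) ^ n).
  { destruct Hk as [[K1 K2] [K3 K4]]. simpl in *. assert (0 < (/ 2) ^ n) by (apply pow_lt; lra).
    unfold overlap2. rewrite !overlap_full; simpl; lra. }
  pose proof (Pz n (S k)) as B. simpl rsum in B. rewrite F in B.
  assert (0 <= rsum k (fun j => overlap2 (D j) (fst (z n)) (snd (z n)) ((/ 2) ^ n)))
    by (apply rsum_nonneg; intros; apply overlap2_nonneg).
  assert (0 < (/ 2) ^ n) by (apply pow_lt; lra).
  assert (0 < (/ 2) ^ n * (/ 2) ^ n) by (apply Rmult_lt_0_compat; assumption).
  assert (r + 2 * d < 1) by (unfold d; lra). nra.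
Qed.

(** * Dyadic grid sets *)

Definition grid_index (n : nat) (x : R) : nat := Z.to_nat (Int_part (x * 2 ^ n)).

Definition grid_set (n : nat) (E : nat -> nat -> bool) (z : pt) : Prop :=
  E (grid_index n (fst z)) (grid_index n (snd z)) = true.

Definition b2r (b : bool) : R := if b then 1 else 0.

Definition grid_area (n : nat) (E : nat -> nat -> bool) : R :=
  rsum (2 ^ n) (fun i => rsum (2 ^ n) (fun j => b2r (E i j))) / 4 ^ n.

Definition cell (n i j : nat) : rect :=
  mkRect (INR i / 2 ^ n) (INR (S i) / 2 ^ n) (INR j / 2 ^ n) (INR (S j) / 2 ^ n).

Lemma INR_pow2 n : INR (2 ^ n) = 2 ^ n.
Proof. rewrite pow_INR. reflexivity. Qed.

Lemma pow4_sqr n : 4 ^ n = 2 ^ n * 2 ^ n.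
Proof. rewrite <- Rpow_mult_distr. replace (2 * 2) with 4 by lra. reflexivity. Qed.

Lemma pow2_pos n : 0 < 2 ^ n.
Proof. apply pow_lt; lra. Qed.

Lemma pow2_nonzero n : (2 ^ n <> 0)%nat.
Proof. apply Nat.pow_nonzero. lia. Qed.

Lemma grid_index_spec n x : 0 <= x -> INR (grid_index n x) <= x * 2 ^ n < INR (grid_index n x) + 1.
Proof.
  intros Hx. unfold grid_index. destruct (base_Int_part (x * 2 ^ n)) as [H1 H2].
  assert (0 <= x * 2 ^ n) by (apply Rmult_le_pos; [exact Hx|apply Rlt_le, pow2_pos]).
  assert (0 <= Int_part (x * 2 ^ n))%Z.
  { apply Z.lt_succ_r. apply lt_IZR. rewrite succ_IZR. lra. }
  rewrite INR_IZR_INZ, Z2Nat.id by assumption. lra.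
Qed.

Lemma grid_index_unique n x k : 0 <= x -> INR k <= x * 2 ^ n < INR k + 1 -> grid_index n x = k.
Proof.
  intros Hx Hk. pose proof (grid_index_spec n x Hx).
  assert (grid_index n x < S k)%nat by (apply INR_lt; rewrite S_INR; lra).
  assert (k < S (grid_index n x))%nat by (apply INR_lt; rewrite S_INR; lra). lia.
Qed.

Lemma grid_index_lt n x : 0 <= x < 1 -> (grid_index n x < 2 ^ n)%nat.
Proof.
  intros Hx. apply INR_lt. rewrite INR_pow2. pose proof (grid_index_spec n x ltac:(lra)).
  pose proof (pow2_pos n). nra.
Qed.

Lemma grid_index_refine n b x : 0 <= x -> (grid_index (n + b) x / 2 ^ b)%nat = grid_index n x.
Proof.
  intros Hx. symmetry. apply grid_index_unique; [exact Hx|].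
  pose proof (grid_index_spec (n + b) x Hx) as H. set (k := grid_index (n + b) x) in *.
  rewrite pow_add in H. pose proof (Nat.div_mod k (2 ^ b) (pow2_nonzero b)) as E.
  pose proof (Nat.mod_upper_bound k (2 ^ b) (pow2_nonzero b)) as B.
  set (q := (k / 2 ^ b)%nat) in *. set (t := (k mod 2 ^ b)%nat) in *.
  apply (f_equal INR) in E. rewrite plus_INR, mult_INR, INR_pow2 in E.
  assert (B' : INR t + 1 <= 2 ^ b) by (rewrite <- INR_pow2, <- S_INR; apply le_INR; lia).
  pose proof (pos_INR t). pose proof (pow2_pos b). split.
  - apply Rmult_le_reg_r with (2 ^ b); [assumption|]. lra.
  - apply Rmult_lt_reg_r with (2 ^ b); [assumption|]. lra.
Qed.

Definition refined (b : nat) (E : nat -> nat -> bool) (i j : nat) : bool :=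
  E (i / 2 ^ b)%nat (j / 2 ^ b)%nat.

Lemma grid_set_refine n b E z : in_square z ->
  grid_set (n + b) (refined b E) z <-> grid_set n E z.
Proof.
  intros [H1 H2]. unfold grid_set, refined. rewrite !grid_index_refine by tauto. reflexivity.
Qed.

Lemma rsum_refine (f : nat -> R) A B : (B <> 0)%nat ->
  rsum (A * B) (fun i => f (i / B)%nat) = INR B * rsum A f.
Proof.
  intros HB. induction A as [|A IH]; [simpl; lra|].
  assert (Hk : forall k, (k <= B)%nat ->
    rsum (A * B + k) (fun i => f (i / B)%nat) = INR B * rsum A f + INR k * f A).
  { induction k as [|k IHk]; intros Hk; [rewrite Nat.add_0_r, IH; simpl; lra|].
    rewrite Nat.add_succ_r, S_INR. cbn [rsum]. rewrite IHk by lia.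
    replace ((A * B + k) / B)%nat with A; [lra|].
    rewrite Nat.add_comm, Nat.div_add by exact HB. rewrite Nat.div_small by lia. reflexivity. }
  replace (S A * B)%nat with (A * B + B)%nat by lia. rewrite Hk by lia. cbn [rsum]. lra.
Qed.

Lemma grid_area_refine n b E :
  grid_area (n + b) (refined b E) = grid_area n E.
Proof.
  unfold grid_area, refined. rewrite Nat.pow_add_r.
  rewrite (rsum_refine (fun i => rsum (2 ^ n * 2 ^ b) (fun j => b2r (E i (j / 2 ^ b)%nat)))) by apply pow2_nonzero.
  rewrite (rsum_ext _ _ (fun i => INR (2 ^ b) * rsum (2 ^ n) (fun j => b2r (E i j)))).
  - rewrite rsum_scal, INR_pow2, pow_add, (pow4_sqr b). pose proof (pow2_pos b).
    assert (0 < 4 ^ n) by (apply pow_lt; lra). field. split; lra.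
  - intros i _. rewrite (rsum_refine (fun j => b2r (E i j))) by apply pow2_nonzero. reflexivity.
Qed.

Lemma grid_area_plus n E F G : (forall i j, b2r (G i j) = b2r (E i j) + b2r (F i j)) ->
  grid_area n G = grid_area n E + grid_area n F.
Proof.
  intros H. unfold grid_area. rewrite <- Rdiv_plus_distr, <- rsum_plus. f_equal.
  apply rsum_ext. intros i _. rewrite <- rsum_plus. apply rsum_ext. intros j _. apply H.
Qed.

Lemma grid_area_full n : grid_area n (fun _ _ => true) = 1.
Proof.
  unfold grid_area. simpl b2r. rewrite !rsum_const, INR_pow2, pow4_sqr. pose proof (pow2_pos n). field. lra.
Qed.

Lemma grid_area_negb n E : grid_area n (fun i j => negb (E i j)) = 1 - grid_area n E.
Proof.
  assert (H : grid_area n (fun _ _ => true) = grid_area n E + grid_area n (fun i j => negb (E i j))).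
  { apply grid_area_plus. intros i j. destruct (E i j); simpl; lra. }
  rewrite grid_area_full in H. lra.
Qed.

Lemma grid_area_nonneg n E : 0 <= grid_area n E.
Proof.
  apply Rmult_le_pos; [|apply Rlt_le, Rinv_0_lt_compat, pow_lt; lra].
  apply rsum_nonneg. intros i _. apply rsum_nonneg. intros j _. destruct (E i j); simpl; lra.
Qed.

Lemma grid_area_le1 n E : grid_area n E <= 1.
Proof. pose proof (grid_area_nonneg n (fun i j => negb (E i j))). rewrite grid_area_negb in H. lra. Qed.

Lemma rsum_exchange n m (f : nat -> nat -> R) :
  rsum n (fun i => rsum m (f i)) = rsum m (fun j => rsum n (fun i => f i j)).
Proof.
  induction n as [|n IH]; [simpl; rewrite rsum_const; lra|].
  cbn [rsum]. rewrite IH, <- rsum_plus. reflexivity.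
Qed.

Lemma grid_area_transpose n E : grid_area n (fun i j => E j i) = grid_area n E.
Proof. unfold grid_area. rewrite rsum_exchange. reflexivity. Qed.

Lemma cell_ok n i j : rect_ok (cell n i j).
Proof.
  pose proof (pow2_pos n). split; unfold cell; cbn [ra rb rc rd]; rewrite S_INR;
    (apply Rmult_le_compat_r; [apply Rlt_le, Rinv_0_lt_compat; assumption|lra]).
Qed.

Lemma cell_area n i j : area (cell n i j) = / 4 ^ n.
Proof.
  unfold area, cell. cbn [ra rb rc rd].
  rewrite !S_INR, pow4_sqr. pose proof (pow2_pos n). field. lra.
Qed.

Lemma in_cell n z : 0 <= fst z -> 0 <= snd z ->
  in_rect (cell n (grid_index n (fst z)) (grid_index n (snd z))) z.
Proof.
  intros H1 H2. pose proof (pow2_pos n).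
  pose proof (grid_index_spec n _ H1). pose proof (grid_index_spec n _ H2).
  unfold in_rect, cell. cbn [ra rb rc rd]. rewrite !S_INR.
  repeat split; apply Rmult_le_reg_r with (2 ^ n); try assumption; unfold Rdiv;
    rewrite ?Rmult_assoc, ?Rinv_l by lra; lra.
Qed.

(* [grid_index n 1 = 2 ^ n], so the right and top sides belong to no cell of the grid. *)
Lemma grid_set_cells n E z : in_square z -> grid_set n E z ->
  (fst z = 1 \/ snd z = 1) \/
  exists i j, (i < 2 ^ n)%nat /\ (j < 2 ^ n)%nat /\ (E i j = true /\ in_rect (cell n i j) z).
Proof.
  intros [H1 H2] Hz. destruct (Req_dec (fst z) 1) as [|N1]; [auto|].
  destruct (Req_dec (snd z) 1) as [|N2]; [auto|]. right.
  exists (grid_index n (fst z)), (grid_index n (snd z)).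
  split; [apply grid_index_lt; lra|]. split; [apply grid_index_lt; lra|].
  split; [exact Hz|]. apply in_cell; tauto.
Qed.

Lemma outer_le_sides : outer_le (fun z => in_square z /\ (fst z = 1 \/ snd z = 1)) 0.
Proof.
  apply outer_le_mono with (fun z => in_rect (mkRect 1 1 0 1) z \/ in_rect (mkRect 0 1 1 1) z)
    (area (mkRect 1 1 0 1) + area (mkRect 0 1 1 1)).
  - intros z [[H1 H2] [H|H]]; [left|right]; split; simpl; lra.
  - unfold area; simpl; lra.
  - apply outer_le_union; apply outer_le_rect; split; simpl; lra.
Qed.

Lemma outer_le_grid_set n E : outer_le (fun z => in_square z /\ grid_set n E z) (grid_area n E).
Proof.
  apply outer_le_mono with (fun z => (in_square z /\ (fst z = 1 \/ snd z = 1)) \/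
    exists i j, (i < 2 ^ n)%nat /\ (j < 2 ^ n)%nat /\ (E i j = true /\ in_rect (cell n i j) z))
    (0 + rsum (2 ^ n) (fun i => rsum (2 ^ n) (fun j => / 4 ^ n * b2r (E i j)))).
  - intros z [Hz Hs]. destruct (grid_set_cells n E z Hz Hs); auto.
  - unfold grid_area. right. rewrite Rplus_0_l. unfold Rdiv. rewrite Rmult_comm, <- rsum_scal.
    apply rsum_ext. intros i _. apply rsum_scal.
  - apply outer_le_union; [apply outer_le_sides|].
    apply outer_le_fin2 with (S := fun i j z => E i j = true /\ in_rect (cell n i j) z).
    intros i j _ _. destruct (E i j) eqn:Ee; simpl b2r.
    + apply outer_le_mono with (in_rect (cell n i j)) (area (cell n i j)); [tauto| |apply outer_le_rect, cell_ok].
      rewrite cell_area. lra.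
    + apply outer_le_mono with (fun _ => False) 0; [|lra|apply outer_le_empty]. intros x [H _]. discriminate.
Qed.

(** * Approximation of Borel sets by grid sets *)

Definition grid_approx (A : pt -> Prop) : Prop :=
  forall d, 0 < d -> exists n E, outer_le (fun z => in_square z /\
    ((A z /\ ~ grid_set n E z) \/ (~ A z /\ grid_set n E z))) d.

Lemma grid_approx_ext A B : (forall z, in_square z -> (A z <-> B z)) -> grid_approx A -> grid_approx B.
Proof.
  intros H HA d Hd. destruct (HA d Hd) as (n & E & HE). exists n, E.
  apply outer_le_mono with (3 := HE); [|lra]. intros z [Hz Hd']. specialize (H z Hz). tauto.
Qed.

Lemma grid_set_negb n E z : grid_set n (fun i j => negb (E i j)) z <-> ~ grid_set n E z.
Proof. unfold grid_set. destruct (E _ _); simpl; split; congruence. Qed.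

Lemma grid_approx_compl A : grid_approx A -> grid_approx (fun z => ~ A z).
Proof.
  intros HA d Hd. destruct (HA d Hd) as (n & E & HE). exists n, (fun i j => negb (E i j)).
  apply outer_le_mono with (3 := HE); [|lra]. intros z [Hz Hd']. split; [exact Hz|].
  rewrite grid_set_negb in Hd'. tauto.
Qed.

Lemma grid_approx_grid_set n E : grid_approx (grid_set n E).
Proof.
  intros d Hd. exists n, E. apply outer_le_mono with (fun _ => False) 0; [|lra|apply outer_le_empty]. tauto.
Qed.

Definition gset := (nat * (nat -> nat -> bool))%type.

Definition gin (g : gset) : pt -> Prop := grid_set (fst g) (snd g).
Definition garea (g : gset) : R := grid_area (fst g) (snd g).

(** The sum of the two levels serves as a common refinement. *)
Definition gcombine (op : bool -> bool -> bool) (g h : gset) : gset :=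
  ((fst g + fst h)%nat, fun i j =>
    op (refined (fst h) (snd g) i j) (refined (fst g) (snd h) i j)).

Lemma gin_combine op g h z : in_square z -> gin (gcombine op g h) z <->
  op (snd g (grid_index (fst g) (fst z)) (grid_index (fst g) (snd z)))
     (snd h (grid_index (fst h) (fst z)) (grid_index (fst h) (snd z))) = true.
Proof.
  intros [H1 H2]. unfold gin, grid_set, gcombine, refined. cbn [fst snd]. rewrite !grid_index_refine by tauto.
  rewrite (Nat.add_comm (fst g) (fst h)), !grid_index_refine by tauto. reflexivity.
Qed.

Definition gunion := gcombine orb.
Definition gdiff := gcombine (fun a b => andb (negb a) b).

Lemma gin_union g h z : in_square z -> gin (gunion g h) z <-> gin g z \/ gin h z.
Proof. intros Hz. unfold gunion. rewrite gin_combine by exact Hz. apply Bool.orb_true_iff. Qed.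

Lemma gin_diff g h z : in_square z -> gin (gdiff g h) z <-> ~ gin g z /\ gin h z.
Proof.
  intros Hz. unfold gdiff. rewrite gin_combine by exact Hz. rewrite Bool.andb_true_iff, Bool.negb_true_iff.
  unfold gin, grid_set. destruct (snd g _ _); intuition congruence.
Qed.

Lemma garea_union g h : garea (gunion g h) = garea g + garea (gdiff g h).
Proof.
  unfold garea. rewrite <- (grid_area_refine (fst g) (fst h) (snd g)).
  apply grid_area_plus. intros i j. unfold gunion, gdiff, gcombine. cbn [fst snd].
  destruct (refined _ (snd g) i j), (refined _ (snd h) i j); simpl; lra.
Qed.

(** The areas of the finite unions [F k] increase and stay below 1, so from some [K] on all later
    additions have total area at most [d / 2], and the union can be cut at [K]. The other [d / 2]
    pays for approximating the individual [A k]. *)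
Lemma grid_approx_cunion (A : nat -> pt -> Prop) : (forall k, grid_approx (A k)) ->
  grid_approx (fun z => exists k, A k z).
Proof.
  intros H d Hd.
  assert (Dp : forall k, 0 < d / 2 * (/ 2) ^ S k).
  { intros k. apply Rmult_lt_0_compat; [lra|]. apply pow_lt; lra. }
  destruct (choice (fun k (g : gset) => outer_le (fun z => in_square z /\
     ((A k z /\ ~ gin g z) \/ (~ A k z /\ gin g z))) (d / 2 * (/ 2) ^ S k))) as [E HE].
  { intros k. destruct (H k _ (Dp k)) as (n & E & HE). exists (n, E). exact HE. }
  set (F := fix F k := match k with O => E O | S m => gunion (F m) (E (S m)) end).
  set (D := fun k => gdiff (F k) (E (S k))).
  assert (FD : forall k, garea (F (S k)) = garea (F k) + garea (D k)) by (intros; apply garea_union).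
  assert (EF : forall k m z, in_square z -> (k <= m)%nat -> gin (E k) z -> gin (F m) z).
  { intros k m z Hz Hkm Hk. induction Hkm as [|m Hkm IH].
    - destruct k; [exact Hk|]. apply gin_union; auto.
    - apply gin_union; auto. }
  assert (FE : forall m z, in_square z -> gin (F m) z -> exists k, gin (E k) z).
  { induction m as [|m IH]; intros z Hz Hm; [exists O; exact Hm|].
    apply gin_union in Hm; [|exact Hz]. destruct Hm as [Hm|Hm]; [apply IH; assumption|exists (S m); exact Hm]. }
  destruct (completeness (fun r => exists k, r = garea (F k))) as [l [L1 L2]].
  { exists 1. intros r [k ->]. apply grid_area_le1. }
  { exists (garea (F O)), O. reflexivity. }
  assert (exists K, l - d / 2 < garea (F K)) as [K HK].
  { apply NNPP. intros N. assert (l <= l - d / 2); [|lra]. apply L2. intros r [k ->].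
    apply Rnot_lt_le. intros L. apply N. exists k. exact L. }
  assert (Tail : forall n, rsum n (fun k => garea (D (K + k)%nat)) <= d / 2).
  { intros n. assert (Eq : rsum n (fun k => garea (D (K + k)%nat)) = garea (F (K + n)%nat) - garea (F K)).
    { induction n as [|n IH]; [rewrite Nat.add_0_r; simpl; lra|].
      rewrite Nat.add_succ_r, FD. cbn [rsum]. rewrite IH. lra. }
    rewrite Eq. assert (garea (F (K + n)%nat) <= l) by (apply L1; eexists; reflexivity). lra. }
  exists (fst (F K)), (snd (F K)). fold (gin (F K)).
  apply outer_le_mono with (fun z =>
     (exists k, in_square z /\ ((A k z /\ ~ gin (E k) z) \/ (~ A k z /\ gin (E k) z))) \/
     (exists k, in_square z /\ gin (D (K + k)%nat) z)) (d / 2 + d / 2); [|lra|].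
  - intros z [Hz [[[k Hk] N]|[N HF]]].
    + destruct (classic (gin (E k) z)) as [HEk|HEk]; [|left; exists k; tauto].
      right. apply NNPP. intros M.
      assert (All : forall n, ~ gin (F (K + n)%nat) z).
      { induction n as [|n IH]; [rewrite Nat.add_0_r; exact N|].
        rewrite Nat.add_succ_r. intros HF. apply gin_union in HF; [|exact Hz].
        destruct HF as [HF|HF]; [tauto|]. apply M. exists n. split; [exact Hz|].
        apply gin_diff; auto. }
      apply (All k). apply EF with k; [exact Hz|lia|exact HEk].
    + destruct (FE K z Hz HF) as [k Hk]. left. exists k. split; [exact Hz|]. right.
      split; [|exact Hk]. intros HA. apply N. exists k. exact HA.
  - apply outer_le_union.
    + apply outer_le_cunion with (1 := HE). intros n. rewrite rsum_scal, rsum_half_pow.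
      assert (0 < (/ 2) ^ n) by (apply pow_lt; lra). nra.
    + apply outer_le_cunion with (r := fun k => garea (D (K + k)%nat)); [|exact Tail].
      intros k. apply outer_le_grid_set.
Qed.

Lemma dist2_le_abs x y : dist2 x y <= Rabs (fst x - fst y) + Rabs (snd x - snd y).
Proof.
  unfold dist2. pose proof (Rabs_pos (fst x - fst y)). pose proof (Rabs_pos (snd x - snd y)).
  rewrite <- (pow2_abs (fst x - fst y)), <- (pow2_abs (snd x - snd y)).
  apply Rle_trans with (sqrt ((Rabs (fst x - fst y) + Rabs (snd x - snd y)) ^ 2)).
  - apply sqrt_le_1_alt. nra.
  - rewrite sqrt_pow2; lra.
Qed.

(** An open set is the union, over all levels, of the cells whose closure it contains: a cell of
    side below [r / 2] has l1 diameter below [r]. *)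
Lemma grid_approx_open U : open2 U -> grid_approx U.
Proof.
  intros HU.
  set (E := fun n i j => if excluded_middle_informative (forall z, in_rect (cell n i j) z -> U z) then true else false).
  apply grid_approx_ext with (fun z => exists n, grid_set n (E n) z).
  - intros z Hz. split.
    + intros [n Hn]. unfold grid_set, E in Hn. destruct excluded_middle_informative as [H|]; [|discriminate].
      apply H. apply in_cell; apply Hz.
    + intros Uz. destruct (HU z Uz) as (r & Hr & Hball).
      destruct (pow_half_small (r / 2) ltac:(lra)) as [n Hn]. exists n. unfold grid_set, E.
      destruct excluded_middle_informative as [|N]; [reflexivity|]. exfalso. apply N. intros w Hw.
      apply Hball. apply Rle_lt_trans with (1 := dist2_le_abs z w).
      pose proof (in_cell n z ltac:(apply Hz) ltac:(apply Hz)) as Hc.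
      rewrite pow_inv in Hn. pose proof (pow2_pos n).
      unfold in_rect, cell in Hw, Hc. cbn [ra rb rc rd] in Hw, Hc. rewrite !S_INR in Hw, Hc.
      unfold Rdiv in *. rewrite !Rmult_plus_distr_r, !Rmult_1_l in Hw, Hc.
      unfold Rabs. destruct Rcase_abs, Rcase_abs; lra.
  - apply grid_approx_cunion. intros n. apply grid_approx_grid_set.
Qed.

Lemma grid_approx_borel A : borel2 A -> grid_approx A.
Proof.
  induction 1; [apply grid_approx_open|apply grid_approx_compl|apply grid_approx_cunion]; assumption.
Qed.

(** Of the symmetric difference only the part of the complement missed by [G] is retained. The lower
    bound on the area of [G] comes from covering the square by [A], [G] and that part; the upper
    bound from covering [A] by the cells outside [G] and the error set. *)
Lemma borel_complement_grid A mA d : borel2 A -> (forall z, A z -> in_square z) -> lebesgue2 A mA -> 0 < d ->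
  exists n G, outer_le (fun z => in_square z /\ ~ A z /\ ~ grid_set n G z) d /\
    1 - mA - d <= grid_area n G <= 1 - mA + d.
Proof.
  intros HB HQ HL Hd. destruct (grid_approx_borel A HB d Hd) as (n & E & HE).
  exists n, (fun i j => negb (E i j)).
  assert (O1 : outer_le (fun z => in_square z /\ ~ A z /\ ~ grid_set n (fun i j => negb (E i j)) z) d).
  { apply outer_le_mono with (3 := HE); [|lra]. intros z (Hz & NA & NG). split; [exact Hz|].
    rewrite grid_set_negb in NG. right. split; [exact NA|]. tauto. }
  split; [exact O1|]. split.
  - assert (1 <= mA + (grid_area n (fun i j => negb (E i j)) + d)); [|lra].
    apply outer_le_square.
    apply outer_le_mono with (fun z => A z \/ ((in_square z /\ grid_set n (fun i j => negb (E i j)) z) \/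
      (in_square z /\ ~ A z /\ ~ grid_set n (fun i j => negb (E i j)) z)))
      (mA + (grid_area n (fun i j => negb (E i j)) + d)); [intros z Hz; tauto|lra|].
    apply outer_le_union; [apply lebesgue2_outer_le, HL|].
    apply outer_le_union; [apply outer_le_grid_set|exact O1].
  - rewrite grid_area_negb. assert (mA <= grid_area n E + d); [|lra].
    apply lebesgue2_le with (1 := HL).
    apply outer_le_mono with (fun z => (in_square z /\ grid_set n E z) \/
      in_square z /\ ((A z /\ ~ grid_set n E z) \/ (~ A z /\ grid_set n E z))) (grid_area n E + d).
    + intros z Hz. specialize (HQ z Hz). tauto.
    + lra.
    + apply outer_le_union; [apply outer_le_grid_set|exact HE].
Qed.

Lemma Rabs_bounds x a : Rabs x <= a -> - a <= x <= a.
Proof. intros H. pose proof (Rle_abs x). pose proof (Rle_abs (- x)). rewrite Rabs_Ropp in *. lra. Qed.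

(** * Piecewise linear interpolation *)

Definition clamp (t : R) : R := Rmax 0 (Rmin 1 t).

(* The piecewise linear function with value [a i] at [t = i] for [i <= n], constant outside [0, n]. *)
Definition pl (n : nat) (a : nat -> R) (t : R) : R :=
  a O + rsum n (fun i => (a (S i) - a i) * clamp (t - INR i)).

Lemma pl_above n a t : INR n <= t -> pl n a t = a n.
Proof.
  induction n as [|n IH]; intros H; [unfold pl; simpl; lra|].
  rewrite S_INR in H. specialize (IH ltac:(lra)). unfold pl in *. cbn [rsum].
  replace (clamp (t - INR n)) with 1; [lra|].
  unfold clamp, Rmax, Rmin. repeat destruct Rle_dec; lra.
Qed.

Lemma pl_below n a t : t <= 0 -> pl n a t = a O.
Proof.
  intros H. unfold pl. rewrite (rsum_ext _ _ (fun _ => 0)); [rewrite rsum_const; lra|].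
  intros i _. pose proof (pos_INR i). replace (clamp (t - INR i)) with 0; [lra|].
  unfold clamp, Rmax, Rmin. repeat destruct Rle_dec; lra.
Qed.

Lemma pl_last n a t : INR n <= t <= INR n + 1 -> pl (S n) a t = a n + (a (S n) - a n) * (t - INR n).
Proof.
  intros H. pose proof (pl_above n a t ltac:(lra)) as E. unfold pl in *. cbn [rsum].
  replace (clamp (t - INR n)) with (t - INR n); [lra|].
  unfold clamp, Rmax, Rmin. repeat destruct Rle_dec; lra.
Qed.

Lemma pl_succ n a t : t <= INR n -> pl (S n) a t = pl n a t.
Proof.
  intros H. unfold pl. cbn [rsum]. replace (clamp (t - INR n)) with 0; [lra|].
  unfold clamp, Rmax, Rmin. repeat destruct Rle_dec; lra.
Qed.

Lemma pl_cell n a t k : (k < n)%nat -> INR k <= t <= INR k + 1 ->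
  pl n a t = a k + (a (S k) - a k) * (t - INR k).
Proof.
  intros Hk Ht. induction Hk as [|n Hk IH]; [apply pl_last, Ht|].
  rewrite pl_succ; [exact IH|]. apply le_INR in Hk. rewrite S_INR in Hk. lra.
Qed.

Lemma pl_bounded n a t L : (forall i, (i <= n)%nat -> Rabs (a i) <= L) -> Rabs (pl n a t) <= L.
Proof.
  intros H. induction n as [|n IH]; [unfold pl; simpl; rewrite Rplus_0_r; apply H; lia|].
  destruct (Rle_lt_dec t (INR n)) as [Ht|Ht]; [rewrite pl_succ by exact Ht; apply IH; intros; apply H; lia|].
  pose proof (H n ltac:(lia)) as H1. pose proof (H (S n) ltac:(lia)) as H2.
  apply Rabs_bounds in H1. apply Rabs_bounds in H2. apply Rabs_le.
  destruct (Rle_lt_dec t (INR n + 1)) as [Ht'|Ht'].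
  - rewrite pl_last by lra. set (s := t - INR n). assert (0 <= s <= 1) by (unfold s; lra). nra.
  - rewrite pl_above by (rewrite S_INR; lra). exact H2.
Qed.

Lemma pl_minus n a b t : pl n a t - pl n b t = pl n (fun i => a i - b i) t.
Proof.
  unfold pl.
  assert (E : rsum n (fun i => (a (S i) - b (S i) - (a i - b i)) * clamp (t - INR i)) =
    rsum n (fun i => (a (S i) - a i) * clamp (t - INR i)) +
    (-1) * rsum n (fun i => (b (S i) - b i) * clamp (t - INR i))).
  { rewrite <- rsum_scal, <- rsum_plus. apply rsum_ext. intros i _. ring. }
  rewrite E. ring.
Qed.

Lemma rsum_clamp n t : rsum n (fun i => clamp (t - INR i)) = Rmin (INR n) (Rmax 0 t).
Proof.
  induction n as [|n IH].
  - simpl. unfold Rmin, Rmax. repeat destruct Rle_dec; lra.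
  - cbn [rsum]. rewrite IH, S_INR. pose proof (pos_INR n).
    unfold clamp, Rmin, Rmax. repeat destruct Rle_dec; lra.
Qed.

(** The increments of the clamps are nonnegative and add up to at most the distance of the
    arguments; the differences of [a] enter only as coefficients bounded by [L]. *)
Lemma pl_lipschitz n a L t t' : 0 <= L -> (forall i, (i < n)%nat -> Rabs (a (S i) - a i) <= L) ->
  Rabs (pl n a t - pl n a t') <= L * Rabs (t - t').
Proof.
  intros HL H.
  assert (W : forall x y, x <= y -> Rabs (pl n a y - pl n a x) <= L * (y - x)).
  { intros x y Hxy.
    assert (E : pl n a y - pl n a x = rsum n (fun i => (a (S i) - a i) * (clamp (y - INR i) - clamp (x - INR i)))).
    { unfold pl. rewrite (rsum_ext n (fun i => (a (S i) - a i) * (clamp (y - INR i) - clamp (x - INR i)))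
        (fun i => (a (S i) - a i) * clamp (y - INR i) + (-1) * ((a (S i) - a i) * clamp (x - INR i)))).
      - rewrite rsum_plus, rsum_scal. ring.
      - intros; ring. }
    assert (D : rsum n (fun i => clamp (y - INR i) - clamp (x - INR i)) <= y - x).
    { rewrite (rsum_ext n _ (fun i => clamp (y - INR i) + (-1) * clamp (x - INR i))) by (intros; ring).
      rewrite rsum_plus, rsum_scal, !rsum_clamp. pose proof (pos_INR n).
      unfold Rmin, Rmax. repeat destruct Rle_dec; lra. }
    assert (P : forall i, 0 <= clamp (y - INR i) - clamp (x - INR i)).
    { intros i. unfold clamp, Rmax, Rmin. repeat destruct Rle_dec; lra. }
    apply Rle_trans with (L * rsum n (fun i => clamp (y - INR i) - clamp (x - INR i)));
      [|apply Rmult_le_compat_l; assumption].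
    rewrite E, <- rsum_scal. apply Rabs_le. split.
    - rewrite <- (Rmult_1_l (rsum n (fun k => L * _))), <- Ropp_mult_distr_l_reverse, <- rsum_scal.
      apply rsum_le. intros i Hi. specialize (H i Hi). apply Rabs_bounds in H. specialize (P i). nra.
    - apply rsum_le. intros i Hi. specialize (H i Hi). apply Rabs_bounds in H. specialize (P i). nra. }
  destruct (Rle_lt_dec t t') as [Ht|Ht].
  - rewrite Rabs_minus_sym, (Rabs_minus_sym t t'), (Rabs_pos_eq (t' - t)) by lra. apply W, Ht.
  - rewrite (Rabs_pos_eq (t - t')) by lra. apply W. lra.
Qed.

(** * Shears *)

Definition shear (t : R) (U : R -> R -> R) (z : pt) : pt :=
  (fst z + t * U (fst z) (snd z), snd z).

Definition lipschitz1 (L : R) (U : R -> R -> R) : Prop :=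
  forall x y x' y', Rabs (U x y - U x' y') <= L * (Rabs (x - x') + Rabs (y - y')).

Lemma rsum_midpoints K : rsum K (fun k => INR k + / 2) = INR K ^ 2 / 2.
Proof. induction K as [|K IH]; [simpl; lra|]. rewrite S_INR. cbn [rsum]. rewrite IH. field. Qed.

Lemma slice_exists c h y K : 0 <= h -> c <= y <= c + INR K * h -> (0 < K)%nat ->
  exists k, (k < K)%nat /\ c + INR k * h <= y <= c + INR (S k) * h.
Proof.
  intros Hh Hy HK. induction K as [|K IH]; [lia|].
  destruct (Rle_lt_dec (c + INR K * h) y) as [H|H].
  - exists K. split; [lia|]. lra.
  - destruct K as [|K]; [simpl in H; lra|].
    destruct IH as (k & Hk & Hk'); [lra|lia|]. exists k. split; [lia|exact Hk'].
Qed.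

(** The bound is the integral of the affine function [p + q * (y - c)] that dominates the width. The
    region is cut into [K] horizontal slices, each covered by one rectangle. *)
Lemma outer_le_between S c d (al be : R -> R) Lam p q : c <= d -> 0 <= Lam ->
  (forall y y', c <= y <= d -> c <= y' <= d -> Rabs (al y - al y') <= Lam * Rabs (y - y')) ->
  (forall y y', c <= y <= d -> c <= y' <= d -> Rabs (be y - be y') <= Lam * Rabs (y - y')) ->
  (forall y, c <= y <= d -> al y <= be y <= al y + p + q * (y - c)) ->
  (forall z, S z -> c <= snd z <= d /\ al (snd z) <= fst z <= be (snd z)) ->
  outer_le S ((d - c) * (p + q * (d - c) / 2)).
Proof.
  intros Hcd HL Hal Hbe Hw HS. apply outer_le_lim. intros e He.
  destruct (INR_unbounded (Lam * (d - c) ^ 2 / e)) as [K HK].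
  assert (HK0 : (0 < K)%nat).
  { apply INR_lt. simpl. apply Rle_lt_trans with (2 := HK).
    apply Rmult_le_pos; [apply Rmult_le_pos; [exact HL|apply pow2_ge_0]|apply Rlt_le, Rinv_0_lt_compat, He]. }
  assert (KR : 0 < INR K) by (apply lt_0_INR; exact HK0).
  set (h := (d - c) / INR K).
  assert (Hh : 0 <= h) by (apply Rmult_le_pos; [lra|apply Rlt_le, Rinv_0_lt_compat, KR]).
  assert (Kh : INR K * h = d - c) by (unfold h; field; lra).
  (* The midpoint rule is exact for affine functions. The only error is the margin [Lam * h] in each
     width, in total [Lam * (d - c) ^ 2 / INR K], which the choice of [K] puts below [e]. *)
  set (ym := fun k => c + (INR k + / 2) * h).
  set (C := fun k => mkRect (al (ym k) - Lam * h / 2) (be (ym k) + Lam * h / 2) (c + INR k * h) (c + INR (Datatypes.S k) * h)).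
  assert (Hym : forall k, (k < K)%nat -> c <= ym k <= d).
  { intros k Hk. unfold ym. pose proof (pos_INR k).
    assert (INR k + 1 <= INR K) by (rewrite <- S_INR; apply le_INR; lia). nra. }
  assert (Lh : 0 <= Lam * h) by (apply Rmult_le_pos; assumption).
  apply outer_le_mono with (fun z => exists k, (k < K)%nat /\ in_rect (C k) z)
    (rsum K (fun k => h * (p + q * (INR k + / 2) * h + Lam * h))).
  - intros z Hz. destruct (HS z Hz) as [Hy Hx].
    destruct (slice_exists c h (snd z) K Hh ltac:(lra) HK0) as (k & Hk & Hk').
    exists k. split; [exact Hk|]. specialize (Hym k Hk).
    assert (Dy : Rabs (snd z - ym k) <= h / 2).
    { apply Rabs_le. unfold ym. rewrite S_INR in Hk'. lra. }
    assert (Dm : Lam * Rabs (snd z - ym k) <= Lam * h / 2).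
    { unfold Rdiv. rewrite Rmult_assoc. apply Rmult_le_compat_l; assumption. }
    pose proof (Hal (snd z) (ym k) Hy Hym) as A1. pose proof (Hbe (snd z) (ym k) Hy Hym) as A2.
    assert (A3 : Rabs (al (snd z) - al (ym k)) <= Lam * h / 2) by lra.
    assert (A4 : Rabs (be (snd z) - be (ym k)) <= Lam * h / 2) by lra.
    apply Rabs_bounds in A3. apply Rabs_bounds in A4.
    unfold in_rect, C. cbn [ra rb rc rd]. lra.
  - assert (E : rsum K (fun k => h * (p + q * (INR k + / 2) * h + Lam * h)) =
      INR K * h * (p + Lam * h) + q * (INR K * h) ^ 2 / 2).
    { rewrite (rsum_ext K _ (fun k => h * (p + Lam * h) + q * h ^ 2 * (INR k + / 2))) by (intros; ring).
      rewrite rsum_plus, rsum_const, rsum_scal, rsum_midpoints. field. }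
    rewrite E, Kh.
    assert (F : (d - c) * (Lam * h) <= e).
    { unfold h. apply Rmult_le_reg_r with (INR K); [exact KR|].
      replace ((d - c) * (Lam * ((d - c) / INR K)) * INR K) with (Lam * (d - c) ^ 2) by (field; lra).
      apply Rmult_lt_compat_r with (r := e) in HK; [|exact He].
      unfold Rdiv in HK. rewrite Rmult_assoc, Rinv_l, Rmult_1_r in HK by lra. lra. }
    lra.
  - apply outer_le_fin with (S := fun k => in_rect (C k)). intros k Hk. specialize (Hym k Hk).
    specialize (Hw _ Hym).
    assert (Ym : ym k - c = (INR k + / 2) * h) by (unfold ym; ring).
    apply outer_le_mono with (in_rect (C k)) (area (C k)); [auto| |apply outer_le_rect].
    + unfold area, C. cbn [ra rb rc rd]. rewrite S_INR.
      replace ((be (ym k) + Lam * h / 2 - (al (ym k) - Lam * h / 2)) * (c + (INR k + 1) * h - (c + INR k * h)))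
        with (h * (be (ym k) - al (ym k) + Lam * h)) by field.
      apply Rmult_le_compat_l; [exact Hh|]. rewrite Ym in Hw. lra.
    + split; unfold C; cbn [ra rb rc rd]; rewrite ?S_INR; lra.
Qed.

Section Shear.
Variables (t L : R) (U : R -> R -> R).
Hypotheses (Ht : 0 <= t) (HL : 0 <= L) (HtL : t * L <= 1) (HU : lipschitz1 L U).

Lemma shear_edge_lipschitz x y y' :
  Rabs (x + t * U x y - (x + t * U x y')) <= t * L * Rabs (y - y').
Proof.
  replace (x + t * U x y - (x + t * U x y')) with (t * (U x y - U x y')) by ring.
  rewrite Rabs_mult, (Rabs_pos_eq t) by exact Ht. rewrite Rmult_assoc.
  apply Rmult_le_compat_l; [exact Ht|]. pose proof (HU x y x y') as H.
  replace (x - x) with 0 in H by ring. rewrite Rabs_R0 in H. lra.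
Qed.

Lemma shear_x_bounds x x' y : x <= x' ->
  x + t * U x y <= x' + t * U x' y <= x + t * U x y + (1 + t * L) * (x' - x).
Proof.
  intros Hx. pose proof (HU x' y x y) as H. replace (y - y) with 0 in H by ring.
  rewrite Rabs_R0, Rplus_0_r, (Rabs_pos_eq (x' - x)) in H by lra. apply Rabs_bounds in H.
  assert (t * (U x' y - U x y) <= t * (L * (x' - x))) by (apply Rmult_le_compat_l; lra).
  assert (t * - (L * (x' - x)) <= t * (U x' y - U x y)) by (apply Rmult_le_compat_l; lra).
  assert (0 <= (1 - t * L) * (x' - x)) by (apply Rmult_le_pos; lra). lra.
Qed.

(** The shear keeps [y] and is monotone in [x] because [t * L <= 1], so the image lies between the
    images of the two vertical sides, which are Lipschitz graphs over [y]. *)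
Lemma outer_le_shear_rect C p q : rect_ok C ->
  (forall y, rc C <= y <= rd C ->
    rb C + t * U (rb C) y <= ra C + t * U (ra C) y + p + q * (y - rc C)) ->
  outer_le (image (shear t U) (in_rect C)) ((rd C - rc C) * (p + q * (rd C - rc C) / 2)).
Proof.
  intros [O1 O2] Hw.
  apply outer_le_between with (al := fun y => ra C + t * U (ra C) y) (be := fun y => rb C + t * U (rb C) y)
    (Lam := t * L); [exact O2|apply Rmult_le_pos; assumption| | | |].
  - intros. apply shear_edge_lipschitz.
  - intros. apply shear_edge_lipschitz.
  - intros y Hy. split; [apply shear_x_bounds; lra|]. apply Hw, Hy.
  - intros z (w & [W1 W2] & ->). unfold shear. cbn [fst snd]. split; [exact W2|].
    split; apply shear_x_bounds; lra.
Qed.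

(** The factor 2 bounds the horizontal stretch [1 + t * L]. It is crude, but meant for the small
    error set. *)
Lemma outer_le_shear S r : outer_le S r -> outer_le (image (shear t U) S) (2 * r).
Proof.
  intros H. apply outer_le_lim. intros d Hd.
  destruct (H (d / 2) ltac:(lra)) as (C & C1 & C2 & C3).
  apply outer_le_mono with (fun z => exists n, image (shear t U) (in_rect (C n)) z) (2 * r + d); [|lra|].
  - intros z (w & Hw & ->). destruct (C2 w Hw) as [n Hn]. exists n, w. auto.
  - apply outer_le_cunion with (r := fun n => 2 * area (C n)).
    + intros n. destruct (C1 n) as [O1 O2].
      apply outer_le_mono with (image (shear t U) (in_rect (C n)))
        ((rd (C n) - rc (C n)) * (2 * (rb (C n) - ra (C n)) + 0 * (rd (C n) - rc (C n)) / 2)); [auto| |].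
      * unfold area. right. field.
      * apply outer_le_shear_rect; [apply C1|]. intros y _.
        pose proof (shear_x_bounds (ra (C n)) (rb (C n)) y O1).
        assert (0 <= (1 - t * L) * (rb (C n) - ra (C n))) by (apply Rmult_le_pos; lra). lra.
    + intros n. rewrite rsum_scal. specialize (C3 n). lra.
Qed.

Lemma shear_surjective y x' : (forall y, U 0 y = 0) -> (forall y, U 1 y = 0) -> 0 <= x' <= 1 ->
  exists x, 0 <= x <= 1 /\ x + t * U x y = x'.
Proof.
  intros U0 U1 Hx.
  assert (Cont : continuity (fun x => x + t * U x y - x')).
  { intros x e He. exists (e / 2). split; [lra|]. intros w [_ Hw]. simpl in *. unfold Rdist in *.
    destruct (Rle_lt_dec x w) as [Hxw|Hxw].
    - pose proof (shear_x_bounds x w y Hxw).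
      assert ((1 + t * L) * (w - x) <= 2 * (w - x)) by (apply Rmult_le_compat_r; lra).
      apply Rabs_def2 in Hw. apply Rabs_def1; lra.
    - pose proof (shear_x_bounds w x y ltac:(lra)).
      assert ((1 + t * L) * (x - w) <= 2 * (x - w)) by (apply Rmult_le_compat_r; lra).
      apply Rabs_def2 in Hw. apply Rabs_def1; lra. }
  destruct (IVT_cor (fun x => x + t * U x y - x') 0 1 Cont ltac:(lra)) as (x & H1 & H2).
  - simpl. rewrite U0, U1. nra.
  - exists x. split; [exact H1|]. lra.
Qed.

End Shear.

Lemma dist2_shift x y a : let D := dist2 x y in
  dist2 (fst x + a, snd x) y <= D + Rabs a /\ D - Rabs a <= dist2 (fst x + a, snd x) y.
Proof.
  intros D. set (dx := fst x - fst y). set (dy := snd x - snd y).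
  assert (ED : D = sqrt (dx ^ 2 + dy ^ 2)) by reflexivity.
  assert (E' : dist2 (fst x + a, snd x) y = sqrt ((dx + a) ^ 2 + dy ^ 2)).
  { unfold dist2, dx, dy. cbn [fst snd]. f_equal. ring. }
  assert (DP : 0 <= D) by apply sqrt_pos.
  assert (D2 : D ^ 2 = dx ^ 2 + dy ^ 2).
  { rewrite ED. rewrite pow2_sqrt; [reflexivity|]. nra. }
  assert (Dx : Rabs dx <= D).
  { rewrite ED, <- (sqrt_pow2 (Rabs dx)) by apply Rabs_pos. apply sqrt_le_1_alt. rewrite pow2_abs. nra. }
  pose proof (Rabs_pos a) as PA.
  assert (Ma : Rabs (dx * a) <= D * Rabs a).
  { rewrite Rabs_mult. apply Rmult_le_compat_r; assumption. }
  apply Rabs_bounds in Ma. pose proof (pow2_abs a) as SA.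
  rewrite E'. split.
  - rewrite <- (sqrt_pow2 (D + Rabs a)) by lra. apply sqrt_le_1_alt. nra.
  - destruct (Rle_lt_dec D (Rabs a)) as [H|H]; [pose proof (sqrt_pos ((dx + a) ^ 2 + dy ^ 2)); lra|].
    rewrite <- (sqrt_pow2 (D - Rabs a)) by lra. apply sqrt_le_1_alt. nra.
Qed.

Definition admissible (eta : R) (phi : pt -> pt) : Prop :=
  square_bijection phi /\
  (forall x y, in_square x -> in_square y ->
     / (1 + eta) * dist2 x y <= dist2 (phi x) (phi y) /\ dist2 (phi x) (phi y) <= (1 + eta) * dist2 x y) /\
  (forall x, on_boundary x -> phi x = x).

Lemma abs_le_dist2 x y : Rabs (fst x - fst y) <= dist2 x y /\ Rabs (snd x - snd y) <= dist2 x y.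
Proof.
  pose proof (pow2_ge_0 (fst x - fst y)). pose proof (pow2_ge_0 (snd x - snd y)).
  split; rewrite <- sqrt_Rsqr_abs; apply sqrt_le_1_alt; unfold Rsqr; lra.
Qed.

Lemma shear_admissible eta t L U : 0 < eta -> 0 < L -> t = eta / (2 * L * (1 + eta)) -> lipschitz1 L U ->
  (forall y, U 0 y = 0) -> (forall y, U 1 y = 0) -> (forall x, U x 0 = 0) -> (forall x, U x 1 = 0) ->
  admissible eta (shear t U).
Proof.
  intros He HL Et HU U1 U2 U3 U4.
  assert (Tp : 0 < t) by (rewrite Et; apply Rdiv_lt_0_compat; [lra|apply Rmult_lt_0_compat; lra]).
  (* Two points are displaced relative to each other by at most [2 * (t * L)] times their distance,
     the 2 coming from l1 against Euclidean distance. The value of [t] makes this [1 - / (1 + eta)],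
     exactly what the lower bound permits. *)
  assert (TL : 2 * (t * L) = eta / (1 + eta)) by (rewrite Et; field; lra).
  assert (K1 : eta / (1 + eta) = 1 - / (1 + eta)) by (field; lra).
  assert (K2 : 0 < / (1 + eta)) by (apply Rinv_0_lt_compat; lra).
  assert (K3 : eta / (1 + eta) <= eta).
  { apply Rmult_le_reg_r with (1 + eta); [lra|]. unfold Rdiv. rewrite Rmult_assoc, Rinv_l by lra. nra. }
  assert (TL1 : t * L <= 1) by lra.
  assert (BL : forall x y, / (1 + eta) * dist2 x y <= dist2 (shear t U x) (shear t U y) /\
     dist2 (shear t U x) (shear t U y) <= (1 + eta) * dist2 x y).
  { intros x y. set (a := t * (U (fst x) (snd x) - U (fst y) (snd y))).
    assert (Ed : dist2 (shear t U x) (shear t U y) = dist2 (fst x + a, snd x) y).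
    { unfold dist2, shear, a. cbn [fst snd]. f_equal. ring. }
    destruct (dist2_shift x y a) as [D1 D2]. rewrite Ed.
    destruct (abs_le_dist2 x y) as [A1 A2].
    assert (Aa : Rabs a <= eta / (1 + eta) * dist2 x y).
    { unfold a. rewrite Rabs_mult, (Rabs_pos_eq t) by lra. rewrite <- TL.
      apply Rle_trans with (t * (L * (Rabs (fst x - fst y) + Rabs (snd x - snd y)))).
      - apply Rmult_le_compat_l; [lra|apply HU].
      - replace (2 * (t * L) * dist2 x y) with (t * (L * (2 * dist2 x y))) by ring.
        apply Rmult_le_compat_l; [lra|]. apply Rmult_le_compat_l; lra. }
    assert (DP : 0 <= dist2 x y) by apply sqrt_pos.
    rewrite K1 in Aa, K3. split; nra. }
  split; [|split; [intros; apply BL|]].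
  - split; [|split].
    + intros [x y] [H1 H2]. unfold shear. split; cbn [fst snd] in *; [|exact H2].
      pose proof (shear_x_bounds t L U (Rlt_le _ _ Tp) TL1 HU 0 x y ltac:(lra)) as B1.
      pose proof (shear_x_bounds t L U (Rlt_le _ _ Tp) TL1 HU x 1 y ltac:(lra)) as B2.
      rewrite U1 in B1. rewrite U2 in B2. lra.
    + intros x y _ _ E. destruct (BL x y) as [B _]. rewrite E in B.
      assert (Z : dist2 (shear t U y) (shear t U y) = 0).
      { unfold dist2. rewrite !Rminus_diag, pow_i by lia. rewrite Rplus_0_r. apply sqrt_0. }
      rewrite Z in B. assert (dist2 x y <= 0) by (apply Rmult_le_reg_l with (/ (1 + eta)); lra).
      destruct (abs_le_dist2 x y) as [A1 A2]. 
      assert (Z1 : Rabs (fst x - fst y) <= 0) by lra. assert (Z2 : Rabs (snd x - snd y) <= 0) by lra.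
      apply Rabs_bounds in Z1. apply Rabs_bounds in Z2. destruct x, y; cbn [fst snd] in *. f_equal; lra.
    + intros [x' y] [H1 H2]. cbn [fst snd] in *.
      destruct (shear_surjective t L U (Rlt_le _ _ Tp) TL1 HU y x' U1 U2 H1) as (x & Hx & E).
      exists (x, y). split; [split; cbn [fst snd]; assumption|]. unfold shear. cbn [fst snd]. f_equal. exact E.
  - intros [x y] [_ H]. unfold shear. cbn [fst snd] in *.
    destruct H as [-> | [-> | [-> | ->]]]; rewrite ?U1, ?U2, ?U3, ?U4; f_equal; ring.
Qed.

(** * Exchange of the coordinates *)

Definition swap (z : pt) : pt := (snd z, fst z).

Lemma swap_swap z : swap (swap z) = z.
Proof. destruct z; reflexivity. Qed.

Lemma dist2_swap x y : dist2 (swap x) (swap y) = dist2 x y.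
Proof. unfold dist2, swap. cbn [fst snd]. f_equal. ring. Qed.

Lemma in_square_swap z : in_square z -> in_square (swap z).
Proof. intros [H1 H2]. split; assumption. Qed.

Lemma outer_le_swap S r : outer_le S r -> outer_le (fun z => S (swap z)) r.
Proof.
  intros H d Hd. destruct (H d Hd) as (C & C1 & C2 & C3).
  exists (fun n => mkRect (rc (C n)) (rd (C n)) (ra (C n)) (rb (C n))). split; [|split].
  - intros n. destruct (C1 n). split; assumption.
  - intros z Hz. destruct (C2 _ Hz) as [n [K1 K2]]. exists n. split; assumption.
  - intros n. rewrite (rsum_ext n _ (fun k => area (C k))); [apply C3|]. intros k _. unfold area. simpl. ring.
Qed.

Lemma admissible_swap eta phi : admissible eta phi -> admissible eta (fun z => swap (phi (swap z))).
Proof.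
  intros [[B1 [B2 B3]] [BL BD]]. split; [|split].
  - split; [|split].
    + intros x Hx. apply in_square_swap, B1, in_square_swap, Hx.
    + intros x y Hx Hy E. apply (f_equal swap) in E. rewrite !swap_swap in E.
      apply B2 in E; try (apply in_square_swap; assumption). rewrite <- (swap_swap x), E. apply swap_swap.
    + intros y Hy. destruct (B3 (swap y) (in_square_swap y Hy)) as (x & Hx & E).
      exists (swap x). split; [apply in_square_swap, Hx|]. rewrite swap_swap, E. apply swap_swap.
  - intros x y Hx Hy. rewrite dist2_swap, <- (dist2_swap x y). apply BL; apply in_square_swap; assumption.
  - intros x [Hx Hb]. rewrite BD; [apply swap_swap|]. split; [apply in_square_swap, Hx|]. simpl. tauto.
Qed.

(** * The interpolated shear of a grid function *)

(** Bilinear on each cell. Dividing by [2 ^ n] turns the differences of [u] into slopes, so the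
    Lipschitz constant does not depend on [n]. *)
Definition interpolation (n : nat) (u : nat -> nat -> R) (x y : R) : R :=
  pl (2 ^ n) (fun i => pl (2 ^ n) (u i) (2 ^ n * y)) (2 ^ n * x) / 2 ^ n.

Definition grid_lipschitz (L : R) (u : nat -> nat -> R) : Prop :=
  (forall i j, Rabs (u (S i) j - u i j) <= L) /\ (forall i j, Rabs (u i (S j) - u i j) <= L).

Definition grid_vanishing (n : nat) (u : nat -> nat -> R) : Prop :=
  forall i j, (i <= 2 ^ n)%nat -> (j <= 2 ^ n)%nat ->
    (i = 0 \/ i = 2 ^ n \/ j = 0 \/ j = 2 ^ n)%nat -> u i j = 0.

(* [2 * 4 ^ n] times the integral over the grid set [E] of the x-derivative of [interpolation n u]. *)
Definition grid_flux (n : nat) (E : nat -> nat -> bool) (u : nat -> nat -> R) : R :=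
  rsum (2 ^ n) (fun i => rsum (2 ^ n) (fun j => b2r (E i j) *
    ((u (S i) j - u i j) + (u (S i) (S j) - u i (S j))))).

Section Interpolation.
Variables (n : nat) (u : nat -> nat -> R) (L : R).
Hypotheses (HL : 0 < L) (Hu : grid_lipschitz L u) (H0 : grid_vanishing n u).

Lemma interpolation_lipschitz : lipschitz1 L (interpolation n u).
Proof.
  intros x y x' y'. unfold interpolation. pose proof (pow2_pos n) as P.
  set (a := fun i => pl (2 ^ n) (u i) (2 ^ n * y)). set (a' := fun i => pl (2 ^ n) (u i) (2 ^ n * y')).
  assert (E1 : Rabs (pl (2 ^ n) a (2 ^ n * x) - pl (2 ^ n) a (2 ^ n * x')) <= L * (2 ^ n * Rabs (x - x'))).
  { replace (2 ^ n * Rabs (x - x')) with (Rabs (2 ^ n * x - 2 ^ n * x')).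
    - apply pl_lipschitz; [lra|]. intros i _. unfold a. rewrite pl_minus. apply pl_bounded. intros; apply Hu.
    - rewrite <- Rmult_minus_distr_l, Rabs_mult, (Rabs_pos_eq (2 ^ n)); lra. }
  assert (E2 : Rabs (pl (2 ^ n) a (2 ^ n * x') - pl (2 ^ n) a' (2 ^ n * x')) <= L * (2 ^ n * Rabs (y - y'))).
  { rewrite pl_minus. apply pl_bounded. intros i _. unfold a, a'.
    replace (2 ^ n * Rabs (y - y')) with (Rabs (2 ^ n * y - 2 ^ n * y')).
    - apply pl_lipschitz; [lra|]. intros; apply Hu.
    - rewrite <- Rmult_minus_distr_l, Rabs_mult, (Rabs_pos_eq (2 ^ n)); lra. }
  unfold Rdiv. rewrite <- Rmult_minus_distr_r, Rabs_mult, (Rabs_pos_eq (/ 2 ^ n))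
    by (apply Rlt_le, Rinv_0_lt_compat, P).
  apply Rmult_le_reg_r with (2 ^ n); [exact P|]. rewrite Rmult_assoc, Rinv_l, Rmult_1_r by lra.
  replace (pl (2 ^ n) a (2 ^ n * x) - pl (2 ^ n) a' (2 ^ n * x')) with
    ((pl (2 ^ n) a (2 ^ n * x) - pl (2 ^ n) a (2 ^ n * x')) + (pl (2 ^ n) a (2 ^ n * x') - pl (2 ^ n) a' (2 ^ n * x'))) by ring.
  apply Rle_trans with (1 := Rabs_triang _ _). lra.
Qed.

Lemma pl_zero N a t : (forall i, (i <= N)%nat -> a i = 0) -> pl N a t = 0.
Proof.
  intros H. assert (B : Rabs (pl N a t) <= 0).
  { apply pl_bounded. intros i Hi. rewrite H by exact Hi. rewrite Rabs_R0. lra. }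
  apply Rabs_bounds in B. lra.
Qed.

Lemma interpolation_left y : interpolation n u 0 y = 0.
Proof.
  unfold interpolation. rewrite pl_below by lra. rewrite pl_zero; [lra|].
  intros j Hj. apply H0; auto; lia.
Qed.

Lemma interpolation_right y : interpolation n u 1 y = 0.
Proof.
  unfold interpolation. rewrite pl_above by (rewrite INR_pow2; lra). rewrite pl_zero; [lra|].
  intros j Hj. apply H0; auto.
Qed.

Lemma interpolation_bottom x : interpolation n u x 0 = 0.
Proof.
  unfold interpolation. rewrite pl_zero; [lra|]. intros i Hi. rewrite pl_below by lra. apply H0; auto; lia.
Qed.

Lemma interpolation_top x : interpolation n u x 1 = 0.
Proof.
  unfold interpolation. rewrite pl_zero; [lra|]. intros i Hi.
  rewrite pl_above by (rewrite INR_pow2; lra). apply H0; auto.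
Qed.

Lemma interpolation_edge i j y : (i <= 2 ^ n)%nat -> (j < 2 ^ n)%nat -> INR j / 2 ^ n <= y <= INR (S j) / 2 ^ n ->
  interpolation n u (INR i / 2 ^ n) y = (u i j + (u i (S j) - u i j) * (2 ^ n * y - INR j)) / 2 ^ n.
Proof.
  intros Hi Hj Hyj. pose proof (pow2_pos n) as P. unfold interpolation. f_equal.
  replace (2 ^ n * (INR i / 2 ^ n)) with (INR i) by (field; lra).
  assert (E : forall a, pl (2 ^ n) a (INR i) = a i).
  { intros a. destruct (Nat.eq_dec i (2 ^ n)) as [->|Ni]; [apply pl_above; lra|].
    rewrite (pl_cell (2 ^ n) a (INR i) i) by (lia || lra). ring. }
  rewrite E. apply pl_cell; [exact Hj|]. rewrite S_INR in Hyj. destruct Hyj as [Y1 Y2].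
  split; [apply Rmult_le_reg_r with (/ 2 ^ n)|apply Rmult_le_reg_r with (/ 2 ^ n)];
    try (apply Rinv_0_lt_compat, P).
  - replace (2 ^ n * y * / 2 ^ n) with y by (field; lra). exact Y1.
  - replace (2 ^ n * y * / 2 ^ n) with y by (field; lra). exact Y2.
Qed.

Variables (t : R).
Hypotheses (Ht : 0 <= t) (HtL : t * L <= 1).

(** The interpolation is affine along both vertical edges of the cell, so the width of the image is
    affine in [y], stretched by [1 + t * d0] at the bottom and [1 + t * d1] at the top; its integral
    only sees their average. *)
Lemma outer_le_shear_cell i j : (i < 2 ^ n)%nat -> (j < 2 ^ n)%nat ->
  outer_le (image (shear t (interpolation n u)) (in_rect (cell n i j)))
    (/ 4 ^ n * (1 + t / 2 * ((u (S i) j - u i j) + (u (S i) (S j) - u i (S j))))).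
Proof.
  intros Hi Hj. pose proof (pow2_pos n) as P.
  set (d0 := u (S i) j - u i j). set (d1 := u (S i) (S j) - u i (S j)).
  apply outer_le_mono with (image (shear t (interpolation n u)) (in_rect (cell n i j)))
    ((rd (cell n i j) - rc (cell n i j)) *
     ((/ 2 ^ n + t * d0 / 2 ^ n) + t * (d1 - d0) * (rd (cell n i j) - rc (cell n i j)) / 2)); [auto| |].
  - unfold cell. cbn [rc rd]. rewrite S_INR, pow4_sqr. right. field. lra.
  - apply outer_le_shear_rect with (L := L); try assumption; try lra.
    + apply interpolation_lipschitz.
    + apply cell_ok.
    + unfold cell. cbn [ra rb rc rd]. intros y Hy'.
      rewrite !(fun i H => interpolation_edge i j y H Hj Hy') by lia.
      right. unfold d0, d1. rewrite S_INR. field. lra.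
Qed.

Lemma outer_le_shear_grid_set E c :
  grid_flux n E u <= - c * 4 ^ n ->
  outer_le (image (shear t (interpolation n u)) (fun z => in_square z /\ grid_set n E z))
    (grid_area n E - t * c / 2).
Proof.
  intros Hc. assert (P4 : 0 < 4 ^ n) by (apply pow_lt; lra).
  pose (du := fun i j => (u (S i) j - u i j) + (u (S i) (S j) - u i (S j))).
  change (rsum (2 ^ n) (fun i => rsum (2 ^ n) (fun j => b2r (E i j) * du i j)) <= - c * 4 ^ n) in Hc.
  apply outer_le_mono with (fun z => (in_square z /\ (fst z = 1 \/ snd z = 1)) \/
    exists i j, (i < 2 ^ n)%nat /\ (j < 2 ^ n)%nat /\
      (E i j = true /\ image (shear t (interpolation n u)) (in_rect (cell n i j)) z))
    (0 + rsum (2 ^ n) (fun i => rsum (2 ^ n) (fun j => / 4 ^ n * (b2r (E i j) + t / 2 * (b2r (E i j) * du i j))))).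
  - intros z (w & [Hw1 Hw2] & ->). destruct (grid_set_cells n E w Hw1 Hw2) as [Hs|(i & j & Hi & Hj & He & Hc')].
    (* The right and top sides, which belong to no cell, are fixed by the shear and have measure
       zero. *)
    + left. assert (shear t (interpolation n u) w = w) as ->; [|auto].
      destruct w as [x y]. unfold shear. cbn [fst snd] in *.
      destruct Hs as [->| ->]; rewrite ?interpolation_right, ?interpolation_top; f_equal; ring.
    + right. exists i, j. repeat (split; [assumption|]). exists w. auto.
  - assert (Eq : rsum (2 ^ n) (fun i => rsum (2 ^ n) (fun j => / 4 ^ n * (b2r (E i j) + t / 2 * (b2r (E i j) * du i j)))) =
      grid_area n E + / 4 ^ n * (t / 2) * rsum (2 ^ n) (fun i => rsum (2 ^ n) (fun j => b2r (E i j) * du i j))).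
    { unfold grid_area, Rdiv. rewrite (Rmult_comm _ (/ 4 ^ n)), <- !rsum_scal, <- rsum_plus. apply rsum_ext.
      intros i _. rewrite <- !rsum_scal, <- rsum_plus. apply rsum_ext. intros j _. ring. }
    rewrite Eq. apply Rmult_le_compat_l with (r := / 4 ^ n * (t / 2)) in Hc.
    + replace (/ 4 ^ n * (t / 2) * (- c * 4 ^ n)) with (- (t * c / 2)) in Hc by (field; lra). lra.
    + apply Rmult_le_pos; [apply Rlt_le, Rinv_0_lt_compat, P4|lra].
  - apply outer_le_union; [apply outer_le_sides|].
    apply outer_le_fin2 with (S := fun i j z => E i j = true /\ image (shear t (interpolation n u)) (in_rect (cell n i j)) z).
    intros i j Hi Hj. destruct (E i j) eqn:Ee; simpl b2r.
    + apply outer_le_mono with (3 := outer_le_shear_cell i j Hi Hj); [tauto|]. unfold du. right. ring.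
    + apply outer_le_mono with (fun _ => False) 0; [|lra|apply outer_le_empty]. intros x [H _]. discriminate.
Qed.

End Interpolation.

Lemma shear_gain eta L c n E u : 0 < eta -> 0 < L ->
  grid_lipschitz L u -> grid_vanishing n u ->
  grid_flux n E u <= - c * 4 ^ n ->
  exists phi, admissible eta phi /\
    outer_le (image phi (fun z => in_square z /\ grid_set n E z))
      (grid_area n E - eta / (2 * L * (1 + eta)) * c / 2) /\
    (forall S r, outer_le S r -> outer_le (image phi S) (2 * r)).
Proof.
  intros He HL Hu H0 Hc. set (t := eta / (2 * L * (1 + eta))).
  assert (Tp : 0 < t) by (apply Rdiv_lt_0_compat; [lra|apply Rmult_lt_0_compat; lra]).
  assert (TL : t * L <= 1).
  { unfold t. replace (eta / (2 * L * (1 + eta)) * L) with (/ 2 * (eta / (1 + eta))) by (field; lra).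
    assert (eta / (1 + eta) <= 1).
    { apply Rmult_le_reg_r with (1 + eta); [lra|]. unfold Rdiv. rewrite Rmult_assoc, Rinv_l by lra. lra. }
    lra. }
  pose proof (interpolation_lipschitz n u L HL Hu) as Lip.
  exists (shear t (interpolation n u)). split; [|split].
  - apply shear_admissible with (L := L); try assumption; try reflexivity; intros.
    + apply interpolation_left, H0.
    + apply interpolation_right, H0.
    + apply interpolation_bottom, H0.
    + apply interpolation_top, H0.
  - apply outer_le_shear_grid_set with (L := L); assumption || lra.
  - intros S r HS. apply outer_le_shear with (L := L); assumption || lra.
Qed.

Open Scope R_scope.

(** * Translation of the grid estimate to the standard real numbers *)

Module Transfer.
Import all_boot all_order all_algebra archimedean Rstruct.
Import Order.TTheory GRing.Theory Num.Theory.
Import Discrete.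

Lemma rsum_big n (f : nat -> R) : rsum n f = (\sum_(i < n) f i)%R.
Proof.
elim: n => [|n IH]; first by rewrite big_ord0.
by rewrite big_ord_recr /= IH.
Qed.

Lemma rsum_gsum n (f : nat -> nat -> R) : rsum n (fun i => rsum n (f i)) = gsum (R := R) n f.
Proof. by rewrite rsum_big; apply: eq_bigr => i _; rewrite rsum_big. Qed.

Lemma pow_expn a n : Nat.pow a n = expn a n.
Proof. by elim: n => //= n ->; rewrite expnS. Qed.

Lemma div_divn a m : (0 < m)%N -> Nat.div a m = divn a m.
Proof.
move=> m0; symmetry; apply: (Nat.div_unique a m (divn a m) (modn a m)).
  by apply/ssrnat.ltP; rewrite ltn_mod.
by rewrite {1}(divn_eq a m) mulnC.
Qed.

Lemma pow4 (n : nat) : pow (IZR 4) n = (4 ^+ n)%R.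
Proof. by rewrite RpowE IZRposE INRE. Qed.

Lemma b2r_natr (b : bool) : b2r b = (b%:R : R)%R.
Proof. by case: b. Qed.

Local Open Scope R_scope.

Lemma grid_gain (g : R) : 0 < g -> g <= 1 / 2 ->
  exists L c : R, 0 < L /\ 0 < c /\ forall (a : nat) (G : nat -> nat -> bool),
    g <= grid_area a G <= 1 - g ->
    exists b u, grid_lipschitz L u /\ grid_vanishing (a + b) u /\
      (grid_flux (a + b) (refined b G) u <= - c * 4 ^ (a + b) \/
       grid_flux (a + b) (refined b (fun i j => G j i)) u <= - c * 4 ^ (a + b)).
Proof.
move=> /RltP g0 /RleP g1.
have {}g1 : (g <= 1 / 2)%R by move: g1; rewrite RdivE (IZRposE 2) INRE.
have [L [c [L0 c0 main]]] := grid_shear_gain g0 g1.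
exists L, c; split; first exact/RltP; split; first exact/RltP.
move=> a G [G1 G2].
have p4 : 0 < 4 ^ a by apply: pow_lt; lra.
have area_sum : grid_area a G = gsum (2 ^ a)%N (fun i j => ((G i j)%:R : R)%R) / 4 ^ a.
  rewrite /grid_area pow_expn rsum_gsum; congr (_ / _).
  by apply: eq_gsum => i j _ _; rewrite b2r_natr.
have [|b [u [ux uy u0 uf]]] := main a G.
  apply/andP; split; apply/RleP; rewrite -pow4 -RmultE.
    have := Rmult_le_compat_r _ _ _ (Rlt_le _ _ p4) G1; rewrite area_sum /Rdiv Rmult_assoc Rinv_l; last by lra.
    by rewrite Rmult_1_r.
  have := Rmult_le_compat_r _ _ _ (Rlt_le _ _ p4) G2; rewrite area_sum /Rdiv Rmult_assoc Rinv_l; last by lra.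
  by rewrite Rmult_1_r.
have flux (H : nat -> nat -> bool) : grid_flux (a + b) (refined b H) u =
    gsum (2 ^ (a + b))%N (fun i j => ((H (i %/ 2 ^ b) (j %/ 2 ^ b))%N%:R *
      (xdiff u i j + xdiff u i j.+1))%R).
  rewrite /grid_flux pow_expn rsum_gsum; apply: eq_gsum => i j _ _.
  by rewrite b2r_natr /refined !div_divn ?pow_expn // expn_gt0.
exists b, u; split; last split.
- by split=> i j; rewrite RabsE; apply/RleP; [exact: ux | exact: uy].
- move=> i j; rewrite pow_expn => /ssrnat.leP iN /ssrnat.leP jN h; apply: u0 => //.
  by case: h => [->|[->|[->|->]]]; rewrite eqxx ?orbT.
rewrite !flux !pow4; case: uf => h; [left | right]; exact/RleP.
Qed.

End Transfer.

Theorem theorem3 :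
  forall gamma gamma' eta : R,
    0 < gamma -> gamma < 1 - gamma' -> 1 - gamma' < 1 -> 0 < eta ->
    exists eps : R, 0 < eps /\
      forall (A : pt -> Prop) (mA : R),
        borel2 A -> (forall x, A x -> in_square x) ->
        lebesgue2 A mA -> gamma <= mA <= 1 - gamma' ->
        exists phi : pt -> pt,
          square_bijection phi /\
          (forall x y, in_square x -> in_square y ->
             / (1 + eta) * dist2 x y <= dist2 (phi x) (phi y) /\
             dist2 (phi x) (phi y) <= (1 + eta) * dist2 x y) /\
          (forall x, on_boundary x -> phi x = x) /\
          (forall m, lebesgue2 (image phi A) m -> mA + eps <= m).
Proof.
  intros gamma gamma' eta Hg Hgg Hg' He.
  (* The complement has measure between [gamma'] and [1 - gamma]; halving leaves room for an error
     of at most [g] in the area of the grid set. *)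
  set (g := Rmin gamma gamma' / 2).
  assert (Gp : 0 < Rmin gamma gamma') by (apply Rmin_glb_lt; lra).
  pose proof (Rmin_l gamma gamma') as Gl. pose proof (Rmin_r gamma gamma') as Gr.
  destruct (Transfer.grid_gain g ltac:(unfold g; lra) ltac:(unfold g; lra)) as (L & c & HL & Hc & gain).
  set (e := eta / (2 * L * (1 + eta)) * c / 2).
  assert (Ep : 0 < e).
  { unfold e. apply Rdiv_lt_0_compat; [|lra]. apply Rmult_lt_0_compat; [|exact Hc].
    apply Rdiv_lt_0_compat; [exact He|]. apply Rmult_lt_0_compat; lra. }
  exists (e / 2). split; [lra|].
  intros A mA HB HQ HA Hm.
  (* The area of [G] exceeds the measure of the complement by at most [d], and the image of the
     missed part has outer measure at most [2 * d]; the gain is thus at least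
     [e - 3 * d >= e / 2]. *)
  set (d := Rmin g (e / 6)).
  assert (Dp : 0 < d) by (apply Rmin_glb_lt; unfold g; lra).
  assert (D1 : d <= g) by apply Rmin_l. assert (D2 : d <= e / 6) by apply Rmin_r.
  destruct (borel_complement_grid A mA d HB HQ HA Dp) as (a & G & HG & GA).
  destruct (gain a G ltac:(unfold g in *; lra)) as (b & u & Hu & H0 & Hf).
  assert (exists phi, admissible eta phi /\
     outer_le (image phi (fun z => in_square z /\ grid_set a G z)) (grid_area a G - e) /\
     (forall S r, outer_le S r -> outer_le (image phi S) (2 * r))) as (phi & Had & HphiG & Hphi).
  { destruct Hf as [Hf|Hf];
      destruct (shear_gain eta L c (a + b) _ u He HL Hu H0 Hf) as (phi & P1 & P2 & P3);
      rewrite grid_area_refine in P2; fold e in P2.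
    - exists phi. split; [exact P1|]. split; [|exact P3].
      apply outer_le_mono with (3 := P2); [|lra].
      intros z (w & [W1 W2] & ->). exists w. split; [|reflexivity]. split; [exact W1|].
      apply grid_set_refine; assumption.
    (* Here the horizontal shear compresses the transpose of [G]; conjugation by [swap] turns it
       into a vertical shear for [G]. *)
    - exists (fun z => swap (phi (swap z))). split; [apply admissible_swap, P1|]. split.
      + rewrite grid_area_transpose in P2. apply outer_le_swap in P2.
        apply outer_le_mono with (3 := P2); [|lra].
        intros z (w & [W1 W2] & ->). exists (swap w). rewrite swap_swap. split; [|reflexivity].
        split; [apply in_square_swap, W1|]. apply grid_set_refine; [apply in_square_swap, W1|exact W2].
      + intros S r HS. apply outer_le_swap in HS. apply P3, outer_le_swap in HS.
        apply outer_le_mono with (3 := HS); [|lra].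
        intros z (w & Hw & ->). exists (swap w). rewrite !swap_swap. auto. }
  exists phi. destruct Had as (Bij & Lip & Bd). split; [exact Bij|]. split; [exact Lip|]. split; [exact Bd|].
  intros m [_ Hm2]. apply Hm2. intros s Hs. apply cover_value_outer_le in Hs.
  (* Any cover of the image of [A], of value [s], becomes a cover of the square once the images of
     the two parts of the complement are covered too. *)
  assert (1 <= s + ((grid_area a G - e) + 2 * d)); [|lra].
  apply outer_le_square.
  apply outer_le_mono with (fun z => image phi A z \/
     (image phi (fun z => in_square z /\ grid_set a G z) z \/
      image phi (fun z => in_square z /\ ~ A z /\ ~ grid_set a G z) z))
    (s + ((grid_area a G - e) + 2 * d)); [|lra|].
  - intros z Hz. destruct Bij as (_ & _ & Surj). destruct (Surj z Hz) as (w & Hw & <-).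
    destruct (classic (A w)); [left; exists w; auto|]. right.
    destruct (classic (grid_set a G w)); [left|right]; exists w; auto.
  - apply outer_le_union; [exact Hs|]. apply outer_le_union; [exact HphiG|]. apply Hphi, HG.
Qed.
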